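(* Let $\theta$ be an inner function and let $G\in L^\infty$. (i) $\theta\in\ker D^\theta_G$ if and only if $G \in \overline \theta K_\theta \cap L^\infty$; moreover $\overline\theta K_\theta\cap L^\infty\subset\overline z\, \overline{H^\infty}$. (ii) If the equivalent conditions in (i) hold and $G \ne 0$, then $\ker D^\theta_G = \theta K_{zI}$, where $\overline G= zIO$ with $I$ inner and $O$ outer is the inner--outer factorization.
   Context: $L^2=L^2(\mathbb T)$, $L^\infty=L^\infty(\mathbb T)$, where $\mathbb T$ is the unit circle; $H^2_+=H^2(\mathbb D)$ and $H^\infty$ are the Hardy spaces of the disc identified with boundary functions on $\mathbb T$; $H^2_-=L^2\ominus H^2_+$; bars denote complex conjugation on $\mathbb T$, and $\overline{H^\infty}$ is the set of conjugates of functions in $H^\infty$. For an inner function $\beta$, $K_\beta=H^2_+\ominus\beta H^2_+$. Put $K_\theta^\perp=L^2\ominus K_\theta=H^2_-\oplus\theta H^2_+$ and let $Q_\theta$ be the orthogonal projection of $L^2$ onto $K_\theta^\perp$. The dual truncated Toeplitz operator with symbol $G\in L^\infty$ is $D^\theta_G:K_\theta^\perp\to K_\theta^\perp$, $D^\theta_G f=Q_\theta(Gf)$. *)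

(* Defs.v *)
From mathcomp Require Import all_boot all_order all_algebra.
From mathcomp Require Import complex.
From mathcomp Require Import all_classical all_reals all_analysis.
Import Order.TTheory GRing.Theory Num.Theory numFieldNormedType.Exports.

Set Implicit Arguments.
Unset Strict Implicit.
Unset Printing Implicit Defensive.

Local Open Scope classical_set_scope.
Local Open Scope ring_scope.
Local Open Scope complex_scope.

(* The unit circle is parametrized by t |-> exp(i t), 0 <= t < 2 pi: a function
   on the circle is a function f : R -> R[i], f t being its value at exp(i t).
   Only the values on [0, 2 pi[ matter. Instead of classes modulo almost
   everywhere equality we use functions; all the spaces below are closed under
   almost everywhere equality among the measurable functions, so an equality of
   two such sets is an equality of the corresponding spaces of classes. *)

Section circle.
Variable R : realType.
Local Notation C := R[i].
Local Notation modulus := (@ComplexField.Normc.normc R).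
Local Notation mu := (@lebesgue_measure R).

Definition circ : set R := `[0, pi *+ 2[.

Definition expi (t : R) : C := cos t +i* sin t.

Definition cexp (w : C) : C :=
  (expR (complex.Re w))%:C * expi (complex.Im w).

Definition cmeasurable (f : R -> C) : Prop :=
  measurable_fun circ (fun t => complex.Re (f t)) /\
  measurable_fun circ (fun t => complex.Im (f t)).

Definition ceq (f g : R -> C) : Prop := ae_eq mu circ f g.

(* integral with respect to the normalized arc length dt / (2 pi) *)
Definition cintegral (f : R -> C) : C :=
  ((pi *+ 2)^-1)%:C *
  ((\int[mu]_(t in circ) complex.Re (f t))%R +i*
   (\int[mu]_(t in circ) complex.Im (f t))%R).

Definition L2 : set (R -> C) :=
  [set f | cmeasurable f /\
           mu.-integrable circ (fun t => ((modulus (f t)) ^+ 2)%:E)].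

Definition Linfty : set (R -> C) :=
  [set f | cmeasurable f /\
           exists M : R, {ae mu, forall t, circ t -> modulus (f t) <= M}].

Definition inner_prod (f g : R -> C) : C :=
  cintegral (fun t => f t * (g t)^*).

Definition conjf (f : R -> C) : R -> C := fun t => (f t)^*.

Definition mulset (g : R -> C) (M : set (R -> C)) : set (R -> C) :=
  [set f | cmeasurable f /\ exists2 k, M k & ceq f (g \* k)].

Definition ominus (M N : set (R -> C)) : set (R -> C) :=
  [set f | M f /\ forall g, N g -> inner_prod f g = 0].

Definition is_orth_proj (M : set (R -> C)) (f g : R -> C) : Prop :=
  M g /\ forall h, M h -> inner_prod (f \- g) h = 0.

(* The value is determined up to almost everywhere equality. The default value
   of xget is irrelevant when M is a closed subspace of L2 and f is in L2. *)
Definition orth_proj (M : set (R -> C)) (f : R -> C) : R -> C :=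
  xget (fun=> 0) [set g | is_orth_proj M f g].

(* F is analytic on the open unit disc, as the sum of a power series *)
Definition analytic_disc (F : C -> C) : Prop :=
  exists a : nat -> C, forall z : C, modulus z < 1 ->
    modulus (\sum_(0 <= n < N) a n * z ^+ n - F z) @[N --> \oo] --> (0 : R).

Definition H2_disc : set (C -> C) :=
  [set F | analytic_disc F /\
     exists M : R, forall r : R, 0 <= r < 1 ->
       (\int[mu]_(t in circ) ((modulus (F (r%:C * expi t))) ^+ 2)%:E
          <= M%:E)%E].

Definition Hinf_disc : set (C -> C) :=
  [set F | analytic_disc F /\
     exists M : R, forall z : C, modulus z < 1 -> modulus (F z) <= M].

(* f is the boundary function of F: radial limits almost everywhere *)
Definition boundary (F : C -> C) (f : R -> C) : Prop :=
  {ae mu, forall t, circ t ->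
    modulus (F (r%:C * expi t) - f t) @[r --> 1^'-] --> (0 : R)}.

Definition H2 : set (R -> C) :=
  [set f | L2 f /\ exists2 F, H2_disc F & boundary F f].

Definition Hinf : set (R -> C) :=
  [set f | Linfty f /\ exists2 F, Hinf_disc F & boundary F f].

Definition inner_function (beta : R -> C) : Prop :=
  Hinf beta /\ {ae mu, forall t, circ t -> modulus (beta t) = 1}.

(* c * exp (int (exp(i t) + z) / (exp(i t) - z) log (phi t) dt / (2 pi)) *)
Definition outer_disc (c : C) (phi : R -> R) (z : C) : C :=
  c * cexp (cintegral
    (fun t => (expi t + z) / (expi t - z) * (ln (phi t))%:C)).

Definition outer_function (f : R -> C) : Prop :=
  cmeasurable f /\
  exists (c : C) (phi : R -> R),
    [/\ modulus c = 1,
        measurable_fun circ phi,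
        forall t, circ t -> 0 < phi t,
        mu.-integrable circ (fun t => (ln (phi t))%:E) &
        boundary (outer_disc c phi) f].

(* model space K_beta = H2 (-) beta H2 *)
Definition model_space (beta : R -> C) : set (R -> C) :=
  ominus H2 (mulset beta H2).

Definition model_perp (theta : R -> C) : set (R -> C) :=
  ominus L2 (model_space theta).

(* dual truncated Toeplitz operator, applied to f in model_perp theta *)
Definition dual_toeplitz (theta G f : R -> C) : R -> C :=
  orth_proj (model_perp theta) (G \* f).

Definition ker_dual_toeplitz (theta G : R -> C) : set (R -> C) :=
  [set f | model_perp theta f /\ ceq (dual_toeplitz theta G f) (fun=> 0)].

End circle.

Arguments expi {R} t.
Arguments L2 {R}.
Arguments Linfty {R}.
Arguments H2 {R}.
Arguments Hinf {R}.

(* Main.v *)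
Require Import Defs.
From mathcomp Require Import all_boot all_order all_algebra.
From mathcomp Require Import complex.
From mathcomp Require Import all_classical all_reals all_analysis.
From mathcomp Require Import measurable_realfun.
From mathcomp Require Import ring lra.
Import Order.TTheory GRing.Theory Num.Theory numFieldNormedType.Exports.

(** Why the theorem is true. Write H2 for the Hardy space, K for the model space
    of theta, and P+ for the orthogonal projection of L2 onto H2.

    Everything rests on the description of H2 by Fourier coefficients: a square
    integrable function is in H2 if and only if its negative coefficients vanish
    (H2P). If f is the boundary function of a disc function with bounded means,
    Fatou's lemma shows that the Taylor polynomials converge to f in L2
    (H2_poly_dense). Conversely, if the negative coefficients of f vanish, then
    its Cauchy integral is its Poisson integral, which has radial limits f at
    the Lebesgue points of f, by Fatou's theorem (poisson_radial_limit). The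
    latter follows from a bound of the Poisson kernel by indicators of dyadic
    intervals (dyadic_bound). Bounded functions are treated in the same way, so
    that multiplication by a function of Hinf preserves H2 (hardyM). The
    completeness of L2 is used once, for the existence of P+
    (riesz_projection).

    The complement of K contains the negative powers of z and theta H2, and
    these suffice to show that K is its own double complement
    (model_space_double_perp). The projection onto K is explicit in terms of P+
    (model_decomposition). Hence f is in the kernel of D_G if and only if f is
    orthogonal to K and G f is in K (ker_dual_toeplitzP).

    For f = theta, which is orthogonal to K, this is the equivalence in (i). The
    negative Fourier coefficients of conj(z G) are, up to conjugation, pairings
    of theta G, an element of K, with the functions theta z^n; so they vanish,
    which is the inclusion in (i) (conj_symbol_Hinf).

    For (ii), write conj(G) = z I O. If k in H2 is orthogonal to z I H2, then
    G theta k is in H2 and orthogonal to theta H2, because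
    G |theta|^2 = conj(z I O) and O H2 is contained in H2: so theta k is in the
    kernel (ker_of_model_space). Conversely, let f be in the kernel. Both G f and
    G P+ f are in H2, while G (f - P+ f) is orthogonal to H2 since conj(G) is in
    Hinf; as G vanishes almost nowhere, f = P+ f, and orthogonality to K then
    gives f = theta q with q in H2 (ker_hardy). Orthogonality of G f to theta H2
    says that q is orthogonal to z I O H2, and O H2 is dense in H2, so q is
    orthogonal to z I H2 (cancel_outer).

    That an outer function O generates a dense subspace (outer_cyclic) is proved
    from its integral formula. Exponentials of Herglotz integrals are bounded
    limits of polynomials on each circle of radius r < 1, which gives their
    Fourier coefficients (analytic_mean_herglotz, bounded_exponential);
    multiplying O by the outer function whose modulus is a truncation of 1/|O|
    gives functions that converge to a constant. *)

Set Implicit Arguments.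
Unset Strict Implicit.
Unset Printing Implicit Defensive.

Local Open Scope classical_set_scope.
Local Open Scope ring_scope.
Local Open Scope complex_scope.
(* Inside products ^* would otherwise be read as the conjugation of closed
   fields, which is the same function on R[i]. *)
Local Notation "z ^*" := (conjc z) : ring_scope.

(** * Mean values of real functions on the circle *)

Section almost_everywhere.
Variable R : realType.
Local Notation mu := (@lebesgue_measure R).
Implicit Types P Q S : R -> Prop.

(** Almost everywhere on the circle; the form in which ceq and boundary are
    stated. *)
Definition aec P := {ae mu, forall t, @circ R t -> P t}.

Let filterS_ae P Q : (forall t, P t -> Q t) ->
  almost_everywhere mu P -> almost_everywhere mu Q.
Proof. exact: (@filterS _ (almost_everywhere mu) (ae_filter_ringOfSetsType mu)). Qed.

Let filterI_ae P Q : almost_everywhere mu P -> almost_everywhere mu Q ->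
  almost_everywhere mu (P `&` Q).
Proof. exact: (@filterI _ (almost_everywhere mu) (ae_filter_ringOfSetsType mu)). Qed.

Lemma aecS P Q : (forall t, circ t -> P t -> Q t) -> aec P -> aec Q.
Proof. by move=> PQ; apply: filterS_ae => t Pt ct; apply: PQ => //; exact: Pt. Qed.

Lemma aecW P : (forall t, circ t -> P t) -> aec P.
Proof. by move=> Ph; apply: aeW. Qed.

Lemma aecI P Q : aec P -> aec Q -> aec (fun t => P t /\ Q t).
Proof.
by move=> p q; apply: filterS_ae (filterI_ae p q) => t [Pt Qt] ct; split; auto.
Qed.

Lemma aecS2 P Q S : (forall t, circ t -> P t -> Q t -> S t) ->
  aec P -> aec Q -> aec S.
Proof. by move=> PQS p q; apply: aecS (aecI p q) => t ct []; exact: PQS. Qed.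

Lemma aecS3 P Q S T : (forall t, circ t -> P t -> Q t -> S t -> T t) ->
  aec P -> aec Q -> aec S -> aec T.
Proof. by move=> h p q s; apply: aecS2 (aecI p q) s => t ct []; exact: h. Qed.

Lemma aec_foralln (P : nat -> R -> Prop) :
  (forall n, aec (P n)) -> aec (fun t => forall n, P n t).
Proof.
by move=> h; have := ae_foralln h; apply: filterS_ae => t Pt ct n; exact: Pt.
Qed.

End almost_everywhere.

Section real_mean.
Variable R : realType.
Local Notation mu := (@lebesgue_measure R).
Local Notation circ := (@circ R).
Implicit Types f g h : R -> R.

(** Integrability and mean value with respect to arc length, for real
    functions. *)
Definition rint g := mu.-integrable circ (EFin \o g).

Definition rmean g : R := (pi *+ 2)^-1 * \int[mu]_(t in circ) g t.

Lemma twopi_gt0 : 0 < pi *+ 2 :> R.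
Proof. by rewrite pmulrn_rgt0 // pi_gt0. Qed.

Lemma measurable_circ : measurable (circ : set (measurableTypeR R)).
Proof. exact: measurable_itv. Qed.

Let measurable_circ' : measurable circ.
Proof. exact: measurable_circ. Qed.
Local Hint Resolve measurable_circ measurable_circ' : core.

Lemma mu_circ : mu circ = (pi *+ 2)%:E.
Proof. by rewrite lebesgue_measure_itv /= lte_fin twopi_gt0 oppr0 adde0. Qed.

Lemma rint_measurable g : rint g -> measurable_fun circ g.
Proof. by move=> /integrableP[/measurable_EFinP]. Qed.

Lemma rint_cst (c : R) : rint (fun=> c).
Proof.
apply: measurable_bounded_integrable => //.
- by rewrite [ltLHS]mu_circ ltry.
- exists `|c|; split; first exact: normr_real.
  by move=> M cM t _ /=; apply: ltW.
Qed.

Lemma rintD f g : rint f -> rint g -> rint (fun t => f t + g t).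
Proof. by move=> fi gi; have := integrableD measurable_circ fi gi. Qed.

Lemma rintN f : rint f -> rint (fun t => - f t).
Proof. by move=> fi; have := integrableN fi. Qed.

Lemma rintB f g : rint f -> rint g -> rint (fun t => f t - g t).
Proof. by move=> fi gi; apply: rintD => //; apply: rintN. Qed.

Lemma rintZ (c : R) f : rint f -> rint (fun t => c * f t).
Proof. by move=> fi; have := integrableZl measurable_circ c fi. Qed.

Lemma rint_abs f : rint f -> rint (fun t => `|f t|).
Proof. exact: integrable_norm. Qed.

Lemma rint_dom f g : measurable_fun circ f -> rint g ->
  aec (fun t => `|f t| <= g t) -> rint f.
Proof.
move=> mf gi fg; apply/integrableP; split; first exact/measurable_EFinP.
have /integrableP[mg] := rint_abs gi; apply: le_lt_trans.
apply: ae_ge0_le_integral => //=.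
- by apply/measurable_EFinP; apply: measurableT_comp.
- apply/measurable_EFinP; apply: measurableT_comp => //.
  by apply: measurableT_comp => //; exact: rint_measurable.
- apply: aecS fg => t ct fgt; rewrite lee_fin normr_id.
  by apply: (le_trans fgt); exact: ler_norm.
Qed.

Lemma rint_dom_all f g : measurable_fun circ f -> rint g ->
  (forall t, circ t -> `|f t| <= g t) -> rint f.
Proof. by move=> mf gi fg; apply: rint_dom gi _ => //; exact: aecW. Qed.

Lemma rmeanD f g : rint f -> rint g ->
  rmean (fun t => f t + g t) = rmean f + rmean g.
Proof. by move=> fi gi; rewrite /rmean RintegralD// mulrDr. Qed.

Lemma rmeanB f g : rint f -> rint g ->
  rmean (fun t => f t - g t) = rmean f - rmean g.
Proof. by move=> fi gi; rewrite /rmean RintegralB// mulrBr. Qed.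

Lemma rmeanZ (c : R) f : rint f -> rmean (fun t => c * f t) = c * rmean f.
Proof. by move=> fi; rewrite /rmean RintegralZl// mulrCA. Qed.

Lemma rmean_cst (c : R) : rmean (fun=> c) = c.
Proof.
by rewrite /rmean Rintegral_cst// [X in fine X]mu_circ/= mulrCA mulVf ?mulr1// gt_eqF// twopi_gt0.
Qed.

Lemma rmean_ae_eq f g : measurable_fun circ f -> measurable_fun circ g ->
  aec (fun t => f t = g t) -> rmean f = rmean g.
Proof.
move=> mf mg fg; congr (_ * _); rewrite /Rintegral; congr fine.
apply: ae_eq_integral => //; do ?exact/measurable_EFinP.
by apply: aecS fg => t ct fgt; rewrite fgt.
Qed.

Lemma rmean_eq f g : {in circ, f =1 g} -> rmean f = rmean g.
Proof. by move=> fg; congr (_ * _); exact: eq_Rintegral. Qed.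

Lemma rmeanN f : rint f -> rmean (fun t => - f t) = - rmean f.
Proof.
move=> fi; rewrite -mulN1r -rmeanZ//; apply: rmean_eq => t _; by rewrite mulN1r.
Qed.

Lemma rmean_ge0 f : (forall t, circ t -> 0 <= f t) -> 0 <= rmean f.
Proof.
by move=> f0; rewrite mulr_ge0 ?Rintegral_ge0// invr_ge0 ltW ?twopi_gt0.
Qed.

Lemma rmean_le f g : rint f -> rint g -> aec (fun t => f t <= g t) ->
  rmean f <= rmean g.
Proof.
move=> fi gi fg; rewrite -subr_ge0 -rmeanB//.
have mB : measurable_fun circ (fun t => g t - f t) by apply: rint_measurable; apply: rintB.
rewrite (rmean_ae_eq mB (g := fun t => `|g t - f t|)).
- by apply: rmean_ge0 => t _.
- exact: measurableT_comp.
- by apply: aecS fg => t ct fgt; rewrite ger0_norm// subr_ge0 fgt.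
Qed.

Lemma rmean_le_all f g : rint f -> rint g -> (forall t, circ t -> f t <= g t) ->
  rmean f <= rmean g.
Proof. by move=> fi gi fg; apply: rmean_le => //; exact: aecW. Qed.

Lemma rmean_abs f : rint f -> `|rmean f| <= rmean (fun t => `|f t|).
Proof.
move=> fi; rewrite normrM ger0_norm ?invr_ge0 ?(ltW twopi_gt0)//.
by rewrite ler_pM2l ?invr_gt0 ?twopi_gt0// le_normr_Rintegral.
Qed.

Lemma rmeanE f : rint f -> (\int[mu]_(t in circ) (f t)%:E = (pi *+ 2 * rmean f)%:E)%E.
Proof.
move=> fi; rewrite mulrA divff ?gt_eqF ?twopi_gt0// mul1r /Rintegral fineK//.
exact: integrable_fin_num.
Qed.

Lemma rmean_eq0 f : rint f -> (forall t, circ t -> 0 <= f t) -> rmean f <= 0 ->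
  aec (fun t => f t = 0).
Proof.
move=> fi f0 m0.
have {}m0 : rmean f = 0 by apply/eqP; rewrite eq_le m0 rmean_ge0.
have := rmeanE fi; rewrite m0 mulr0.
have -> : (\int[mu]_(t in circ) (f t)%:E = \int[mu]_(t in circ) `|(f t)%:E|)%E.
  by apply: eq_integral => t; rewrite inE => ct; rewrite gee0_abs// lee_fin f0.
move=> /ae_eq_integral_abs => /(_ measurable_circ).
move=> /(_ (proj1 (integrableP _ _ _ fi))).
by apply: aecS => t ct [].
Qed.

(** Integrability and norm bounds pass to boundary values through this form of
    Fatou's lemma. *)
Lemma rmean_fatou (f_ : nat -> R -> R) f (c : R) : 0 <= c ->
  (forall n, rint (f_ n)) -> (forall n t, circ t -> 0 <= f_ n t) ->
  measurable_fun circ f -> (forall t, circ t -> 0 <= f t) ->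
  (forall n, rmean (f_ n) <= c) ->
  aec (fun t => f_ n t @[n --> \oo] --> f t) ->
  rint f /\ rmean f <= c.
Proof.
move=> c0 fi f0 mf pf fc cvf.
have le : (\int[mu]_(t in circ) (f t)%:E <= (pi *+ 2 * c)%:E)%E.
  have -> : (\int[mu]_(t in circ) (f t)%:E =
             \int[mu]_(t in circ) limn_einf (fun n => (f_ n t)%:E))%E.
    apply: ae_eq_integral => //; first exact/measurable_EFinP.
      apply: measurableT_comp => //; apply: measurable_fun_limn_esup => n.
      by apply: measurableT_comp => //; apply/measurable_EFinP; exact: rint_measurable (fi n).
    apply: aecS cvf => t ct cvt; apply/esym.
    apply: (cvg_limn_einf_sup _).1; apply: cvg_EFin; last exact: cvt.
    exact: nearW.
  have F := @fatou _ _ _ mu circ measurable_circ (fun n t => (f_ n t)%:E).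
  have {}F := F (fun n => proj2 (measurable_EFinP _ _) (rint_measurable (fi n))).
  apply: (le_trans (F _)); first by move=> n t ct; rewrite lee_fin f0.
  have h : forall n, (\int[mu]_(t in circ) (f_ n t)%:E <= (pi *+ 2 * c)%:E)%E.
    by move=> n; rewrite rmeanE// lee_fin ler_pM2l ?twopi_gt0.
  rewrite limn_einf_lim; apply: lime_le; first exact: is_cvg_einfs.
  apply: nearW => n; apply: le_trans (h n).
  by apply: ereal_inf_lbound; exists n => /=.
have fi' : rint f.
  apply/integrableP; split; first exact/measurable_EFinP.
  apply: le_lt_trans (ltry (pi *+ 2 * c)); apply: le_trans le.
  by rewrite le_eqVlt; apply/orP; left; apply/eqP; apply: eq_integral => t;
     rewrite inE => ct; rewrite gee0_abs// lee_fin pf.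
split => //.
by move: le; rewrite rmeanE// lee_fin ler_pM2l ?twopi_gt0.
Qed.

Lemma rmean_dct (f_ : nat -> R -> R) g :
  (forall n, measurable_fun circ (f_ n)) -> rint g ->
  (forall n, aec (fun t => `|f_ n t| <= g t)) ->
  aec (fun t => f_ n t @[n --> \oo] --> (0 : R)) ->
  rmean (f_ n) @[n --> \oo] --> (0 : R).
Proof.
move=> mf gi fg cvf.
have fi n : rint (f_ n) by exact: rint_dom gi (fg n).
have mf' n : measurable_fun circ (EFin \o f_ n) by exact/measurable_EFinP.
have cv : {ae mu, forall t, circ t -> (f_ n t)%:E @[n --> \oo] --> 0%E}.
  by apply: aecS cvf => t ct cvt; apply: cvg_EFin; [exact: nearW|exact: cvt].
have dom : {ae mu, forall t n, circ t -> (`|(f_ n t)%:E| <= (EFin \o g) t)%E}.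
  have := aec_foralln fg.
  apply: (@filterS _ (almost_everywhere mu) (ae_filter_ringOfSetsType mu)).
  by move=> t h n ct; rewrite /= lee_fin h.
have [_ _] := dominated_convergence measurable_circ mf' (measurable_cst _) cv gi dom.
rewrite integral0 => h.
rewrite -[X in _ --> X](mulr0 (pi *+ 2)^-1); apply: cvgMl_tmp.
rewrite -[X in _ --> X]/(fine 0%E); apply: fine_cvg.
exact: h.
Qed.

End real_mean.

(** * Modulus and limits of complex numbers *)

Section complex_modulus.
Variable R : realType.
Local Notation C := R[i].
Local Notation modulus := (@ComplexField.Normc.normc R).
Implicit Types z w : C.

Lemma modulus_ge0 z : 0 <= modulus z.
Proof. by case: z => a b; exact: sqrtr_ge0. Qed.

Lemma modulus_sqr z : modulus z ^+ 2 = complex.Re z ^+ 2 + complex.Im z ^+ 2.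
Proof. by case: z => a b; rewrite sqr_sqrtr// addr_ge0 ?sqr_ge0. Qed.

Lemma modulusM z w : modulus (z * w) = modulus z * modulus w.
Proof. exact: ComplexField.Normc.normcM. Qed.

Lemma modulusD z w : modulus (z + w) <= modulus z + modulus w.
Proof. exact: le_normcD. Qed.

Lemma modulusN z : modulus (- z) = modulus z.
Proof. exact: normcN. Qed.

Lemma modulusB z w : modulus (z - w) <= modulus z + modulus w.
Proof. by rewrite -(modulusN w); exact: modulusD. Qed.

Lemma modulus_distC z w : modulus (z - w) = modulus (w - z).
Proof. by rewrite -modulusN opprB. Qed.

Lemma modulus0 : modulus 0 = 0.
Proof. exact: ComplexField.Normc.normc0. Qed.

Lemma modulus1 : modulus 1 = 1.
Proof. exact: ComplexField.Normc.normc1. Qed.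

Lemma modulus_eq0 z : modulus z = 0 -> z = 0.
Proof. exact: ComplexField.Normc.eq0_normc. Qed.

Lemma modulus_gt0 z : z != 0 -> 0 < modulus z.
Proof.
by move=> z0; rewrite lt_def modulus_ge0 andbT; apply: contra_neq z0 => /modulus_eq0.
Qed.

Lemma modulusV z : modulus z^-1 = (modulus z)^-1.
Proof. exact: ComplexField.Normc.normcV. Qed.

Lemma modulusX z n : modulus (z ^+ n) = modulus z ^+ n.
Proof. by elim: n => [|n IH]; rewrite ?expr0 ?modulus1// !exprS modulusM IH. Qed.

Lemma modulus_conj z : modulus z^* = modulus z.
Proof. by case: z => a b; rewrite /= sqrrN. Qed.

Lemma modulus_real (x : R) : modulus x%:C = `|x|.
Proof. by rewrite /= expr0n addr0 sqrtr_sqr. Qed.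

Lemma modulus_sum (I : Type) (r : seq I) (P : pred I) (F : I -> C) :
  modulus (\sum_(i <- r | P i) F i) <= \sum_(i <- r | P i) modulus (F i).
Proof.
elim/big_ind2 : _ => //; first by rewrite modulus0.
by move=> a b c d ab cd; apply: (le_trans (modulusD _ _)); exact: lerD.
Qed.

Lemma Re_le_modulus z : `|complex.Re z| <= modulus z.
Proof.
case: z => a b /=; rewrite -(sqrtr_sqr a) ler_sqrt ?addr_ge0 ?sqr_ge0//.
by rewrite lerDl sqr_ge0.
Qed.

Lemma Im_le_modulus z : `|complex.Im z| <= modulus z.
Proof.
case: z => a b /=; rewrite -(sqrtr_sqr b) ler_sqrt ?addr_ge0 ?sqr_ge0//.
by rewrite lerDr sqr_ge0.
Qed.

Lemma modulus_le z : modulus z <= `|complex.Re z| + `|complex.Im z|.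
Proof.
have -> : z = (complex.Re z)%:C + 'i * (complex.Im z)%:C.
  by rewrite -complexE.
apply: (le_trans (modulusD _ _)); rewrite modulusM !modulus_real /=.
rewrite !(mul0r, mul1r, oppr0, addr0, add0r, subr0, mulr0) expr0n expr1n add0r.
by rewrite sqrtr1 mul1r.
Qed.

Lemma mulcJ z : z * z^* = (modulus z ^+ 2)%:C.
Proof.
rewrite modulus_sqr; case: z => a b; apply/eqP; rewrite eq_complex /=.
by apply/andP; split; apply/eqP; ring.
Qed.

Lemma conj_eq_inv z : modulus z = 1 -> z^* * z = 1.
Proof. by move=> z1; rewrite mulrC mulcJ z1 expr1n. Qed.

Lemma ReD z w : complex.Re (z + w) = complex.Re z + complex.Re w.
Proof. by case: z w => [a b] [c d]. Qed.

Lemma ImD z w : complex.Im (z + w) = complex.Im z + complex.Im w.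
Proof. by case: z w => [a b] [c d]. Qed.

Lemma ReN z : complex.Re (- z) = - complex.Re z.
Proof. by case: z. Qed.

Lemma ImN z : complex.Im (- z) = - complex.Im z.
Proof. by case: z. Qed.

Lemma ReM z w : complex.Re (z * w) =
  complex.Re z * complex.Re w - complex.Im z * complex.Im w.
Proof. by case: z w => [a b] [c d]. Qed.

Lemma ImM z w : complex.Im (z * w) =
  complex.Re z * complex.Im w + complex.Im z * complex.Re w.
Proof. by case: z w => [a b] [c d]. Qed.

Lemma Re_conj z : complex.Re z^* = complex.Re z.
Proof. by case: z. Qed.

Lemma Im_conj z : complex.Im z^* = - complex.Im z.
Proof. by case: z. Qed.

Lemma conjcM z w : (z * w)^* = z^* * w^*.
Proof. exact: rmorphM. Qed.

Lemma conjcB z w : (z - w)^* = z^* - w^*.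
Proof. exact: rmorphB. Qed.

Lemma conjcX z n : (z ^+ n)^* = z^* ^+ n.
Proof. exact: rmorphXn. Qed.

Lemma complexP z w : complex.Re z = complex.Re w -> complex.Im z = complex.Im w -> z = w.
Proof. by case: z w => [a b] [c d] /= -> ->. Qed.

End complex_modulus.

Section complex_convergence.
Variables (R : realType) (T : Type) (F : set_system T).
Context {FF : Filter F}.
Local Notation C := R[i].
Local Notation modulus := (@ComplexField.Normc.normc R).
Implicit Types (u v : T -> C) (a b : C).

Definition ccvg u a := modulus (u x - a) @[x --> F] --> (0 : R).

Lemma cvg0_le (f g : T -> R) : (forall x, 0 <= f x <= g x) ->
  g x @[x --> F] --> (0 : R) -> f x @[x --> F] --> (0 : R).
Proof.
move=> fg g0; by apply: (squeeze_cvgr _ (cvg_cst _) g0); apply: nearW => x; exact: fg.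
Qed.

Lemma ccvgP u a : ccvg u a <->
  (complex.Re (u x) @[x --> F] --> complex.Re a /\
   complex.Im (u x) @[x --> F] --> complex.Im a).
Proof.
split=> [ua|[ra ia]].
  split; apply/subr_cvg0; apply/norm_cvg0P.
  - apply: cvg0_le ua => x; rewrite normr_ge0/= -ReN -ReD.
    exact: Re_le_modulus.
  - apply: cvg0_le ua => x; rewrite normr_ge0/= -ImN -ImD.
    exact: Im_le_modulus.
have r0 : `|complex.Re (u x) - complex.Re a| @[x --> F] --> (0 : R).
  by apply/norm_cvg0P; apply/subr_cvg0.
have i0 : `|complex.Im (u x) - complex.Im a| @[x --> F] --> (0 : R).
  by apply/norm_cvg0P; apply/subr_cvg0.
have h := cvgD r0 i0; rewrite addr0 in h; rewrite /ccvg; apply: cvg0_le (h _) => x.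
rewrite modulus_ge0/= -!ReN -!ImN -!ReD -!ImD; exact: modulus_le.
Qed.

Lemma ccvg_near u a (e : R) : 0 < e -> ccvg u a ->
  \forall x \near F, modulus (u x - a) < e.
Proof.
rewrite /ccvg => e0 /cvgrPdist_lt/(_ e e0); apply: filterS => x.
by rewrite sub0r normrN ger0_norm// modulus_ge0.
Qed.

Lemma near_ccvg u a :
  (forall e : R, 0 < e -> \forall x \near F, modulus (u x - a) < e) -> ccvg u a.
Proof.
move=> h; apply/cvgrPdist_lt => e e0; apply: filterS (h e e0) => x.
by rewrite sub0r normrN ger0_norm// modulus_ge0.
Qed.

Lemma ccvg_cst a : ccvg (fun=> a) a.
Proof. by apply/ccvgP; split; exact: cvg_cst. Qed.

Lemma ccvgD u v a b : ccvg u a -> ccvg v b -> ccvg (fun x => u x + v x) (a + b).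
Proof.
move=> /ccvgP[u1 u2] /ccvgP[v1 v2]; apply/ccvgP; split.
- by under eq_fun do rewrite ReD; rewrite ReD; exact: cvgD.
- by under eq_fun do rewrite ImD; rewrite ImD; exact: cvgD.
Qed.

Lemma ccvgM u v a b : ccvg u a -> ccvg v b -> ccvg (fun x => u x * v x) (a * b).
Proof.
move=> /ccvgP[u1 u2] /ccvgP[v1 v2]; apply/ccvgP; split.
- by under eq_fun do rewrite ReM; rewrite ReM; apply: cvgB; exact: cvgM.
- by under eq_fun do rewrite ImM; rewrite ImM; apply: cvgD; exact: cvgM.
Qed.

Lemma ccvgX u a n : ccvg u a -> ccvg (fun x => u x ^+ n) (a ^+ n).
Proof.
move=> ua; elim: n => [|n IH]; first exact: ccvg_cst.
by under eq_fun do rewrite exprS; rewrite exprS; exact: ccvgM.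
Qed.

Lemma ccvgN u a : ccvg u a -> ccvg (fun x => - u x) (- a).
Proof.
rewrite /ccvg; apply: cvg0_le => x; rewrite modulus_ge0 andTb.
by rewrite -opprD modulusN.
Qed.

Lemma ccvgB u v a b : ccvg u a -> ccvg v b -> ccvg (fun x => u x - v x) (a - b).
Proof. by move=> ua vb; apply: ccvgD => //; exact: ccvgN. Qed.

Lemma ccvg_sum (I : Type) (s : seq I) (w : I -> T -> C) (l : I -> C) :
  (forall i, ccvg (w i) (l i)) ->
  ccvg (fun x => \sum_(i <- s) w i x) (\sum_(i <- s) l i).
Proof.
move=> wl; elim: s => [|i s IH].
  by under eq_fun do rewrite big_nil; rewrite big_nil; exact: ccvg_cst.
by under eq_fun do rewrite big_cons; rewrite big_cons; exact: ccvgD.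
Qed.

Lemma ccvg_real (h : T -> R) (l : R) : h x @[x --> F] --> l ->
  ccvg (fun x => (h x)%:C) l%:C.
Proof. by move=> hl; apply/ccvgP; split => //=; exact: cvg_cst. Qed.

Lemma ccvg_modulus u a : ccvg u a -> modulus (u x) @[x --> F] --> modulus a.
Proof.
move=> ua; apply/subr_cvg0; apply/norm_cvg0P; apply: cvg0_le ua => x.
rewrite normr_ge0 andTb ler_norml; apply/andP; split.
- rewrite lerNl opprB lerBlDr modulus_distC; apply: le_trans (modulusD _ _).
  by rewrite subrK.
- by rewrite lerBlDr; apply: le_trans (modulusD _ _); rewrite subrK.
Qed.

End complex_convergence.

Lemma ccvg_unique (R : realType) (T : Type) (F : set_system T) {FF : ProperFilter F}
  (u : T -> R[i]) a b : ccvg F u a -> ccvg F u b -> a = b.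
Proof.
move=> /ccvgP[u1 u2] /ccvgP[v1 v2].
by apply: complexP; [exact: cvg_unique u1 v1|exact: cvg_unique u2 v2].
Qed.

Lemma cvg_rsum (R : realType) (T : Type) (F : set_system T) {FF : Filter F}
  (I : Type) (s : seq I) (w : I -> T -> R) (l : I -> R) :
  (forall i, w i x @[x --> F] --> l i) ->
  (\sum_(i <- s) w i x) @[x --> F] --> \sum_(i <- s) l i.
Proof.
move=> wl; elim: s => [|i s IH].
  by under eq_fun do rewrite big_nil; rewrite big_nil; exact: cvg_cst.
by under eq_fun do rewrite big_cons; rewrite big_cons; exact: cvgD.
Qed.

(** * Mean values of complex functions on the circle *)

Section complex_mean.
Variable R : realType.
Local Notation C := R[i].
Local Notation modulus := (@ComplexField.Normc.normc R).
Local Notation circ := (@circ R).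
Implicit Types f g : R -> C.

Lemma cmeas_cst (c : C) : cmeasurable (fun=> c).
Proof. by split; exact: measurable_cst. Qed.

Lemma cmeasD f g : cmeasurable f -> cmeasurable g -> cmeasurable (fun t => f t + g t).
Proof.
move=> [f1 f2] [g1 g2]; split.
- under eq_fun do rewrite ReD; exact: measurable_funD.
- under eq_fun do rewrite ImD; exact: measurable_funD.
Qed.

Lemma cmeasN f : cmeasurable f -> cmeasurable (fun t => - f t).
Proof.
move=> [f1 f2]; split.
- under eq_fun do rewrite ReN; exact: measurable_funN.
- under eq_fun do rewrite ImN; exact: measurable_funN.
Qed.

Lemma cmeasB f g : cmeasurable f -> cmeasurable g -> cmeasurable (fun t => f t - g t).
Proof. by move=> mf mg; apply: cmeasD => //; exact: cmeasN. Qed.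

Lemma cmeasM f g : cmeasurable f -> cmeasurable g -> cmeasurable (fun t => f t * g t).
Proof.
move=> [f1 f2] [g1 g2]; split.
- under eq_fun do rewrite ReM; apply: measurable_funB; exact: measurable_funM.
- under eq_fun do rewrite ImM; apply: measurable_funD; exact: measurable_funM.
Qed.

Lemma cmeas_conj f : cmeasurable f -> cmeasurable (fun t => (f t)^*).
Proof.
move=> [f1 f2]; split.
- by under eq_fun do rewrite Re_conj.
- under eq_fun do rewrite Im_conj; exact: measurable_funN.
Qed.

Lemma cmeasX f n : cmeasurable f -> cmeasurable (fun t => f t ^+ n).
Proof.
move=> mf; elim: n => [|n IH]; first exact: cmeas_cst.
by under eq_fun do rewrite exprS; exact: cmeasM.
Qed.

Lemma cmeas_sum (I : Type) (s : seq I) (F : I -> R -> C) :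
  (forall i, cmeasurable (F i)) -> cmeasurable (fun t => \sum_(i <- s) F i t).
Proof.
move=> mF; elim: s => [|i s IH].
  by under eq_fun do rewrite big_nil; exact: cmeas_cst.
by under eq_fun do rewrite big_cons; exact: cmeasD.
Qed.

Lemma cmeas_real (f : R -> R) : measurable_fun circ f -> cmeasurable (fun t => (f t)%:C).
Proof. by move=> mf; split => //; exact: measurable_cst. Qed.

Lemma cmeas_lim (u : nat -> R -> C) f : (forall n, cmeasurable (u n)) ->
  (forall t, circ t -> ccvg \oo (u ^~ t) (f t)) -> cmeasurable f.
Proof.
move=> mu uf; split.
- apply: (@measurable_fun_cvg _ _ _ _ (fun n t => complex.Re (u n t))) => [n|t ct].
    exact: (mu n).1.
  by have /ccvgP[] := uf t ct.
- apply: (@measurable_fun_cvg _ _ _ _ (fun n t => complex.Im (u n t))) => [n|t ct].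
    exact: (mu n).2.
  by have /ccvgP[] := uf t ct.
Qed.

Lemma meas_modulus2 f : cmeasurable f ->
  measurable_fun circ (fun t => modulus (f t) ^+ 2).
Proof.
move=> [f1 f2]; under eq_fun do rewrite modulus_sqr.
by apply: measurable_funD; exact: measurable_funX.
Qed.

Lemma meas_modulus f : cmeasurable f -> measurable_fun circ (fun t => modulus (f t)).
Proof.
move=> mf; have -> : (fun t => modulus (f t)) = Num.sqrt \o (fun t => modulus (f t) ^+ 2).
  by apply/funext => t /=; rewrite sqrtr_sqr ger0_norm// modulus_ge0.
apply: measurableT_comp; last exact: meas_modulus2.
apply: continuous_measurable_fun; exact: sqrt_continuous.
Qed.

Definition cint f :=
  rint (fun t => complex.Re (f t)) /\ rint (fun t => complex.Im (f t)).

Lemma cint_measurable f : cint f -> cmeasurable f.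
Proof. by case=> /rint_measurable ? /rint_measurable. Qed.

Lemma cint_modulus f : cint f -> rint (fun t => modulus (f t)).
Proof.
move=> fi; have mf := cint_measurable fi; case: fi => f1 f2.
apply: (rint_dom_all (meas_modulus mf) (rintD (rint_abs f1) (rint_abs f2))).
by move=> t _; rewrite ger0_norm ?modulus_ge0//; exact: modulus_le.
Qed.

Lemma cint_dom f (g : R -> R) : cmeasurable f -> rint g ->
  aec (fun t => modulus (f t) <= g t) -> cint f.
Proof.
move=> [f1 f2] gi fg; split; apply: rint_dom gi _ => //.
- by apply: aecS fg => t _; apply: le_trans; exact: Re_le_modulus.
- by apply: aecS fg => t _; apply: le_trans; exact: Im_le_modulus.
Qed.

Lemma cint_dom_all f (g : R -> R) : cmeasurable f -> rint g ->
  (forall t, circ t -> modulus (f t) <= g t) -> cint f.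
Proof. by move=> mf gi fg; apply: cint_dom gi _ => //; exact: aecW. Qed.

Lemma cint_bounded f (M : R) : cmeasurable f -> aec (fun t => modulus (f t) <= M) ->
  cint f.
Proof. by move=> mf fM; apply: cint_dom mf (rint_cst M) fM. Qed.

Lemma cint_cst (c : C) : cint (fun=> c).
Proof. by split; exact: rint_cst. Qed.

Lemma cintD f g : cint f -> cint g -> cint (fun t => f t + g t).
Proof.
move=> [f1 f2] [g1 g2]; split.
- by under eq_fun do rewrite ReD; exact: rintD.
- by under eq_fun do rewrite ImD; exact: rintD.
Qed.

Lemma cintZ (c : C) f : cint f -> cint (fun t => c * f t).
Proof.
move=> [f1 f2]; split.
- by under eq_fun do rewrite ReM; apply: rintB; exact: rintZ.
- by under eq_fun do rewrite ImM; apply: rintD; exact: rintZ.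
Qed.

Lemma cintN f : cint f -> cint (fun t => - f t).
Proof. by move=> fi; under eq_fun do rewrite -mulN1r; exact: cintZ. Qed.

Lemma cintB f g : cint f -> cint g -> cint (fun t => f t - g t).
Proof. by move=> fi gi; apply: cintD => //; exact: cintN. Qed.

Lemma cint_sum (I : Type) (s : seq I) (F : I -> R -> C) :
  (forall i, cint (F i)) -> cint (fun t => \sum_(i <- s) F i t).
Proof.
move=> Fi; elim: s => [|i s IH].
  by under eq_fun do rewrite big_nil; exact: cint_cst.
by under eq_fun do rewrite big_cons; exact: cintD.
Qed.

Lemma cintM_bounded f g (M : R) : cint f -> cmeasurable g ->
  aec (fun t => modulus (g t) <= M) -> cint (fun t => f t * g t).
Proof.
move=> fi mg gM; apply: (cint_dom _ (rintZ M (cint_modulus fi))).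
  by apply: cmeasM => //; exact: cint_measurable.
by apply: aecS gM => t _ h; rewrite modulusM mulrC ler_wpM2r// modulus_ge0.
Qed.

Lemma Re_cintegral f : complex.Re (cintegral f) = rmean (fun t => complex.Re (f t)).
Proof. by rewrite /cintegral/rmean/=; ring. Qed.

Lemma Im_cintegral f : complex.Im (cintegral f) = rmean (fun t => complex.Im (f t)).
Proof. by rewrite /cintegral/rmean/=; ring. Qed.

Lemma cintegral_ae_eq f g : cmeasurable f -> cmeasurable g -> aec (fun t => f t = g t) ->
  cintegral f = cintegral g.
Proof.
move=> [f1 f2] [g1 g2] fg.
by apply: complexP; rewrite ?(Re_cintegral,Im_cintegral); apply: rmean_ae_eq => //;
  apply: aecS fg => t _ ->.
Qed.

Lemma cintegral_eq f g : (forall t, circ t -> f t = g t) -> cintegral f = cintegral g.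
Proof.
move=> fg; by apply: complexP; rewrite ?(Re_cintegral,Im_cintegral);
  apply: rmean_eq => t; rewrite inE => /fg ->.
Qed.

Lemma cintegralD f g : cint f -> cint g ->
  cintegral (fun t => f t + g t) = cintegral f + cintegral g.
Proof.
move=> [f1 f2] [g1 g2]; apply: complexP.
- by rewrite ReD !Re_cintegral -rmeanD//; apply: rmean_eq => t _; rewrite ReD.
- by rewrite ImD !Im_cintegral -rmeanD//; apply: rmean_eq => t _; rewrite ImD.
Qed.

Lemma cintegralZ (c : C) f : cint f -> cintegral (fun t => c * f t) = c * cintegral f.
Proof.
move=> [f1 f2]; apply: complexP.
- rewrite [RHS]ReM !(Re_cintegral, Im_cintegral) -!rmeanZ// -rmeanB; do ?exact: rintZ.
  by apply: rmean_eq => t _; rewrite ReM.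
- rewrite [RHS]ImM !(Re_cintegral, Im_cintegral) -!rmeanZ// -rmeanD; do ?exact: rintZ.
  by apply: rmean_eq => t _; rewrite ImM.
Qed.

Lemma cintegralN f : cint f -> cintegral (fun t => - f t) = - cintegral f.
Proof.
move=> fi; rewrite -mulN1r -cintegralZ//.
by congr cintegral; apply/funext => t; rewrite mulN1r.
Qed.

Lemma cintegralB f g : cint f -> cint g ->
  cintegral (fun t => f t - g t) = cintegral f - cintegral g.
Proof. by move=> fi gi; rewrite cintegralD ?cintegralN//; exact: cintN. Qed.

Lemma cintegral_conj f : cint f -> cintegral (fun t => (f t)^*) = (cintegral f)^*.
Proof.
move=> [f1 f2]; apply: complexP.
- by rewrite Re_conj !Re_cintegral; apply: rmean_eq => t _; rewrite Re_conj.
- by rewrite Im_conj !Im_cintegral -rmeanN//; apply: rmean_eq => t _; rewrite Im_conj.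
Qed.

Lemma cintegral_cst (c : C) : cintegral (fun=> c) = c.
Proof. by apply: complexP; rewrite ?(Re_cintegral,Im_cintegral) rmean_cst. Qed.

Lemma cintegral_real (f : R -> R) : cintegral (fun t => (f t)%:C) = (rmean f)%:C.
Proof. by apply: complexP; rewrite ?(Re_cintegral,Im_cintegral)//= rmean_cst. Qed.

Lemma cintegral_sum (I : Type) (s : seq I) (F : I -> R -> C) :
  (forall i, cint (F i)) ->
  cintegral (fun t => \sum_(i <- s) F i t) = \sum_(i <- s) cintegral (F i).
Proof.
move=> Fi; elim: s => [|i s IH].
  by under eq_fun do rewrite big_nil; rewrite big_nil cintegral_cst.
by under eq_fun do rewrite big_cons; rewrite big_cons cintegralD ?IH//; exact: cint_sum.
Qed.

(** Multiplying by a unimodular constant, the integral may be assumed real. *)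
Lemma modulus_cintegral f : cint f -> modulus (cintegral f) <= rmean (fun t => modulus (f t)).
Proof.
move=> fi; set J := cintegral f.
have [->|J0] := eqVneq J 0.
  by rewrite modulus0; apply: rmean_ge0 => t _; exact: modulus_ge0.
pose c := J^* / (modulus J)%:C.
have mJ : (modulus J)%:C != 0 :> C.
  by apply/eqP => /complexI h; move: (modulus_gt0 J0); rewrite h ltxx.
have c1 : modulus c = 1.
  by rewrite modulusM modulusV modulus_conj modulus_real ger0_norm ?modulus_ge0// divff//
     gt_eqF// modulus_gt0.
have cJ : c * J = (modulus J)%:C.
  rewrite /c mulrAC [_^* * _]mulrC mulcJ.
  by rewrite expr2 (rmorphM (real_complex R)) mulfK.
have -> : modulus J = rmean (fun t => complex.Re (c * f t)).
  by rewrite -Re_cintegral cintegralZ// -/J cJ.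
have ci := cintZ c fi.
apply: rmean_le_all; [exact: ci.1|exact: cint_modulus|] => t _.
apply: (le_trans (ler_norm _)); apply: (le_trans (Re_le_modulus _)).
by rewrite modulusM c1 mul1r.
Qed.

Lemma cintegral_dct (u : nat -> R -> C) f (g : R -> R) :
  (forall n, cmeasurable (u n)) -> cmeasurable f -> rint g ->
  (forall n, aec (fun t => modulus (u n t) <= g t)) ->
  aec (fun t => ccvg \oo (u ^~ t) (f t)) ->
  cint f /\ ccvg \oo (fun n => cintegral (u n)) (cintegral f).
Proof.
move=> mu mf gi ug uf.
have fg : aec (fun t => modulus (f t) <= g t).
  apply: aecS2 (aec_foralln ug) uf => t _ h cv.
  apply/ler_addgt0Pr => e e0.
  have [n _ /(_ n (leqnn n)) hn] := ccvg_near e0 cv.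
  have -> : f t = u n t - (u n t - f t) by ring.
  apply: (le_trans (modulusB _ _)); apply: lerD (h n) (ltW hn).
have fi : cint f by exact: cint_dom gi fg.
split=> //.
have ui n : cint (u n) by exact: cint_dom gi (ug n).
have cv : rmean (fun t => modulus (u n t - f t)) @[n --> \oo] --> (0 : R).
  apply: (rmean_dct (g := fun t => g t + g t)).
  - by move=> n; apply: meas_modulus; exact: cmeasB.
  - exact: rintD.
  - move=> n; apply: aecS2 (ug n) fg => t _ h1 h2.
    rewrite ger0_norm ?modulus_ge0//; apply: (le_trans (modulusB _ _)); exact: lerD.
  - exact: uf.
rewrite /ccvg; apply: cvg0_le cv => n; rewrite modulus_ge0 andTb -cintegralB//.
by apply: modulus_cintegral; exact: cintB.
Qed.

End complex_mean.

(** * Square integrable functions *)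

Section square_integrable.
Variable R : realType.
Local Notation C := R[i].
Local Notation modulus := (@ComplexField.Normc.normc R).
Local Notation circ := (@circ R).
Implicit Types f g h : R -> C.

(** The square of the norm of L2; keeping the square avoids square roots
    throughout. *)
Definition nsq f : R := rmean (fun t => modulus (f t) ^+ 2).

Lemma L2_measurable f : L2 f -> cmeasurable f. Proof. by case. Qed.

Lemma L2_sqr f : L2 f -> rint (fun t => modulus (f t) ^+ 2). Proof. by case. Qed.

Lemma L2_dom f (g : R -> R) : cmeasurable f -> rint g ->
  aec (fun t => modulus (f t) ^+ 2 <= g t) -> L2 f.
Proof.
move=> mf gi fg; split=> //; apply: rint_dom gi _; first exact: meas_modulus2.
by apply: aecS fg => t _; rewrite ger0_norm// sqr_ge0.
Qed.

Lemma L2_dom_all f (g : R -> R) : cmeasurable f -> rint g ->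
  (forall t, circ t -> modulus (f t) ^+ 2 <= g t) -> L2 f.
Proof. by move=> mf gi fg; apply: L2_dom gi _ => //; exact: aecW. Qed.

Lemma Linf_L2 f : Linfty f -> L2 f.
Proof.
move=> [mf [M fM]]; apply: (L2_dom mf (rint_cst (M ^+ 2))).
by apply: aecS fM => t _ h; rewrite lerXn2r// nnegrE ?(le_trans _ h) ?modulus_ge0.
Qed.

Lemma L2_ae_eq f g : cmeasurable g -> aec (fun t => f t = g t) -> L2 f -> L2 g.
Proof.
move=> mg fg [mf fi]; apply: (L2_dom mg fi).
by apply: aecS fg => t _ ->.
Qed.

Lemma sqrD_le (x y : R) : (x + y) ^+ 2 <= 2 * x ^+ 2 + 2 * y ^+ 2.
Proof. by have := sqr_ge0 (x - y); rewrite sqrrB sqrrD; lra. Qed.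

Lemma modulusD_sqr (z w : C) :
  modulus (z + w) ^+ 2 <= 2 * modulus z ^+ 2 + 2 * modulus w ^+ 2.
Proof.
apply: le_trans (sqrD_le _ _).
by rewrite lerXn2r ?nnegrE ?addr_ge0 ?modulus_ge0// modulusD.
Qed.

Lemma L2D f g : L2 f -> L2 g -> L2 (fun t => f t + g t).
Proof.
move=> [mf fi] [mg gi]; apply: L2_dom_all (rintD (rintZ 2 fi) (rintZ 2 gi)) _.
  exact: cmeasD.
by move=> t _; exact: modulusD_sqr.
Qed.

Lemma L2M_bounded f g : Linfty f -> L2 g -> L2 (fun t => f t * g t).
Proof.
move=> [mf [M fM]] [mg gi]; apply: L2_dom (rintZ (M ^+ 2) gi) _; first exact: cmeasM.
apply: aecS fM => t _ h; rewrite modulusM exprMn ler_wpM2r ?sqr_ge0//.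
by rewrite lerXn2r// nnegrE ?(le_trans _ h) ?modulus_ge0.
Qed.

Lemma Linf_cst (c : C) : Linfty (fun=> c).
Proof. by split; [exact: cmeas_cst|exists (modulus c); exact: aecW]. Qed.

Lemma LinfM f g : Linfty f -> Linfty g -> Linfty (fun t => f t * g t).
Proof.
move=> [mf [M fM]] [mg [N gN]]; split; first exact: cmeasM.
exists (M * N); apply: aecS2 fM gN => t _ hM hN.
by rewrite modulusM ler_pM ?modulus_ge0.
Qed.

Lemma Linf_conj f : Linfty f -> Linfty (fun t => (f t)^*).
Proof.
move=> [mf [M fM]]; split; first exact: cmeas_conj.
by exists M; apply: aecS fM => t _; rewrite modulus_conj.
Qed.

Lemma L2Z (c : C) f : L2 f -> L2 (fun t => c * f t).
Proof. by move=> f2; have := L2M_bounded (Linf_cst c) f2. Qed.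

Lemma L2N f : L2 f -> L2 (fun t => - f t).
Proof. by move=> f2; under eq_fun do rewrite -mulN1r; exact: L2Z. Qed.

Lemma L2B f g : L2 f -> L2 g -> L2 (fun t => f t - g t).
Proof. by move=> f2 g2; apply: L2D => //; exact: L2N. Qed.

Lemma L2_cst (c : C) : L2 (fun=> c).
Proof. exact/Linf_L2/Linf_cst. Qed.

Lemma L2_conj f : L2 f -> L2 (fun t => (f t)^*).
Proof.
move=> [mf fi]; apply: (L2_dom_all (cmeas_conj mf) fi) => t _.
by rewrite modulus_conj.
Qed.

Lemma L2_sum (I : Type) (s : seq I) (F : I -> R -> C) :
  (forall i, L2 (F i)) -> L2 (fun t => \sum_(i <- s) F i t).
Proof.
move=> F2; elim: s => [|i s IH].
  by under eq_fun do rewrite big_nil; exact: L2_cst.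
by under eq_fun do rewrite big_cons; exact: L2D.
Qed.

Lemma L2_cintM f g : L2 f -> L2 g -> cint (fun t => f t * g t).
Proof.
move=> [mf fi] [mg gi]; apply: cint_dom_all (rintD fi gi) _; first exact: cmeasM.
move=> t _; rewrite modulusM; have := sqr_ge0 (modulus (f t) - modulus (g t)).
have := mulr_ge0 (modulus_ge0 (f t)) (modulus_ge0 (g t)).
by rewrite sqrrB; lra.
Qed.

Lemma L2_cint f : L2 f -> cint f.
Proof.
move=> f2; have := L2_cintM (L2_cst 1) f2.
by under eq_fun do rewrite mul1r.
Qed.

Lemma nsq_ge0 f : 0 <= nsq f.
Proof. by apply: rmean_ge0 => t _; exact: sqr_ge0. Qed.

Lemma nsq_eq f g : (forall t, circ t -> modulus (f t) = modulus (g t)) -> nsq f = nsq g.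
Proof. by move=> fg; apply: rmean_eq => t; rewrite inE => /fg ->. Qed.

Lemma nsq_distC f g : nsq (fun t => f t - g t) = nsq (fun t => g t - f t).
Proof. by apply: nsq_eq => t _; rewrite modulus_distC. Qed.

Lemma nsq_eq0 f : L2 f -> nsq f <= 0 -> aec (fun t => f t = 0).
Proof.
move=> f2 f0; have := rmean_eq0 (L2_sqr f2) (fun t _ => sqr_ge0 _) f0.
by apply: aecS => t _ /eqP; rewrite sqrf_eq0 => /eqP /modulus_eq0.
Qed.

(** The quadratic polynomial in x given by the integral of (x |f| - |g|)^2 has
    no sign change. *)
Lemma cauchy_schwarz f g : L2 f -> L2 g ->
  modulus (cintegral (fun t => f t * g t)) ^+ 2 <= nsq f * nsq g.
Proof.
move=> f2 g2; have fi := L2_sqr f2; have gi := L2_sqr g2.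
have fgi := cint_modulus (L2_cintM f2 g2).
set X := rmean (fun t => modulus (f t * g t)).
have X0 : 0 <= X by apply: rmean_ge0 => t _; exact: modulus_ge0.
apply: (@le_trans _ _ (X ^+ 2)).
  by rewrite lerXn2r ?nnegrE ?modulus_ge0//; apply: modulus_cintegral; exact: L2_cintM.
have q (x : R) : 0 <= x ^+ 2 * nsq f - 2 * x * X + nsq g.
  rewrite -!rmeanZ// -rmeanB; do ?exact: rintZ.
  rewrite -rmeanD//; last by apply: rintB; exact: rintZ.
  apply: rmean_ge0 => t _; rewrite modulusM.
  have := sqr_ge0 (x * modulus (f t) - modulus (g t)).
  by rewrite sqrrB exprMn; lra.
have [nf|nf] := eqVneq (nsq f) 0.
  have [->|X1] := eqVneq X 0; first by rewrite expr0n /= mulr_ge0 ?nsq_ge0.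
  have Xp : 0 < X by rewrite lt_def X1.
  have := q ((nsq g + 1) / X); rewrite nf mulr0 -mulrA divfK ?gt_eqF//.
  by have := nsq_ge0 g; lra.
have nfp : 0 < nsq f by rewrite lt_def nf nsq_ge0.
have := q (X / nsq f); rewrite -(pmulr_rge0 _ nfp).
suff -> : nsq f * ((X / nsq f) ^+ 2 * nsq f - 2 * (X / nsq f) * X + nsq g) =
  nsq f * nsq g - X ^+ 2 by rewrite subr_ge0.
by field.
Qed.

Lemma inner_prodE f g : inner_prod f g = cintegral (fun t => f t * (g t)^*).
Proof. by []. Qed.

Lemma cauchy_schwarz_sqr f g : L2 f -> L2 g ->
  modulus (inner_prod f g) ^+ 2 <= nsq f * nsq g.
Proof.
move=> f2 g2; have -> : nsq g = nsq (fun t => (g t)^*).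
  by apply: nsq_eq => t _; rewrite modulus_conj.
by apply: cauchy_schwarz => //; exact: L2_conj.
Qed.

(** By Cauchy-Schwarz the functions annihilated by f form a closed subspace,
    so it suffices to approximate g by elements of it. *)
Lemma pairing_closed f g : L2 f -> L2 g ->
  (forall e : R, 0 < e -> exists g', [/\ L2 g', nsq (fun t => g t - g' t) < e &
     cintegral (fun t => f t * g' t) = 0]) ->
  cintegral (fun t => f t * g t) = 0.
Proof.
move=> f2 g2 H; apply: modulus_eq0; apply/eqP; rewrite -sqrf_eq0 eq_le sqr_ge0 andbT.
apply/ler_addgt0Pr => e e0; rewrite add0r.
have d0 : 0 < e / (nsq f + 1) by rewrite divr_gt0// ltr_wpDl ?nsq_ge0.
have [g' [g2' gg' fg']] := H _ d0.
have -> : cintegral (fun t => f t * g t) = cintegral (fun t => f t * (g t - g' t)).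
  under [RHS]cintegral_eq do rewrite mulrBr.
  by rewrite cintegralB ?fg' ?subr0//; exact: L2_cintM.
apply: (le_trans (cauchy_schwarz f2 (L2B g2 g2'))).
rewrite -[leRHS](divfK (_ : nsq f + 1 != 0)); last by rewrite gt_eqF// ltr_wpDl ?nsq_ge0.
rewrite mulrC; apply: ler_pM; rewrite ?nsq_ge0//; [exact: ltW|lra].
Qed.

Lemma inner_prodC f g : cint (fun t => f t * (g t)^*) ->
  inner_prod g f = (inner_prod f g)^*.
Proof.
move=> fg; rewrite !inner_prodE -cintegral_conj//; apply: cintegral_eq => t _.
by rewrite rmorphM/= conjcK mulrC.
Qed.

Lemma inner_prod_nsq f : inner_prod f f = (nsq f)%:C.
Proof. by rewrite /nsq -cintegral_real; apply: cintegral_eq => t _; rewrite mulcJ. Qed.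

Lemma inner_prodDl f g h : L2 f -> L2 g -> L2 h ->
  inner_prod (fun t => f t + g t) h = inner_prod f h + inner_prod g h.
Proof.
move=> f2 g2 h2; have hc := L2_conj h2.
rewrite !inner_prodE -cintegralD; do ?exact: L2_cintM.
by apply: cintegral_eq => t _; rewrite mulrDl.
Qed.

Lemma inner_prodBl f g h : L2 f -> L2 g -> L2 h ->
  inner_prod (fun t => f t - g t) h = inner_prod f h - inner_prod g h.
Proof.
move=> f2 g2 h2; have hc := L2_conj h2.
rewrite !inner_prodE -cintegralB; do ?exact: L2_cintM.
by apply: cintegral_eq => t _; rewrite mulrBl.
Qed.

Lemma inner_prod_ae_eq f f' g g' : cmeasurable f -> cmeasurable f' ->
  cmeasurable g -> cmeasurable g' -> aec (fun t => f t = f' t) ->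
  aec (fun t => g t = g' t) -> inner_prod f g = inner_prod f' g'.
Proof.
move=> mf mf' mg mg' ff gg; apply: cintegral_ae_eq.
- by apply: cmeasM => //; exact: cmeas_conj.
- by apply: cmeasM => //; exact: cmeas_conj.
- by apply: aecS2 ff gg => t _ -> ->.
Qed.

Lemma nsqD f g : L2 f -> L2 g ->
  nsq (fun t => f t + g t) = nsq f + nsq g + 2 * complex.Re (inner_prod f g).
Proof.
move=> f2 g2; have fgi := L2_cintM f2 (L2_conj g2).
rewrite inner_prodE Re_cintegral -rmeanZ; last exact: fgi.1.
rewrite /nsq -rmeanD; do ?exact: L2_sqr.
rewrite -rmeanD; last 2 first.
- by apply: rintD; exact: L2_sqr.
- by apply: rintZ; exact: fgi.1.
apply: rmean_eq => t _; rewrite !modulus_sqr ReD ImD ReM Re_conj Im_conj; ring.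
Qed.

End square_integrable.

(** * Fourier coefficients and trigonometric polynomials *)

Section trigonometric.
Variable R : realType.
Local Notation C := R[i].
Local Notation modulus := (@ComplexField.Normc.normc R).
Local Notation circ := (@circ R).
Local Notation mu := (@lebesgue_measure R).
Implicit Types (f g : R -> C) (t : R).

Lemma modulus_expi t : modulus (expi t) = 1.
Proof. by rewrite /= cos2Dsin2 sqrtr1. Qed.

Lemma modulus_expiX t n : modulus (expi t ^+ n) = 1.
Proof. by rewrite modulusX modulus_expi expr1n. Qed.

Lemma expiD s t : expi (s + t) = expi s * expi t :> C.
Proof.
by apply: complexP; rewrite ?(ReM, ImM) /= ?cosD ?sinD//; ring.
Qed.

Lemma expi0 : expi 0 = 1 :> C.
Proof. by apply: complexP; rewrite /= ?cos0 ?sin0. Qed.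

Lemma expiX t n : expi t ^+ n = expi (n%:R * t) :> C.
Proof.
elim: n => [|n IH]; first by rewrite mul0r expi0 expr0.
by rewrite exprS IH -expiD mulrS mulrDl mul1r.
Qed.

Lemma expi_conjK t : (expi t)^* * expi t = 1 :> C.
Proof. exact: conj_eq_inv (modulus_expi t). Qed.

Lemma cmeas_expi : cmeasurable (@expi R).
Proof.
split; apply: measurable_funTS; apply: continuous_measurable_fun.
- exact: continuous_cos.
- exact: continuous_sin.
Qed.

Lemma cmeas_expiX n : cmeasurable (fun t : R => expi t ^+ n).
Proof. exact: cmeasX cmeas_expi. Qed.

Lemma Linf_expiX n : Linfty (fun t : R => expi t ^+ n).
Proof.
split; first exact: cmeas_expiX.
by exists 1; apply: aecW => t _; rewrite modulus_expiX.
Qed.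

Lemma L2_expiX n : L2 (fun t : R => expi t ^+ n).
Proof. exact/Linf_L2/Linf_expiX. Qed.

Lemma rmean_periodic_derivative (F f : R -> R) :
  (forall x : R, is_derive x (1 : R) F (f x)) -> continuous f -> F (pi *+ 2) = F 0 ->
  rmean f = 0.
Proof.
move=> Ff cf F0; have cF : continuous F.
  by move=> x; apply: differentiable_continuous; apply/derivable1_diffP.
have h := @continuous_FTC2 R f F 0 (pi *+ 2) (twopi_gt0 R) (continuous_subspaceT cf).
have {h} : (\int[mu]_(x in `[0%R, (pi *+ 2)%R]) (f x)%:E = 0)%E.
  rewrite h ?F0 ?subee//.
  - split => //; first by apply: cvg_at_right_filter; exact: cF.
    by apply: cvg_at_left_filter; exact: cF.
  - by move=> x _; rewrite derive1E; exact: derive_val.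
move=> h; rewrite /rmean /circ Rintegral_itv_bndo_bndc; last first.
  apply: (@integrableS _ _ _ mu `[0, pi *+ 2]) => //.
  - exact: subset_itv_co_cc.
  - apply: continuous_compact_integrable; first exact: segment_compact.
    exact: continuous_subspaceT.
by rewrite /Rintegral h mulr0.
Qed.

Lemma sin_2pin n : sin (n%:R * (pi *+ 2)) = 0 :> R.
Proof.
elim: n => [|n IH]; first by rewrite mul0r sin0.
by rewrite mulrSr mulrDl mul1r sinD sin2pi cos2pi IH mul0r mulr0 addr0.
Qed.

Lemma cos_2pin n : cos (n%:R * (pi *+ 2)) = 1 :> R.
Proof.
elim: n => [|n IH]; first by rewrite mul0r cos0.
by rewrite mulrSr mulrDl mul1r cosD sin2pi cos2pi IH mulr0 mulr1 subr0.
Qed.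

Lemma cintegral_expiX n : cintegral (fun t : R => expi t ^+ n.+1) = 0.
Proof.
pose c : R := n.+1%:R.
have c0 : c != 0 by rewrite pnatr_eq0.
apply: complexP; rewrite ?(Re_cintegral, Im_cintegral).
- under eq_fun do rewrite expiX.
  apply: (@rmean_periodic_derivative (fun t => c^-1 * sin (c * t))).
  + move=> x; apply: is_derive_eq; rewrite /GRing.scale/=.
    by rewrite !(mulr0, addr0, add0r, mulr1) mulrCA mulVf// mulr1.
  + move=> x; apply: continuous_comp; last exact: continuous_cos.
    by apply: cvgM; [exact: cvg_cst|exact: cvg_id].
  + by rewrite sin_2pin !mulr0 sin0 mulr0.
- under eq_fun do rewrite expiX.
  apply: (@rmean_periodic_derivative (fun t => - c^-1 * cos (c * t))).
  + move=> x; apply: is_derive_eq; rewrite /GRing.scale/=.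
    rewrite !(mulr0, addr0, add0r, mulr1).
    by field.
  + move=> x; apply: continuous_comp; last exact: continuous_sin.
    by apply: cvgM; [exact: cvg_cst|exact: cvg_id].
  + by rewrite cos_2pin mulr0 cos0.
Qed.

End trigonometric.

Section fourier.
Variable R : realType.
Local Notation C := R[i].
Local Notation modulus := (@ComplexField.Normc.normc R).
Implicit Types (f g : R -> C) (t : R) (p : {poly C}) (a : nat -> C).

(** The description of H2 by Fourier coefficients; lemma H2P proves that it
    agrees with the one by boundary values. *)
Definition hardy f := L2 f /\ forall n, cintegral (fun t => f t * expi t ^+ n.+1) = 0.

Definition fcoef f n := inner_prod f (fun t => expi t ^+ n).

Lemma L2_poly p : L2 (fun t => p.[expi t]).
Proof.
under eq_fun do rewrite horner_coef.
apply: L2_sum => i; apply: L2Z; exact: L2_expiX.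
Qed.

Lemma cint_expiX f n : cint f -> cint (fun t => f t * expi t ^+ n).
Proof.
move=> fi; apply: (cintM_bounded (M := 1) fi (cmeas_expiX _ n)).
by apply: aecW => t _; rewrite modulus_expiX.
Qed.

Lemma cintegralM_poly f p : cint f ->
  cintegral (fun t => f t * p.[expi t]) =
  \sum_(i < size p) p`_i * cintegral (fun t => f t * expi t ^+ i).
Proof.
move=> fi; have -> : cintegral (fun t => f t * p.[expi t]) =
    cintegral (fun t => \sum_(i < size p) p`_i * (f t * expi t ^+ i)).
  apply: cintegral_eq => t _; rewrite horner_coef mulr_sumr.
  by apply: eq_bigr => i _; rewrite mulrCA.
rewrite cintegral_sum => [|i]; last by apply: cintZ; exact: cint_expiX.
by apply: eq_bigr => i _; rewrite cintegralZ//; exact: cint_expiX.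
Qed.

Lemma hardy_poly p : hardy (fun t => p.[expi t]).
Proof.
split=> [|n]; first exact: L2_poly.
under cintegral_eq do rewrite mulrC.
rewrite cintegralM_poly; last exact/L2_cint/L2_expiX.
rewrite big1// => i _; under cintegral_eq do rewrite -exprD addSn.
by rewrite cintegral_expiX mulr0.
Qed.

Lemma cintegral_expi_conj n : cintegral (fun t : R => (expi t ^+ n.+1)^*) = 0.
Proof.
by rewrite cintegral_conj ?cintegral_expiX ?conjc0//; exact/L2_cint/L2_expiX.
Qed.

Lemma expiX_conjK t n : expi t ^+ n * (expi t ^+ n)^* = 1 :> C.
Proof. by rewrite mulcJ modulus_expiX expr1n. Qed.

Lemma expi_orthogonal j k : inner_prod (fun t => expi t ^+ j) (fun t => expi t ^+ k) =
  (j == k)%:R :> C.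
Proof.
rewrite inner_prodE; case: (ltngtP j k) => [jk|kj|->].
- apply: etrans _ (cintegral_expi_conj (k - j).-1); apply: cintegral_eq => t _.
  rewrite prednK ?subn_gt0// -{1}(subnK (ltnW jk)) exprD conjcM mulrCA expiX_conjK.
  by rewrite mulr1.
- apply: etrans _ (cintegral_expiX R (j - k).-1); apply: cintegral_eq => t _.
  rewrite prednK ?subn_gt0// -{1}(subnK (ltnW kj)) exprD -mulrA expiX_conjK.
  by rewrite mulr1.
- by under cintegral_eq do rewrite expiX_conjK; rewrite cintegral_cst.
Qed.

Definition block a m n t := \sum_(m <= k < n) a k * expi t ^+ k.

Lemma L2_block a m n : L2 (block a m n).
Proof. by apply: L2_sum => i; apply: L2Z; exact: L2_expiX. Qed.

Lemma inner_prod_block f a m n : L2 f ->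
  inner_prod f (block a m n) = \sum_(m <= k < n) (a k)^*%C * fcoef f k.
Proof.
move=> f2; rewrite inner_prodE.
have ci k : cint (fun t => f t * (expi t ^+ k)^*).
  by apply: L2_cintM => //; apply: L2_conj; exact: L2_expiX.
under cintegral_eq.
  move=> t _; rewrite rmorph_sum mulr_sumr.
  by under eq_bigr do rewrite rmorphM/= mulrCA; over.
rewrite cintegral_sum => [|k]; last exact: cintZ.
by apply: eq_bigr => k _; rewrite cintegralZ.
Qed.

Lemma fcoef_block a m n k : fcoef (block a m n) k = if (m <= k < n)%N then a k else 0.
Proof.
have ex := L2_expiX R k; have bl := L2_block a m n.
rewrite /fcoef inner_prodC; last by apply: L2_cintM => //; exact: L2_conj.
rewrite inner_prod_block//.
under eq_bigr do rewrite /fcoef expi_orthogonal.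
case: ifPn => mkn.
- rewrite (bigD1_seq k) ?mem_index_iota ?iota_uniq//= eqxx mulr1 big1 ?addr0 ?conjcK//.
  by move=> i /negbTE ik; rewrite eq_sym ik mulr0.
- rewrite big_nat big1 ?conjc0// => i imn.
  by case: eqP mkn => [->|_ _]; rewrite ?imn ?mulr0.
Qed.

Lemma nsq_block a m n : nsq (block a m n) = \sum_(m <= k < n) modulus (a k) ^+ 2.
Proof.
apply: complexI; rewrite -inner_prod_nsq inner_prod_block; last exact: L2_block.
rewrite (rmorph_sum (real_complex R)) !big_nat; apply: eq_bigr => k kn.
by rewrite fcoef_block kn mulrC mulcJ.
Qed.

(** Pythagoras: f minus its partial Fourier sum is orthogonal to that sum. *)
Lemma nsq_fourier f n : L2 f ->
  nsq f = nsq (fun t => f t - block (fcoef f) 0 n t) +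
          \sum_(0 <= k < n) modulus (fcoef f k) ^+ 2.
Proof.
move=> f2; set S := block _ _ _; have S2 : L2 S by exact: L2_block.
rewrite -nsq_block -/S.
have h : inner_prod (fun t => f t - S t) S = 0.
  rewrite inner_prodBl// inner_prod_nsq inner_prod_block// nsq_block (rmorph_sum (real_complex R)).
  apply/eqP; rewrite subr_eq0; apply/eqP; apply: eq_bigr => k _.
  by rewrite mulrC mulcJ.
have := nsqD (L2B f2 S2) S2; rewrite h mulr0 addr0 => <-.
by apply: nsq_eq => t _; rewrite subrK.
Qed.

Lemma bessel f n : L2 f -> \sum_(0 <= k < n) modulus (fcoef f k) ^+ 2 <= nsq f.
Proof. by move=> f2; rewrite (nsq_fourier n f2) lerDr nsq_ge0. Qed.

Lemma block_poly a n t : block a 0 n t = (\poly_(k < n) a k).[expi t].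
Proof. by rewrite horner_poly /block big_mkord. Qed.

End fourier.

(** * Boundary functions of functions on the disc *)

Section disc_functions.
Variable R : realType.
Local Notation C := R[i].
Local Notation modulus := (@ComplexField.Normc.normc R).
Implicit Types (f g : R -> C) (t r : R) (F : C -> C) (a : nat -> C).

(** Fatou's lemma and dominated convergence are about sequences, so radial
    limits are taken along these radii. *)
Definition radius (n : nat) : R := 1 - n.+2%:R^-1.

Lemma radius_itv n : 0 <= radius n < 1.
Proof.
rewrite /radius subr_ge0 invf_le1 ?ler1n// ltrBlDr ltrDl invr_gt0 ltr0n.
by [].
Qed.

Lemma cvg_radius : radius n @[n --> \oo] --> (1 : R).
Proof.
rewrite -[X in _ --> X]subr0; apply: cvgB; first exact: cvg_cst.
by have := @cvg_harmonic R; rewrite -(cvg_shiftS (@harmonic R)).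
Qed.

Lemma cvg_radiusX k : radius n ^+ k @[n --> \oo] --> (1 ^+ k : R).
Proof.
exact: (cvg_comp _ _ cvg_radius (@exprn_continuous R k 1)).
Qed.

Lemma boundary_radius F f : boundary F f ->
  aec (fun t => ccvg \oo (fun n => F ((radius n)%:C * expi t)) (f t)).
Proof.
apply: aecS => t _ /cvg_at_leftP; apply; split; last exact: cvg_radius.
by move=> n; have /andP[] := radius_itv n.
Qed.

Definition power_series a F := forall z : C, modulus z < 1 ->
  ccvg \oo (fun N => \sum_(0 <= n < N) a n * z ^+ n) (F z).

Lemma modulus_radial r t : 0 <= r -> modulus (r%:C * expi t) = r.
Proof. by move=> r0; rewrite modulusM modulus_expi modulus_real mulr1 ger0_norm. Qed.

(** The coefficients of z |-> F (r z), when those of F are given by a. *)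
Definition dilate a r (n : nat) : C := a n * (r ^+ n)%:C.

Lemma block_dilate a r m n t :
  block (dilate a r) m n t = \sum_(m <= k < n) a k * (r%:C * expi t) ^+ k.
Proof.
apply: eq_bigr => k _.
by rewrite exprMn -mulrA (rmorphXn (real_complex R)).
Qed.

Lemma sum_geometric_le (q : R) n : 0 <= q < 1 -> \sum_(0 <= k < n) q ^+ k <= (1 - q)^-1.
Proof.
move=> /andP[q0 q1]; have p : 0 < 1 - q by rewrite subr_gt0.
rewrite -(ler_pM2l p) mulfV ?gt_eqF//.
rewrite (_ : _ * _ = 1 - q ^+ n) ?gerBl ?exprn_ge0//.
by rewrite big_mkord -opprB mulNr -subrX1 opprB.
Qed.

(** The terms of a convergent series are bounded: beyond some rank they are
    differences of two partial sums close to the limit. *)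
Lemma power_series_coef_bounded a F (rho : R) : power_series a F -> 0 <= rho < 1 ->
  exists B : R, forall n, modulus (a n) * rho ^+ n <= B.
Proof.
move=> aF /andP[r0 r1].
have z1 : modulus (rho%:C : C) < 1 by rewrite modulus_real ger0_norm.
have [N _ hN] := ccvg_near ltr01 (aF _ z1).
have term n : modulus (a n) * rho ^+ n = modulus (a n * rho%:C ^+ n).
  by rewrite modulusM modulusX modulus_real ger0_norm.
exists (2 + \sum_(0 <= k < N) modulus (a k) * rho ^+ k) => n.
have s0 : 0 <= \sum_(0 <= k < N) modulus (a k) * rho ^+ k.
  by apply: sumr_ge0 => k _; rewrite mulr_ge0 ?modulus_ge0 ?exprn_ge0.
have [nN|Nn] := ltnP n N.
  apply: (@le_trans _ _ (\sum_(0 <= k < N) modulus (a k) * rho ^+ k)); last by rewrite lerDr.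
  rewrite (bigD1_seq n) ?mem_index_iota ?iota_uniq//= lerDl.
  by apply: sumr_ge0 => k _; rewrite mulr_ge0 ?modulus_ge0 ?exprn_ge0.
rewrite term; apply: (@le_trans _ _ 2); last by rewrite lerDl.
set S := fun N => \sum_(0 <= n < N) a n * rho%:C ^+ n.
have -> : a n * rho%:C ^+ n = (S n.+1 - F rho%:C) - (S n - F rho%:C).
  by rewrite /S big_nat_recr//=; ring.
apply: (le_trans (modulusB _ _)).
have h1 := hN n Nn; have h2 := hN n.+1 (leqW Nn).
by apply: ltW; have := ltrD h2 h1; rewrite /S -(_ : 1 + 1 = 2).
Qed.

(** Comparison with a geometric series, at the radius midway between r and 1.
    *)
Lemma power_series_abs a F r : power_series a F -> 0 <= r < 1 ->
  exists K : R, forall n, \sum_(0 <= k < n) modulus (dilate a r k) <= K.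
Proof.
move=> aF /andP[r0 r1]; pose rho := (1 + r) / 2.
have rho0 : 0 < rho by rewrite divr_gt0// ltr_pwDl.
have rr : r < rho by rewrite /rho; lra.
have [|B hB] := power_series_coef_bounded (rho := rho) aF.
  by rewrite ltW//= /rho; lra.
have q1 : 0 <= r / rho < 1 by rewrite divr_ge0 ?(ltW rho0)//= ltr_pdivrMr// mul1r.
have B0 : 0 <= B.
  by apply: le_trans (hB 0%N); rewrite mulr_ge0 ?modulus_ge0 ?exprn_ge0// ltW.
exists (B * (1 - r / rho)^-1) => n.
apply: le_trans (ler_wpM2l B0 (sum_geometric_le n q1)).
rewrite mulr_sumr; apply: ler_sum => k _.
rewrite modulusM modulus_real ger0_norm ?exprn_ge0//.
have -> : r ^+ k = rho ^+ k * (r / rho) ^+ k.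
  by rewrite -exprMn mulrCA divff ?mulr1// gt_eqF.
by rewrite mulrA ler_wpM2r// exprn_ge0//; case/andP: q1.
Qed.

Section dilation.
Variables (a : nat -> C) (F : C -> C) (r : R).
Hypotheses (aF : power_series a F) (r01 : 0 <= r < 1).

Let Fr t := F (r%:C * expi t).

Let r1 t : modulus (r%:C * expi t) < 1.
Proof. by case/andP: r01 => r0 ?; rewrite modulus_radial. Qed.

Lemma dilate_cvg t : ccvg \oo (fun n => block (dilate a r) 0 n t) (Fr t).
Proof.
rewrite /ccvg; under eq_fun do rewrite block_dilate.
exact: aF.
Qed.

Lemma dilate_bounded : exists K : R,
  (forall n t, modulus (block (dilate a r) 0 n t) <= K).
Proof.
have [K hK] := power_series_abs aF r01; exists K => n t.
apply: le_trans (hK n); apply: (le_trans (modulus_sum _ _ _)).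
by apply: ler_sum => k _; rewrite modulusM modulus_expiX mulr1.
Qed.

Lemma dilate_cmeas : cmeasurable Fr.
Proof.
apply: (cmeas_lim (u := block (dilate a r) 0)) => [n|t _]; last exact: dilate_cvg.
exact: L2_measurable (L2_block _ _ _).
Qed.

Lemma dilate_L2 : L2 Fr.
Proof.
apply/Linf_L2; split; first exact: dilate_cmeas.
have [K hK] := dilate_bounded; exists K; apply: aecW => t _.
apply/ler_addgt0Pr => e e0.
have [n _ /(_ n (leqnn n)) hn] := ccvg_near e0 (dilate_cvg t).
have -> : Fr t = block (dilate a r) 0 n t - (block (dilate a r) 0 n t - Fr t) by ring.
by apply: (le_trans (modulusB _ _)); apply: lerD (hK n t) (ltW hn).
Qed.

(** Termwise integration, justified by dominated convergence. *)
Lemma dilate_fcoef k : fcoef Fr k = dilate a r k.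
Proof.
have [K hK] := dilate_bounded.
have ex := L2_conj (L2_expiX R k).
have [|||||_ cv] := @cintegral_dct R
  (fun n t => block (dilate a r) 0 n t * (expi t ^+ k)^*)
  (fun t => Fr t * (expi t ^+ k)^*) (fun=> K).
- by move=> n; apply: cmeasM; apply: L2_measurable => //; exact: L2_block.
- by apply: cmeasM; [exact: dilate_cmeas|exact: L2_measurable].
- exact: rint_cst.
- move=> n; apply: aecW => t _.
  by rewrite modulusM modulus_conj modulus_expiX mulr1.
- apply: aecW => t _; have := dilate_cvg t; rewrite /ccvg.
  apply: cvg0_le => n; rewrite modulus_ge0 andTb -mulrBl.
  by rewrite modulusM modulus_conj modulus_expiX mulr1.
apply/eqP; rewrite -subr_eq0; apply/eqP/modulus_eq0/eqP.
rewrite eq_le modulus_ge0 andbT; apply/ler_addgt0Pr => e e0; rewrite add0r.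
have [n _ /(_ (maxn n k.+1) (leq_maxl _ _)) hn] := ccvg_near e0 cv.
have := fcoef_block (dilate a r) 0 (maxn n k.+1) k.
rewrite leq0n leq_max ltnSn orbT/= => h.
move: hn; rewrite -[X in modulus (X - _)]/(fcoef (block (dilate a r) 0 (maxn n k.+1)) k).
by rewrite h modulus_distC => /ltW.
Qed.

End dilation.

Lemma nsq_le_fatou (u : nat -> R -> C) f (c : R) : 0 <= c -> (forall n, L2 (u n)) ->
  cmeasurable f -> (forall n, nsq (u n) <= c) ->
  aec (fun t => ccvg \oo (u ^~ t) (f t)) -> L2 f /\ nsq f <= c.
Proof.
move=> c0 u2 mf uc uf.
have [] := rmean_fatou c0 (fun n => L2_sqr (u2 n)) (fun n t _ => sqr_ge0 _)
  (meas_modulus2 mf) (fun t _ => sqr_ge0 _) uc.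
  apply: aecS uf => t _ /ccvgP[ru iu].
  under eq_fun do rewrite modulus_sqr.
  rewrite modulus_sqr; apply: cvgD.
    by rewrite expr2; under eq_fun do rewrite expr2; exact: cvgM.
  by rewrite expr2; under eq_fun do rewrite expr2; exact: cvgM.
by move=> fi fc; split.
Qed.

(** Bessel's inequality on the circle of radius r, and then r tends to 1. *)
Lemma H2_disc_square_summable a F : power_series a F -> H2_disc F ->
  exists M : R, forall n, \sum_(0 <= k < n) modulus (a k) ^+ 2 <= M.
Proof.
move=> aF [_ [M hM]]; exists ((pi *+ 2)^-1 * M) => n.
have le_r m : \sum_(0 <= k < n) modulus (dilate a (radius m) k) ^+ 2 <= (pi *+ 2)^-1 * M.
  have r01 := radius_itv m.
  have L := dilate_L2 aF r01.
  under eq_bigr do rewrite -(dilate_fcoef aF r01).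
  apply: (le_trans (bessel n L)).
  have := hM _ r01; have := rmeanE (L2_sqr L); rewrite /= => ->.
  by rewrite lee_fin -ler_pdivlMl// twopi_gt0.
have term k : modulus (dilate a (radius m) k) ^+ 2 @[m --> \oo] -->
    modulus (a k) ^+ 2.
  have -> : (fun m => modulus (dilate a (radius m) k) ^+ 2) =
            (fun m => modulus (a k) ^+ 2 * `|radius m ^+ k ^+ 2|).
    by apply/funext => m; rewrite modulusM exprMn modulus_real [in RHS]normrX.
  have h : `|radius m ^+ k ^+ 2| @[m --> \oo] --> (1 : R).
    have -> : (1 : R) = `|1 ^+ (k * 2)| by rewrite expr1n normr1.
    by apply: cvg_norm; under eq_fun do rewrite -exprM; exact: cvg_radiusX.
  by have := cvgMl_tmp (a := modulus (a k) ^+ 2) h; rewrite mulr1; exact.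
have cv := @cvg_rsum _ _ _ _ _ (index_iota 0 n) _ _ term.
by apply: (ler_cvg_to (cv _) (cvg_cst _)); exact: nearW.
Qed.

(** The approximants are the Taylor polynomials of the disc function. By
    Fatou's lemma, applied on the circles of radius r and then as r tends to
    1, the squared distance to the N-th one is at most the tail of the
    convergent series of the |a k|^2. *)
Lemma H2_poly_dense f : H2 f -> forall e : R, 0 < e ->
  exists p : {poly C}, nsq (fun t => f t - p.[expi t]) < e.
Proof.
move=> [f2 [F [[a aF] Fb] bF]] e e0.
have [M hM] := H2_disc_square_summable aF (conj (ex_intro _ a aF) Fb).
pose S n := \sum_(0 <= k < n) modulus (a k) ^+ 2.
have ndS : nondecreasing_seq S.
  apply/nondecreasing_seqP => n; rewrite /S big_nat_recr//= lerDl sqr_ge0 //.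
have cS : cvgn S by apply: nondecreasing_is_cvgn => //; exists M => _ [n _ <-]; exact: hM.
have Sle n : S n <= limn S by exact: nondecreasing_cvgn_le.
have [N _ /(_ N (leqnn N)) hN] : \forall n \near \oo, `|limn S - S n| < e.
  by move/cvgrPdist_lt : cS; exact.
have {}hN : limn S - S N < e by apply: le_lt_trans hN; exact: ler_norm.
exists (\poly_(k < N) a k).
have -> : (fun t => f t - (\poly_(k < N) a k).[expi t]) = (fun t => f t - block a 0 N t).
  by apply/funext => t; rewrite block_poly.
apply: le_lt_trans hN.
have tail0 : 0 <= limn S - S N by rewrite subr_ge0.
have step1 r : 0 <= r < 1 ->
    nsq (fun t => F (r%:C * expi t) - block (dilate a r) 0 N t) <= limn S - S N.
  move=> r01; have /andP[r0 r1] := r01.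
  apply: (@nsq_le_fatou (fun m => block (dilate a r) N (m + N)) _ _ tail0 _ _ _ _).2.
  - by move=> m; exact: L2_block.
  - apply: L2_measurable; apply: L2B; [exact: (dilate_L2 aF r01)|exact: L2_block].
  - move=> m; rewrite nsq_block.
    apply: (@le_trans _ _ (S (m + N)%N - S N)); last by rewrite lerD2r; exact: Sle.
    have -> : S (m + N)%N - S N = \sum_(N <= k < m + N) modulus (a k) ^+ 2.
      by rewrite /S (@big_cat_nat _ _ _ N 0 (m + N))//= ?leq_addl// addrAC subrr add0r.
    apply: ler_sum => k _; rewrite modulusM exprMn ler_piMr ?sqr_ge0//.
    rewrite modulus_real ger0_norm ?exprn_ge0// -exprM exprn_ile1//; exact: ltW.
  - apply: aecW => t _; have := dilate_cvg aF r01 t; rewrite /ccvg.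
    rewrite -(cvg_shiftn N); apply: cvg0_le => m; rewrite modulus_ge0 andTb.
    rewrite /block (@big_cat_nat _ _ _ N 0 (m + N))//= ?leq_addl//.
    by rewrite le_eqVlt; apply/orP; left; apply/eqP; congr modulus; ring.
apply: (nsq_le_fatou (u := fun m t => F ((radius m)%:C * expi t) -
          block (dilate a (radius m)) 0 N t) tail0 _ _ _ _).2.
- move=> m; apply: L2B; last exact: L2_block.
  exact: (dilate_L2 aF (radius_itv m)).
- by apply: L2_measurable; apply: L2B => //; exact: L2_block.
- move=> m; exact: step1 (radius_itv m).
- apply: aecS (boundary_radius bF) => t _ cv.
  apply: ccvgB => //; apply: ccvg_sum => k; apply: ccvgM; last exact: ccvg_cst.
  rewrite -[X in ccvg _ _ X]mulr1; apply: ccvgM; first exact: ccvg_cst.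
  by apply: ccvg_real; rewrite -(expr1n _ k); exact: cvg_radiusX.
Qed.

End disc_functions.

(** * The Cauchy and Poisson kernels *)

Section kernels.
Variable R : realType.
Local Notation C := R[i].
Local Notation modulus := (@ComplexField.Normc.normc R).
Local Notation circ := (@circ R).
Implicit Types (f g : R -> C) (s t r : R) (z w : C).

Lemma H2_hardy f : H2 f -> hardy f.
Proof.
move=> f2; have L := f2.1; split=> // n.
under cintegral_eq do rewrite mulrC.
apply: pairing_closed => //; first exact: L2_expiX.
move=> e e0; have [p hp] := H2_poly_dense f2 e0.
exists (fun t => p.[expi t]); split=> //; first exact: L2_poly.
by under cintegral_eq do rewrite mulrC; exact: (hardy_poly p).2.
Qed.

Lemma one_sub_neq0 w : modulus w < 1 -> 1 - w != 0.
Proof.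
move=> w1.
by apply: contraTneq w1 => /eqP; rewrite subr_eq0 => /eqP <-; rewrite modulus1 ltxx.
Qed.

Lemma cvg_geometric_modulus w : modulus w < 1 ->
  ccvg \oo (fun n => \sum_(0 <= k < n) w ^+ k) (1 - w)^-1.
Proof.
move=> w1; have d0 := one_sub_neq0 w1.
have E n : \sum_(0 <= k < n) w ^+ k = (1 - w)^-1 - (1 - w)^-1 * w ^+ n.
  apply: (mulfI d0); rewrite mulrBr mulrA divff// mul1r.
  by rewrite big_mkord -opprB mulNr -subrX1 opprB.
rewrite /ccvg; under eq_fun do rewrite E addrAC subrr add0r modulusN modulusM modulusX.
rewrite -(mulr0 (modulus (1 - w)^-1)); apply: cvgMl_tmp.
by apply: cvg_expr; rewrite ger0_norm ?modulus_ge0.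
Qed.

Lemma modulus_sum_geometric w (q : R) n : modulus w <= q -> q < 1 ->
  modulus (\sum_(0 <= k < n) w ^+ k) <= (1 - q)^-1.
Proof.
move=> wq q1; have q0 : 0 <= q by apply: le_trans wq; exact: modulus_ge0.
apply: le_trans (sum_geometric_le n (_ : 0 <= q < 1)); last by rewrite q0 q1.
apply: (le_trans (modulus_sum _ _ _)); apply: ler_sum => k _.
by rewrite modulusX lerXn2r ?nnegrE ?modulus_ge0.
Qed.

Lemma cintegral_geometric f (u : R -> C) (q : R) : cint f -> cmeasurable u ->
  (forall s, modulus (u s) <= q) -> q < 1 ->
  cint (fun s => f s * (1 - u s)^-1) /\
  ccvg \oo (fun n => cintegral (fun s => f s * \sum_(0 <= k < n) u s ^+ k))
    (cintegral (fun s => f s * (1 - u s)^-1)).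
Proof.
move=> fi mu uq q1; have mf := cint_measurable fi.
have mS n : cmeasurable (fun s => f s * \sum_(0 <= k < n) u s ^+ k).
  by apply: cmeasM => //; apply: cmeas_sum => k; exact: cmeasX.
have cv s : ccvg \oo (fun n => f s * \sum_(0 <= k < n) u s ^+ k) (f s * (1 - u s)^-1).
  apply: ccvgM; first exact: ccvg_cst.
  by apply: cvg_geometric_modulus; exact: le_lt_trans q1.
apply: (cintegral_dct (g := fun s => (1 - q)^-1 * modulus (f s))) => //.
- exact: cmeas_lim mS (fun s _ => cv s).
- exact/rintZ/cint_modulus.
- move=> n; apply: aecW => s _; rewrite modulusM mulrC ler_wpM2r ?modulus_ge0//.
  exact: modulus_sum_geometric.
- by apply: aecW => s _; exact: cv.
Qed.

Definition cauchy_kernel z s : C := (1 - z * (expi s)^*)^-1.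

Definition cauchy f z := cintegral (fun s => f s * cauchy_kernel z s).

Definition poisson z s : R := (1 - modulus z ^+ 2) / modulus (expi s - z) ^+ 2.

Lemma cmeas_rot z : cmeasurable (fun s => z * (expi s)^*).
Proof. by apply: cmeasM; [exact: cmeas_cst|apply: cmeas_conj; exact: cmeas_expi]. Qed.

Lemma modulus_rot z s : modulus (z * (expi s)^*) = modulus z.
Proof. by rewrite modulusM modulus_conj modulus_expi mulr1. Qed.

Lemma cint_cauchy f z : cint f -> modulus z < 1 ->
  cint (fun s => f s * cauchy_kernel z s).
Proof.
move=> fi z1; apply: (cintegral_geometric fi (cmeas_rot z) _ z1).1 => s.
by rewrite modulus_rot.
Qed.

Lemma cauchy_series f : cint f -> power_series (fcoef f) (cauchy f).
Proof.
move=> fi z z1.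
have [|_] := cintegral_geometric fi (cmeas_rot z) _ z1.
  by move=> s; rewrite modulus_rot.
apply: cvg0_le => n; rewrite modulus_ge0 andTb.
suff -> : \sum_(0 <= k < n) fcoef f k * z ^+ k =
  cintegral (fun s => f s * \sum_(0 <= k < n) (z * (expi s)^*%C) ^+ k) by [].
have ci k : cint (fun t => f t * (expi t ^+ k)^*).
  apply: (cintM_bounded (M := 1) fi); first exact/cmeas_conj/cmeas_expiX.
  by apply: aecW => t _; rewrite modulus_conj modulus_expiX.
transitivity (cintegral (fun s => \sum_(0 <= k < n) z ^+ k * (f s * (expi s ^+ k)^*%C))).
  rewrite cintegral_sum => [|k]; last by apply: cintZ; exact: ci.
  by apply: eq_bigr => k _; rewrite cintegralZ; [rewrite mulrC|exact: ci]. 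
apply: cintegral_eq => s _; rewrite mulr_sumr; apply: eq_bigr => k _.
by rewrite exprMn conjcX mulrCA.
Qed.

(** With w = z conj(exp(i s)), this is 1/(1 - w) + conj(w)/(1 - conj(w)) = (1
    - |w|^2)/|1 - w|^2. *)
Lemma poissonE z s : modulus z < 1 -> (poisson z s)%:C =
  cauchy_kernel z s + (z^* * expi s) * (1 - z^* * expi s)^-1.
Proof.
move=> z1; rewrite /poisson /cauchy_kernel; set w := z * (expi s)^*.
have -> : z^* * expi s = w^* by rewrite /w conjcM conjcK.
have -> : modulus z = modulus w by rewrite modulus_rot.
have -> : modulus (expi s - z) = modulus (1 - w).
  rewrite -[RHS]mul1r -(modulus_expi s) -modulusM mulrBr mulr1 /w.
  by rewrite mulrCA [expi s * _]mulrC expi_conjK mulr1.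
have w1 : modulus w < 1 by rewrite modulus_rot.
have d0 := one_sub_neq0 w1.
have d1 : 1 - w^* != 0 by apply: one_sub_neq0; rewrite modulus_conj.
have -> (x y : R) : ((1 - x) / y)%:C = (1 - x%:C) / y%:C.
  by rewrite (rmorphM (real_complex R)) (fmorphV (real_complex R)) (rmorphB (real_complex R)).
rewrite -!mulcJ conjcB conjc1.
by field; rewrite d0 d1.
Qed.

Lemma poisson_ge0 z s : modulus z < 1 -> 0 <= poisson z s.
Proof.
move=> z1; rewrite divr_ge0 ?sqr_ge0// subr_ge0 expr_le1//; first exact: ltW.
exact: modulus_ge0.
Qed.

Lemma poisson_le z s : modulus z < 1 -> poisson z s <= 2 / (1 - modulus z).
Proof.
move=> z1; have p : 0 < 1 - modulus z by rewrite subr_gt0.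
have h : 1 - modulus z <= modulus (expi s - z).
  rewrite lerBlDr -(modulus_expi s); apply: le_trans (modulusD _ _).
  by rewrite subrK.
have h0 : 0 < modulus (expi s - z) by exact: lt_le_trans p h.
rewrite ler_pdivrMr ?exprn_gt0// mulrAC ler_pdivlMr//.
have z0 := modulus_ge0 z.
have : (1 - modulus z) ^+ 2 <= modulus (expi s - z) ^+ 2.
  by rewrite lerXn2r ?nnegrE ?(ltW p) ?(ltW h0).
by nra.
Qed.

Lemma cmeas_poisson z : modulus z < 1 -> measurable_fun circ (poisson z).
Proof.
move=> z1.
have : cmeasurable (fun s => (poisson z s)%:C).
  have -> : (fun s => (poisson z s)%:C) = (fun s => 1 * cauchy_kernel z s +
       (z^* * expi s) * (1 - z^* * expi s)^-1).
    by apply/funext => s; rewrite poissonE// mul1r.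
  have mz : cmeasurable (fun s => z^* * expi s).
    by apply: cmeasM; [exact: cmeas_cst|exact: cmeas_expi].
  apply: cmeasD; apply: cint_measurable.
  - exact: (cint_cauchy (cint_cst (1 : C)) z1).
  - have zi : cint (fun s => z^* * expi s).
      apply: (cint_bounded (M := modulus z) mz); apply: aecW => s _.
      by rewrite modulusM modulus_conj modulus_expi mulr1.
    apply: (cintegral_geometric zi mz _ z1).1 => s.
    by rewrite modulusM modulus_conj modulus_expi mulr1.
by case.
Qed.

Lemma rint_poisson z (h : R -> R) : rint h -> modulus z < 1 ->
  rint (fun s => poisson z s * h s).
Proof.
move=> hi z1; apply: (rint_dom_all _ (rintZ (2 / (1 - modulus z)) (rint_abs hi))).
  by apply: measurable_funM; [exact: cmeas_poisson|exact: rint_measurable].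
move=> s _; rewrite normrM ger0_norm ?poisson_ge0// ler_wpM2r//.
exact: poisson_le.
Qed.

(** The two kernels differ by a power series in exp(i s) without constant
    term, which a function with vanishing negative coefficients does not see.
    *)
Lemma cauchy_poisson f z : hardy f -> modulus z < 1 ->
  cauchy f z = cintegral (fun s => f s * (poisson z s)%:C).
Proof.
move=> [f2 fh] z1; have fi := L2_cint f2.
have mz : cmeasurable (fun s => z^* * expi s).
  by apply: cmeasM; [exact: cmeas_cst|exact: cmeas_expi].
have modz s : modulus (z^* * expi s) <= modulus z.
  by rewrite modulusM modulus_conj modulus_expi mulr1.
have gi : cint (fun s => f s * (z^* * expi s)).
  by apply: cintM_bounded fi mz (aecW (fun s _ => modz s)).
have [hi cv] := cintegral_geometric gi mz modz z1.
have h0 : cintegral (fun s => f s * (z^* * expi s) * (1 - z^* * expi s)^-1) = 0.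
  apply: ccvg_unique cv _; apply: near_ccvg => e e0; apply: nearW => n.
  rewrite subr0 (_ : cintegral _ = 0) ?modulus0//.
  transitivity (cintegral (fun s => \sum_(0 <= k < n) z^*%C ^+ k.+1 * (f s * expi s ^+ k.+1))).
    apply: cintegral_eq => s _; rewrite mulr_sumr; apply: eq_bigr => k _.
    rewrite -mulrA -exprS exprMn; exact: mulrCA.
  rewrite cintegral_sum => [|k]; last by apply: cintZ; exact: cint_expiX.
  rewrite big1// => k _; rewrite cintegralZ; last exact: cint_expiX.
  by rewrite fh mulr0.
rewrite /cauchy -[LHS]addr0 -[X in _ + X]h0 -cintegralD//; last exact: (cint_cauchy fi z1).
by apply: cintegral_eq => s _; rewrite poissonE// mulrDr [in RHS]mulrA.
Qed.

(** The constant function 1 is its own Cauchy integral. *)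
Lemma rmean_poisson z : modulus z < 1 -> rmean (poisson z) = 1.
Proof.
move=> z1; have h1 : hardy (fun=> 1 : C).
  have := hardy_poly (1 : {poly C}).
  by under eq_fun do rewrite hornerC.
have := cauchy_poisson h1 z1.
have -> : cauchy (fun=> 1) z = 1.
  apply: ccvg_unique (cauchy_series (cint_cst (1 : C)) z1) _.
  apply: near_ccvg => e e0; exists 1%N => // n /= n1.
  rewrite (_ : \sum_(_ <= _ < _) _ = 1) ?subrr ?modulus0//.
  have fc k : fcoef (fun=> 1 : C) k = (k == 0%N)%:R.
    rewrite eq_sym -expi_orthogonal; apply: cintegral_eq => s _.
    by rewrite expr0.
  rewrite -(prednK n1) big_nat_recl// fc mul1r expr0 big1 ?addr0// => k _.
  by rewrite fc mul0r.
have -> : (fun s => 1 * (poisson z s)%:C) = (fun s => (poisson z s)%:C).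
  by apply/funext => s; rewrite mul1r.
by rewrite cintegral_real => /complexI.
Qed.

End kernels.

(** * Fatou's theorem on radial limits *)

Section radial_limits.
Variable R : realType.
Local Notation C := R[i].
Local Notation modulus := (@ComplexField.Normc.normc R).
Implicit Types (s t r x e : R).

(** From 1 - cos x = 2 sin^2 (x/2) and, by the mean value theorem, sin y >=
    y/2 as long as cos >= 1/2 on [0, y]. *)
Lemma cos_quadratic : exists2 d : R, 0 < d &
  forall x, `|x| < d -> x ^+ 2 / 8 <= 1 - cos x.
Proof.
have [d /= d0 hd] : exists2 d : R, 0 < d & forall y, `|y| < d -> 2^-1 < cos y.
  have := @continuous_cos R 0; rewrite /continuous_at cos0.
  move/cvgrPdist_lt => /(_ (2^-1) ltac:(by rewrite invr_gt0)).
  move=> /nbhs_ballP[d /= d0 hd]; exists d => // y yd.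
  have := hd y; rewrite /ball/= sub0r normrN => /(_ yd).
  rewrite ltr_norml => /andP[_]; lra.
have sin_ge y : 0 < y < d -> y / 2 <= sin y.
  move=> /andP[y0 yd].
  have [|c] := @MVT R sin cos 0 y y0 (fun x _ => is_derive_sin x).
    by apply: continuous_subspaceT; exact: continuous_sin.
  rewrite in_itv/= sin0 !subr0 => /andP[c0 cy] ->.
  have : 2^-1 < cos c by apply: hd; rewrite gtr0_norm// (lt_trans cy).
  by nra.
exists d => // x xd.
have -> : cos x = 1 - 2 * sin (`|x| / 2) ^+ 2.
  have -> : cos x = cos ((`|x| / 2) *+ 2).
    rewrite -[in RHS]mulr_natr divfK//.
    by have [x0|x0] := leP 0 x; rewrite ?(ger0_norm x0) ?(ltr0_norm x0) ?cosN.
  by rewrite cos_mulr2n sin2cos2 -mulr_natr; ring.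
have [->|x0] := eqVneq x 0.
  by rewrite normr0 mul0r sin0 expr0n/= !mulr0 mul0r; lra.
have xp : 0 < `|x| by rewrite normr_gt0.
have := sin_ge (`|x| / 2); rewrite divr_gt0//= => /(_ ltac:(lra)) h.
by rewrite -(real_normK (num_real x)); nra.
Qed.

Lemma cos_far (d x : R) : 0 < d <= pi -> d <= `|x| -> `|x| <= pi *+ 2 - d ->
  cos x <= cos d.
Proof.
move=> /andP[d0 dpi] dx xd.
have anti y : d <= y -> y <= pi -> cos y <= cos d.
  move=> dy ypi; rewrite leNgt ltr_cos -?leNgt// in_itv/= ?(ltW d0)//.
  by rewrite ypi (le_trans (ltW d0)).
have -> : cos x = cos `|x|.
  by have [x0|x0] := leP 0 x; rewrite ?(ger0_norm x0) ?(ltr0_norm x0) ?cosN.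
have [xpi|xpi] := leP `|x| pi; first exact: anti.
have -> : cos `|x| = cos (pi *+ 2 - `|x|).
  by rewrite cosB cos2pi sin2pi mul1r mul0r addr0.
apply: anti; first by lra.
by move: xpi; rewrite mulr2n; lra.
Qed.

Lemma modulus_expiB s t r : modulus (expi s - r%:C * expi t) ^+ 2 =
  (1 - r) ^+ 2 + 2 * r * (1 - cos (s - t)).
Proof.
rewrite modulus_sqr cosB /expi /=.
have := cos2Dsin2 s; have := cos2Dsin2 t => h1 h2.
transitivity ((cos s ^+ 2 + sin s ^+ 2) + r ^+ 2 * (cos t ^+ 2 + sin t ^+ 2) -
   2 * r * (cos s * cos t + sin s * sin t)); first by ring.
by rewrite h1 h2; ring.
Qed.

Lemma poisson_radialE s t r : 0 <= r -> poisson (r%:C * expi t) s =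
  (1 - r ^+ 2) / ((1 - r) ^+ 2 + 2 * r * (1 - cos (s - t))).
Proof. by move=> r0; rewrite /poisson modulus_expiB modulus_radial. Qed.

Lemma poisson_near s t r : 2^-1 <= r < 1 ->
  (s - t) ^+ 2 / 8 <= 1 - cos (s - t) ->
  poisson (r%:C * expi t) s <= 16 * ((1 - r) / ((1 - r) ^+ 2 + (s - t) ^+ 2)).
Proof.
move=> /andP[r2 r1] h; rewrite poisson_radialE; last by lra.
set x := s - t in h *; have x0 := sqr_ge0 x.
have p1 : 0 < (1 - r) ^+ 2 by rewrite exprn_gt0// subr_gt0.
have p2 : 0 < (1 - r) ^+ 2 + x ^+ 2 by lra.
have p3 : ((1 - r) ^+ 2 + x ^+ 2) / 8 <= (1 - r) ^+ 2 + 2 * r * (1 - cos x) by nra.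
rewrite ler_pdivrMr; last by lra.
have q : 0 < (1 - r) / ((1 - r) ^+ 2 + x ^+ 2) by rewrite divr_gt0 ?subr_gt0.
apply: (@le_trans _ _ (16 * ((1 - r) / ((1 - r) ^+ 2 + x ^+ 2)) *
    (((1 - r) ^+ 2 + x ^+ 2) / 8))).
  rewrite (_ : _ * (_ / 8) = 2 * (1 - r)); last by field; rewrite gt_eqF.
  by nra.
by rewrite ler_wpM2l// mulr_ge0// ltW.
Qed.

Lemma poisson_far s t r (d : R) : 0 <= r < 1 -> 0 < sin d -> cos (s - t) <= cos d ->
  poisson (r%:C * expi t) s <= 2 / sin d ^+ 2 * (1 - r).
Proof.
move=> /andP[r0 r1] sd h; rewrite poisson_radialE//.
have sd2 : 0 < sin d ^+ 2 by rewrite exprn_gt0.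
have p : sin d ^+ 2 <= (1 - r) ^+ 2 + 2 * r * (1 - cos (s - t)).
  have : (1 - r) ^+ 2 + 2 * r * (1 - cos d) <= (1 - r) ^+ 2 + 2 * r * (1 - cos (s - t)).
    by rewrite lerD2l ler_wpM2l ?mulr_ge0//; lra.
  apply: le_trans; rewrite sin2cos2.
  by have := sqr_ge0 (r - cos d); rewrite !expr2; lra.
rewrite ler_pdivrMr; last exact: lt_le_trans p.
apply: (@le_trans _ _ (2 * (1 - r))); first by nra.
set D := (1 - r) ^+ 2 + _ in p *.
rewrite (_ : _ * D = 2 * (1 - r) * (D / sin d ^+ 2)); last by ring.
rewrite ler_peMr ?mulr_ge0 ?subr_ge0 ?(ltW r1)//.
by rewrite ler_pdivlMr ?mul1r.
Qed.

(** The k-th term has weight 4/(4^k e) on a neighbourhood of 0 of length of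
    order 2^k e: against a function with small averages near 0, the right-hand
    side is a convergent geometric series. *)
Lemma dyadic_bound e (rho x : R) N : 0 < e -> rho <= 2 ^+ N * e -> `|x| < rho ->
  e / (e ^+ 2 + x ^+ 2) <=
  \sum_(k < N.+1) 4 / (4 ^+ k * e) * (`|x| < Num.min (2 ^+ k * e) rho)%R%:R.
Proof.
move=> e0 rN xr.
have ex : exists k : nat, `|x| < 2 ^+ k * e by exists N; exact: lt_le_trans rN.
case: (ex_minnP ex) => k xk kmin.
have kN : (k < N.+1)%N by rewrite ltnS; apply: kmin; exact: lt_le_trans rN.
rewrite (bigD1 (Ordinal kN))//= lt_min xk xr mulr1.
rewrite -[leLHS]addr0; apply: lerD; last first.
  apply: sumr_ge0 => j _; rewrite mulr_ge0 ?ler0n// divr_ge0// mulr_ge0 ?exprn_ge0// ltW//.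
have e2 : 0 < e ^+ 2 by rewrite exprn_gt0.
have x2 := sqr_ge0 x.
have pk : 0 < (4 : R) ^+ k by rewrite exprn_gt0.
rewrite ler_pdivrMr; last by lra.
rewrite mulrAC ler_pdivlMr; last by rewrite mulr_gt0.
case: k xk kmin kN pk => [|k] xk kmin _ pk.
  by rewrite expr0 mul1r -expr2; lra.
have {}xk : 2 ^+ k * e <= `|x|.
  by rewrite leNgt; apply/negP => /kmin; rewrite ltnn.
have : (2 ^+ k * e) ^+ 2 <= x ^+ 2.
  by rewrite -(real_normK (num_real x)) lerXn2r ?nnegrE// mulr_ge0 ?exprn_ge0// ltW.
rewrite exprMn exprAC (_ : (2 : R) ^+ 2 = 4); last by rewrite -natrX.
move=> h; have -> : e * (4 ^+ k.+1 * e) = 4 * (4 ^+ k * e ^+ 2) by rewrite exprS; ring.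
by lra.
Qed.

Lemma rint_indicM (A : set R) (g : R -> R) : measurable A -> rint g ->
  rint (fun s => \1_A s * g s).
Proof.
move=> mA gi; apply: (rint_dom_all _ (rint_abs gi)).
  by apply: measurable_funM; [exact: measurable_indic|exact: rint_measurable].
move=> s _; rewrite normrM indicE; case: (s \in A); rewrite ?normr0 ?normr1 ?mul0r ?mul1r//.
Qed.

Lemma indic_ball t (rho : R) s : \1_(ball t rho) s = (`|s - t| < rho)%R%:R :> R.
Proof. by rewrite indicE mem_setE distrC. Qed.

(** Near t the dyadic bound leaves a multiple of the averages of g on small
    balls; away from t the kernel is of order 1 - r. *)
Lemma rmean_poisson_le (g : R -> R) t r (rho d eta : R) : rint g -> (forall s, 0 <= g s) ->
  2^-1 <= r < 1 ->
  0 < rho <= d -> (forall x, `|x| < d -> x ^+ 2 / 8 <= 1 - cos x) ->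
  rho <= t -> t <= pi *+ 2 - rho -> rho < pi ->
  0 <= eta ->
  (forall r', 0 < r' <= rho -> rmean (fun s => \1_(ball t r') s * g s) <= r' * eta) ->
  rmean (fun s => poisson (r%:C * expi t) s * g s) <=
  128 * eta + 2 / sin rho ^+ 2 * (1 - r) * rmean g.
Proof.
move=> gi g0 /andP[r2 r1] /andP[rho0 rd] hd rt tr rpi eta0 hA.
have r01 : 0 <= r < 1 by rewrite r1 andbT; lra.
have /andP[r0 _] := r01.
have z1 : modulus (r%:C * expi t) < 1 by rewrite modulus_radial.
set e := 1 - r; have e0 : 0 < e by rewrite subr_gt0.
have srho : 0 < sin rho by apply: sin_gt0_pi; rewrite rho0.
have [N hN] : exists N, rho <= 2 ^+ N * e.
  have := archi_boundP (ltW (divr_gt0 rho0 e0)); set N := Num.bound _ => h.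
  exists N; rewrite -ler_pdivrMr//; apply: (le_trans (ltW h)).
  by rewrite -natrX ler_nat ltnW// ltn_expl.
pose c k : R := 64 / (4 ^+ k * e).
pose rk k : R := Num.min (2 ^+ k * e) rho.
have rk0 k : 0 < rk k by rewrite lt_min rho0 mulr_gt0// exprn_gt0.
have mball k : measurable (ball t (rk k)) by exact: measurable_ball.
pose G s := \sum_(k < N.+1) c k * (\1_(ball t (rk k)) s * g s) +
             2 / sin rho ^+ 2 * e * g s.
have c0 k : 0 <= c k by rewrite divr_ge0// mulr_ge0 ?exprn_ge0// ltW.
have sumi (n : nat) : rint (fun s => \sum_(k < n) c k * (\1_(ball t (rk k)) s * g s)) /\
   rmean (fun s => \sum_(k < n) c k * (\1_(ball t (rk k)) s * g s)) =
   \sum_(k < n) c k * rmean (fun s => \1_(ball t (rk k)) s * g s).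
  elim: n => [|n [IH1 IH2]].
    under eq_fun do rewrite big_ord0; rewrite big_ord0; split; first exact: rint_cst.
    exact: rmean_cst.
  under eq_fun do rewrite big_ord_recr/=; rewrite big_ord_recr/=.
  have ii : rint (fun s => \1_(ball t (rk n)) s * g s) by exact: rint_indicM.
  split; first by apply: rintD => //; exact: rintZ.
  by rewrite rmeanD ?rmeanZ ?IH2//; exact: rintZ.
have [Si Se] := sumi N.+1.
apply: (@le_trans _ _ (rmean G)).
  apply: rmean_le_all => [||s cs]; first exact: rint_poisson.
    by apply: rintD => //; exact: rintZ.
  rewrite /G; under eq_bigr do rewrite mulrA.
  rewrite -mulr_suml -mulrDl ler_wpM2r//.
  have [near|far] := ltP `|s - t| rho.
    have h1 : poisson (r%:C * expi t) s <= 16 * (e / (e ^+ 2 + (s - t) ^+ 2)).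
      by apply: poisson_near; [rewrite r2|apply: hd; exact: lt_le_trans rd].
    have h2 := dyadic_bound e0 hN near.
    rewrite -[leLHS]addr0; apply: lerD; last first.
      by rewrite mulr_ge0 ?(ltW e0)// divr_ge0// sqr_ge0.
    apply: (le_trans h1); apply: le_trans (ler_wpM2l _ h2) _ => //.
    rewrite mulr_sumr le_eqVlt; apply/orP; left; apply/eqP; apply: eq_bigr => k _.
    by rewrite indic_ball /c /rk; field; rewrite gt_eqF// expf_neq0.
  rewrite -[leLHS]add0r; apply: lerD.
    by apply: sumr_ge0 => k _; rewrite mulr_ge0// indic_ball ler0n.
  apply: poisson_far => //; apply: cos_far => //; first by rewrite rho0 ltW.
  move: cs; rewrite /Defs.circ/= in_itv/= => /andP[s0 s2].
  by rewrite ler_norml; apply/andP; split; lra.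
rewrite /G rmeanD//; last exact: rintZ.
rewrite Se rmeanZ// lerD2r.
apply: (@le_trans _ _ (\sum_(k < N.+1) 64 * eta * (2^-1) ^+ k)).
  apply: ler_sum => k _.
  apply: (@le_trans _ _ (c k * (2 ^+ k * e * eta))).
    rewrite ler_wpM2l//; apply: (le_trans (hA (rk k) _)).
      by rewrite rk0 ge_min lexx orbT.
    by rewrite ler_wpM2r// ge_min lexx.
  rewrite /c (_ : (4 : R) = 2 * 2); last by rewrite -natrM.
  rewrite exprMn exprVn le_eqVlt; apply/orP; left; apply/eqP.
  have p2 : (2 : R) ^+ k != 0 by rewrite expf_neq0.
  by field; rewrite p2 gt_eqF.
rewrite -mulr_sumr.
have := @sum_geometric_le R (2^-1) N.+1; rewrite big_mkord => /(_ ltac:(lra)).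
rewrite (_ : (1 - 2^-1)^-1 = 2 :> R); last by field.
have := mulr_ge0 (ler0n R 64) eta0.
by nra.
Qed.

End radial_limits.

Section fatou_theorem.
Variable R : realType.
Local Notation C := R[i].
Local Notation modulus := (@ComplexField.Normc.normc R).
Local Notation circ := (@circ R).
Local Notation mu := (@lebesgue_measure R).
Implicit Types (s t r x e : R) (h : R -> R).

Lemma rmean_ball_davg h t (rho eta : R) : rint h -> 0 < rho -> rho <= t ->
  t <= pi *+ 2 - rho -> circ t -> 0 <= eta ->
  (davg (h \_ circ) t rho <= eta%:E)%E ->
  rmean (fun s => \1_(ball t rho) s * `|h s - h t|) <= rho * eta.
Proof.
move=> hi r0 rt tr ct eta0 D.
have bc : ball t rho `<=` circ.
  move=> s; rewrite /ball/= /Defs.circ/= in_itv/= ltr_norml => /andP[h1 h2].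
  by apply/andP; split; lra.
have gi : rint (fun s => `|h s - h t|) by apply/rint_abs/rintB => //; exact: rint_cst.
have mb : measurable (ball t rho : set (measurableTypeR R)) by exact: measurable_ball.
have I1 : (\int[mu]_(s in circ) (\1_(ball t rho) s * `|h s - h t|)%:E =
          \int[mu]_(s in ball t rho) `|((h \_ circ) s - (h \_ circ) t)%:E|)%E.
  rewrite -[in RHS](setIidr bc) integral_mkcondr; apply: eq_integral => s.
  rewrite inE => cs; rewrite epatch_indic/=.
  have -> : (h \_ circ) s = h s by rewrite patchE mem_set.
  have -> : (h \_ circ) t = h t by rewrite patchE mem_set.
  by rewrite -EFinM mulrC.
have I2 := rmeanE (rint_indicM (measurable_ball t rho) gi).
rewrite I2 in I1.
have {}D : ((mu (ball t rho))^-1 *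
    (pi *+ 2 * rmean (fun s => \1_(ball t rho) s * `|h s - h t|))%:E <= eta%:E)%E.
  by rewrite I1; exact: D.
move: D; rewrite lebesgue_measure_ball ?(ltW r0)//.
have r2 : rho *+ 2 != 0 by rewrite mulrn_eq0/= gt_eqF.
rewrite inver (negbTE r2) -EFinM lee_fin => D.
have D2 : pi *+ 2 * rmean (fun s => \1_(ball t rho) s * `|h s - h t|) <= rho *+ 2 * eta.
  by rewrite -ler_pdivrMl// pmulrn_rgt0.
have m0 : 0 <= rmean (fun s => \1_(ball t rho) s * `|h s - h t|).
  by apply: rmean_ge0 => s _; rewrite mulr_ge0// indic_ball ler0n.
move: (rmean _) m0 D2 => m m0; rewrite -mulr_natr -(mulr_natr rho) => D2.
have pim : 1 * m <= pi * m by rewrite ler_wpM2r//; have := @pi_ge2 R; lra.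
by clear -D2 pim; lra.
Qed.

(** Fatou's theorem. At a Lebesgue point t of h the averages of |h s - h t| on
    small balls are small, so the Poisson integral of |h s - h t| tends to 0.
    *)
Lemma poisson_radial_limit h : rint h ->
  aec (fun t => rmean (fun s => poisson (r%:C * expi t) s * h s) @[r --> 1^'-] --> h t).
Proof.
move=> hi.
have loc : locally_integrable setT (h \_ circ).
  by apply: integrable_locally_restrict => //; exact: measurable_circ.
have leb : aec (fun t => lebesgue_pt (h \_ circ) t).
  have := lebesgue_differentiation loc.
  apply: (@filterS _ (almost_everywhere mu) (ae_filter_ringOfSetsType mu)).
  by move=> t + _.
have t0 : aec (fun t => t != 0).
  exists [set 0]; split => //; first exact: lebesgue_measure_set1.
  by move=> t /= /not_implyP[_ /negP]; rewrite negbK => /eqP.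
have [d d0 hd] := cos_quadratic R.
apply: aecS2 leb t0 => t ct lt tn0.
have /andP[tge tlt] : 0 <= t < pi *+ 2 by move: ct; rewrite /Defs.circ/= in_itv.
have tp : 0 < t by rewrite lt_def tn0.
apply/cvgrPdist_le => e e0.
pose eta := e / 2 / 128.
have eta0 : 0 < eta by rewrite !divr_gt0 ?ltr0n.
have eta128 : 128 * eta = e / 2 by rewrite mulrC divfK// pnatr_eq0.
have [d1 d10 hd1] : exists2 d1 : R, 0 < d1 & forall r, 0 < r < d1 ->
    (davg (h \_ circ) t r <= eta%:E)%E.
  have := lt; rewrite /lebesgue_pt => /fine_cvgP[fin /cvgrPdist_lt/(_ _ eta0) cv].
  have [d1 /= d10 hd1] : \forall r \near (0 : R)^'+, (davg (h \_ circ) t r <= eta%:E)%E.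
    near=> r.
    have fr : davg (h \_ circ) t r \is a fin_num by near: r.
    rewrite -(fineK fr) lee_fin.
    have : `|0 - fine (davg (h \_ circ) t r)| < eta by near: r.
    by rewrite sub0r normrN ltr_norml => /andP[_ /ltW].
  exists d1 => // r /andP[r0 rd]; apply: hd1 => //.
  by rewrite /= sub0r normrN gtr0_norm.
pose rho := Num.min (Num.min d (d1 / 2)) (Num.min 1 (Num.min t (pi *+ 2 - t))).
have rho0 : 0 < rho.
  by rewrite !lt_min d0 divr_gt0//= ltr01 tp subr_gt0.
have rhod : rho <= d by rewrite !ge_min lexx.
have rhod1 : rho < d1.
  by apply: (@le_lt_trans _ _ (d1 / 2)); [rewrite !ge_min lexx orbT|lra].
have rho1 : rho <= 1 by rewrite !ge_min lexx !orbT.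
have rhot : rho <= t by rewrite !ge_min lexx !orbT.
have rhot2 : t <= pi *+ 2 - rho.
  suff : rho <= pi *+ 2 - t by lra.
  by rewrite !ge_min lexx !orbT.
have rhopi : rho < pi by have := @pi_ge2 R; lra.
pose g s : R := `|h s - h t|.
have gi : rint g by apply/rint_abs/rintB => //; exact: rint_cst.
have hA r' : 0 < r' <= rho -> rmean (fun s => \1_(ball t r') s * g s) <= r' * eta.
  move=> /andP[r0 rr]; apply: rmean_ball_davg => //; [lra|lra|exact: ltW|].
  by apply: hd1; rewrite r0/=; lra.
pose K := 2 / sin rho ^+ 2 * rmean g.
have K0 : 0 <= K.
  by rewrite mulr_ge0 ?divr_ge0 ?sqr_ge0// rmean_ge0// => s _; exact: normr_ge0.
near=> r.
have r2 : 2^-1 <= r < 1.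
  apply/andP; split; last by near: r; exact: nbhs_left_lt.
  near: r; apply: nbhs_left_ge; lra.
have rK : 1 - r <= (e / 2) / (K + 1).
  rewrite lerBlDr -lerBlDl; near: r; apply: nbhs_left_ge.
  by rewrite gtrBl divr_gt0// ?divr_gt0//; lra.
have /andP[r2l r1] := r2.
have r01 : 0 <= r by apply: le_trans r2l; rewrite invr_ge0.
have z1 : modulus (r%:C * expi t) < 1 by rewrite modulus_radial.
have key := rmean_poisson_le gi (fun s => normr_ge0 _) r2 (introT andP (conj rho0 rhod))
  hd rhot rhot2 rhopi (ltW eta0) hA.
have pint := rint_poisson hi z1.
have cint0 : rint (fun s => poisson (r%:C * expi t) s * h t).
  exact: rint_poisson (rint_cst _) z1.
have -> : h t = rmean (fun s => poisson (r%:C * expi t) s * h t).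
  transitivity (rmean (fun s => h t * poisson (r%:C * expi t) s)).
    rewrite rmeanZ ?rmean_poisson ?mulr1//.
    by have := rint_poisson (rint_cst (1 : R)) z1; under eq_fun do rewrite mulr1.
  by congr rmean; apply/funext => s; rewrite mulrC.
rewrite distrC -rmeanB//; apply: (le_trans (rmean_abs _)); first exact: rintB.
have -> : (fun s => `|poisson (r%:C * expi t) s * h s - poisson (r%:C * expi t) s * h t|) =
   (fun s => poisson (r%:C * expi t) s * g s).
  by apply/funext => s; rewrite -mulrBr normrM ger0_norm// poisson_ge0.
apply: (le_trans key).
have -> : 2 / sin rho ^+ 2 * (1 - r) * rmean g = K * (1 - r) by rewrite /K; ring.
rewrite [leRHS]splitr eta128 lerD2l.
have K1 : 0 < K + 1 by rewrite ltr_wpDl.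
apply: (@le_trans _ _ ((K + 1) * (1 - r))).
  by rewrite ler_wpM2r ?lerDl// subr_ge0 ltW.
by rewrite mulrC -ler_pdivlMr.
Unshelve. all: by end_near. Qed.

End fatou_theorem.

(** * Hardy spaces in terms of Fourier coefficients *)

Section hardy_spaces.
Variable R : realType.
Local Notation C := R[i].
Local Notation modulus := (@ComplexField.Normc.normc R).
Implicit Types (f g h : R -> C) (s t r x e : R) (z : C).

Lemma poisson_boundary f : cint f ->
  aec (fun t => ccvg 1^'- (fun r : R =>
    cintegral (fun s => f s * (poisson (r%:C * expi t) s)%:C)) (f t)).
Proof.
move=> [fr fi].
apply: aecS2 (poisson_radial_limit fr) (poisson_radial_limit fi) => t _ cr ci.
apply/ccvgP; split.
- have -> : (fun r : R => complex.Re (cintegral (fun s => f s * (poisson (r%:C * expi t) s)%:C))) =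
    (fun r => rmean (fun s => poisson (r%:C * expi t) s * complex.Re (f s))).
    apply/funext => r; rewrite Re_cintegral; congr rmean; apply/funext => s.
    by rewrite ReM /= mulr0 subr0 mulrC.
  exact: cr.
- have -> : (fun r : R => complex.Im (cintegral (fun s => f s * (poisson (r%:C * expi t) s)%:C))) =
    (fun r => rmean (fun s => poisson (r%:C * expi t) s * complex.Im (f s))).
    apply/funext => r; rewrite Im_cintegral; congr rmean; apply/funext => s.
    by rewrite ImM /= mulr0 add0r mulrC.
  exact: ci.
Qed.

Lemma near_radius : \forall r \near (1 : R)^'-, 0 <= r < 1.
Proof.
near=> r; apply/andP; split.
- by near: r; apply: nbhs_left_ge; exact: ltr01.
- by near: r; exact: nbhs_left_lt.
Unshelve. all: by end_near. Qed.

Lemma near_eq_ccvg (T : Type) (F : set_system T) {FF : Filter F} (u v : T -> C) (a : C) :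
  (\forall x \near F, u x = v x) -> ccvg F v a -> ccvg F u a.
Proof.
move=> uv va; apply: near_ccvg => e e0.
by apply: filterS2 uv (ccvg_near e0 va) => x ->.
Qed.

Lemma boundary_cauchy f : hardy f -> boundary (cauchy f) f.
Proof.
move=> fh; have fi := L2_cint fh.1.
apply: aecS (poisson_boundary fi) => t _; apply: near_eq_ccvg.
apply: filterS near_radius => r /andP[r0 r1].
by rewrite cauchy_poisson// modulus_radial.
Qed.

Lemma cauchy_nsq_le f r : L2 f -> 0 <= r < 1 ->
  L2 (fun t => cauchy f (r%:C * expi t)) /\
  nsq (fun t => cauchy f (r%:C * expi t)) <= nsq f.
Proof.
move=> f2 r01; have ps := cauchy_series (L2_cint f2); have /andP[r0 r1] := r01.
apply: (nsq_le_fatou (u := block (dilate (fcoef f) r) 0) (nsq_ge0 f)).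
- by move=> n; exact: L2_block.
- exact: dilate_cmeas ps r01.
- move=> n; rewrite nsq_block; apply: le_trans (bessel n f2).
  apply: ler_sum => k _; rewrite modulusM exprMn ler_piMr ?sqr_ge0//.
  by rewrite modulus_real ger0_norm ?exprn_ge0// -exprM exprn_ile1// ltW.
- by apply: aecW => t _; exact: dilate_cvg.
Qed.

(** The disc function is the Cauchy integral: here it coincides with the
    Poisson integral, which has radial limits almost everywhere. *)
Lemma hardy_H2 f : hardy f -> H2 f.
Proof.
move=> fh; have f2 := fh.1; split=> //; exists (cauchy f); last exact: boundary_cauchy.
split; first by exists (fcoef f); exact: cauchy_series (L2_cint f2).
exists (pi *+ 2 * nsq f) => r r01; have [L le] := cauchy_nsq_le f2 r01.
have := rmeanE (L2_sqr L); rewrite /= => ->.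
by rewrite lee_fin ler_pM2l ?twopi_gt0.
Qed.

Lemma H2P f : H2 f <-> hardy f.
Proof. by split; [exact: H2_hardy|exact: hardy_H2]. Qed.

(** The Poisson kernel is a probability density. *)
Lemma cauchy_bounded f (M : R) z : hardy f -> aec (fun t => modulus (f t) <= M) ->
  modulus z < 1 -> modulus (cauchy f z) <= M.
Proof.
move=> fh fM z1; rewrite cauchy_poisson//.
have fi := L2_cint fh.1.
have pi1 : rint (poisson z).
  by have := rint_poisson (rint_cst (1 : R)) z1; under eq_fun do rewrite mulr1.
have Mi := rintZ M pi1.
have mp : cmeasurable (fun s => (poisson z s)%:C).
  by apply: cmeas_real; exact: cmeas_poisson.
have bd : aec (fun s => modulus (f s * (poisson z s)%:C) <= M * poisson z s).
  apply: aecS fM => s _ h; rewrite modulusM modulus_real ger0_norm ?poisson_ge0//.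
  by rewrite ler_wpM2r// poisson_ge0.
have fpi := cint_dom (cmeasM (cint_measurable fi) mp) Mi bd.
apply: (le_trans (modulus_cintegral fpi)).
apply: le_trans (rmean_le (cint_modulus fpi) Mi bd) _.
by rewrite rmeanZ// rmean_poisson// mulr1.
Qed.

Lemma hardy_Hinf f : hardy f -> Linfty f -> Hinf f.
Proof.
move=> fh fb; split=> //; exists (cauchy f); last exact: boundary_cauchy.
split; first by exists (fcoef f); exact: cauchy_series (L2_cint fh.1).
have [_ [M fM]] := fb; exists M => z z1; exact: cauchy_bounded.
Qed.

Lemma Hinf_hardy f : Hinf f -> hardy f.
Proof.
move=> [fb [F [[a aF] [M FM]] bF]]; apply/H2P; split; first exact: Linf_L2.
exists F => //; split; first by exists a.
exists (pi *+ 2 * M ^+ 2) => r r01; have /andP[r0 r1] := r01.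
have ps : power_series a F by exact: aF.
have := rmeanE (L2_sqr (dilate_L2 ps r01)); rewrite /= => ->.
rewrite lee_fin ler_pM2l ?twopi_gt0//.
rewrite -[leRHS](rmean_cst (M ^+ 2)); apply: rmean_le_all.
- exact: L2_sqr (dilate_L2 ps r01).
- exact: rint_cst.
- move=> t _; have := FM (r%:C * expi t); rewrite modulus_radial// => /(_ r1) h.
  by rewrite lerXn2r// nnegrE ?(le_trans _ h) ?modulus_ge0.
Qed.

Lemma hardy_ae_eq f g : hardy f -> cmeasurable g -> aec (fun t => f t = g t) -> hardy g.
Proof.
move=> [f2 fh] mg fg; have g2 := L2_ae_eq mg fg f2; split=> // n.
rewrite -[RHS](fh n); apply: cintegral_ae_eq.
- by apply: cmeasM => //; exact: cmeas_expiX.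
- apply: cmeasM; [exact: L2_measurable|exact: cmeas_expiX].
- by apply: aecS fg => t _ ->.
Qed.

(** Analytic polynomials are dense in H2. *)
Lemma pairing_hardy f g : L2 f -> (forall n, cintegral (fun t => f t * expi t ^+ n) = 0) ->
  hardy g -> cintegral (fun t => f t * g t) = 0.
Proof.
move=> f2 fn gh; apply: pairing_closed (gh.1) _ => // e e0.
have [p hp] := H2_poly_dense (hardy_H2 gh) e0.
exists (fun t => p.[expi t]); split=> //; first exact: L2_poly.
rewrite cintegralM_poly; last exact: L2_cint.
by rewrite big1// => i _; rewrite fn mulr0.
Qed.

Lemma hardy_expiX n : hardy (fun t => expi t ^+ n).
Proof.
have := hardy_poly ('X^n : {poly C}).
by under eq_fun do rewrite hornerXn.
Qed.

Lemma hardy1 : hardy (fun=> 1 : C).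
Proof. by have := hardy_expiX 0; under eq_fun do rewrite expr0. Qed.

Lemma hardyM f g : Linfty f -> hardy f -> hardy g -> hardy (fun t => f t * g t).
Proof.
move=> fb fh gh; split=> [|n]; first exact: L2M_bounded gh.1.
transitivity (cintegral (fun t => (expi t ^+ n.+1 * f t) * g t)).
  by apply: cintegral_eq => t _; ring.
apply: pairing_hardy => //.
  by apply: L2M_bounded; [exact: Linf_expiX|exact: fh.1].
move=> m; rewrite -[RHS](fh.2 (n + m)%N); apply: cintegral_eq => t _.
by rewrite -addSn exprD; ring.
Qed.

Lemma hardyB f g : hardy f -> hardy g -> hardy (fun t => f t - g t).
Proof.
move=> [f2 fh] [g2 gh]; split=> [|n]; first exact: L2B.
have fe : cint (fun t => f t * expi t ^+ n.+1) by exact/cint_expiX/L2_cint.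
have ge : cint (fun t => g t * expi t ^+ n.+1) by exact/cint_expiX/L2_cint.
transitivity (cintegral (fun t => f t * expi t ^+ n.+1 - g t * expi t ^+ n.+1)).
  by apply: cintegral_eq => t _; rewrite mulrBl.
by rewrite cintegralB// fh gh subrr.
Qed.

End hardy_spaces.

(** * The projection onto the Hardy space *)

Section riesz_fischer.
Variable R : realType.
Local Notation C := R[i].
Local Notation modulus := (@ComplexField.Normc.normc R).
Local Notation circ := (@circ R).
Local Notation mu := (@lebesgue_measure R).
Implicit Types (f g h : R -> C) (s t r x e : R) (z : C).

(** The integral of the sum of the series is finite, hence so is the sum
    almost everywhere. *)
Lemma ae_bounded_sums (d : nat -> R -> R) : (forall k, rint (d k)) ->
  (forall k t, circ t -> 0 <= d k t) -> (forall k, rmean (d k) <= 2^-1 ^+ k) ->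
  aec (fun t => exists B : R, forall n, \sum_(0 <= k < n) d k t <= B).
Proof.
move=> di d0 dm.
pose F t := (\sum_(0 <= k <oo) (d k t)%:E)%E.
have md k : measurable_fun circ (EFin \o d k).
  by apply/measurable_EFinP; exact: rint_measurable.
have F0 t : circ t -> (0 <= F t)%E.
  by move=> ct; apply: nneseries_ge0 => k _ _; rewrite lee_fin d0.
have mF : measurable_fun circ F.
  apply: (@ge0_emeasurable_sum _ _ _ _ (fun k t => (d k t)%:E) xpredT).
    by move=> k t ct _; rewrite lee_fin d0.
  by move=> k _; exact: md.
have Fi : mu.-integrable circ F.
  apply/integrableP; split => //.
  have -> : (\int[mu]_(t in circ) `|F t| = \int[mu]_(t in circ) F t)%E.
    by apply: eq_integral => t; rewrite inE => ct; rewrite gee0_abs// F0.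
  rewrite (integral_nneseries _ (@measurable_circ R) md); last first.
    by move=> k t ct; rewrite lee_fin d0.
  apply: le_lt_trans (ltry (pi *+ 2 * 2)).
  apply: lime_le.
    apply: is_cvg_nneseries => k _ _; apply: integral_ge0 => t ct.
    by rewrite lee_fin d0.
  apply: nearW => n.
  under eq_bigr do rewrite rmeanE//.
  rewrite sumEFin lee_fin -mulr_sumr ler_pM2l ?twopi_gt0//.
  apply: (@le_trans _ _ (\sum_(0 <= k < n) 2^-1 ^+ k)); first by apply: ler_sum.
  have := @sum_geometric_le R 2^-1 n ltac:(lra).
  by rewrite (_ : (1 - 2^-1)^-1 = 2 :> R)//; field.
have fin : aec (fun t => F t \is a fin_num) := integrable_ae (@measurable_circ R) Fi.
apply: aecS fin => t ct Ft; exists (fine (F t)) => n.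
rewrite -lee_fin fineK// -sumEFin; apply: nneseries_lim_ge => k _ _.
by rewrite lee_fin d0.
Qed.

Lemma bounded_series_cvg (u : nat -> R) (B : R) :
  (forall n, \sum_(0 <= k < n) `|u k| <= B) ->
  exists l : R, \sum_(0 <= k < n) u k @[n --> \oo] --> l.
Proof.
move=> uB; suff : cvgn (series u) by move=> h; exists (limn (series u)).
apply: normed_cvg; apply: nondecreasing_is_cvgn.
  by apply/nondecreasing_seqP => n; rewrite /= /series/= big_nat_recr//= lerDl.
by exists B => _ [n _ <-]; exact: uB.
Qed.

Lemma bounded_cseries_cvg (u : nat -> C) (B : R) :
  (forall n, \sum_(0 <= k < n) modulus (u k) <= B) ->
  exists l, ccvg \oo (fun n => \sum_(0 <= k < n) u k) l.
Proof.
move=> uB.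
have [|a ha] := @bounded_series_cvg (fun k => complex.Re (u k)) B.
  move=> n; apply: le_trans (uB n); apply: ler_sum => k _; exact: Re_le_modulus.
have [|b hb] := @bounded_series_cvg (fun k => complex.Im (u k)) B.
  move=> n; apply: le_trans (uB n); apply: ler_sum => k _; exact: Im_le_modulus.
exists (a +i* b); apply/ccvgP; split => /=.
- have -> : (fun n => complex.Re (\sum_(0 <= k < n) u k)) =
    (fun n => \sum_(0 <= k < n) complex.Re (u k)) => //.
  by apply/funext => n; elim/big_ind2 : _ => // x y z w <- <-; rewrite ReD.
- have -> : (fun n => complex.Im (\sum_(0 <= k < n) u k)) =
    (fun n => \sum_(0 <= k < n) complex.Im (u k)) => //.
  by apply/funext => n; elim/big_ind2 : _ => // x y z w <- <-; rewrite ImD.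
Qed.

(** The upper limit is measurable, and equals the limit wherever there is one. *)
Lemma measurable_limit (u : nat -> R -> R) : (forall n, measurable_fun circ (u n)) ->
  exists2 v, measurable_fun circ v &
    forall t (l : R), u n t @[n --> \oo] --> l -> v t = l.
Proof.
move=> mu'; exists (fun t => fine (limn_esup (fun n => (u n t)%:E))).
  apply: (measurableT_comp (fine_measurable measurableT)).
  by apply: measurable_fun_limn_esup => n; apply/measurable_EFinP.
move=> t l ul; rewrite (cvg_limn_einf_sup (l := l%:E) _).2//.
by apply: cvg_EFin; [exact: nearW|exact: ul].
Qed.

Lemma cmeasurable_limit (u : nat -> R -> C) : (forall n, cmeasurable (u n)) ->
  aec (fun t => exists l, ccvg \oo (u ^~ t) l) ->
  exists2 g, cmeasurable g & aec (fun t => ccvg \oo (u ^~ t) (g t)).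
Proof.
move=> mu' cu.
have [v mv hv] := measurable_limit (fun n => (mu' n).1).
have [w mw hw] := measurable_limit (fun n => (mu' n).2).
exists (fun t => v t +i* w t); first by split.
apply: aecS cu => t _ [l /ccvgP[rl il]]; apply/ccvgP => /=.
by rewrite (hv _ _ rl) (hw _ _ il).
Qed.

(** Integrate |f| <= (2^k |f|^2 + 2^-k) / 2. *)
Lemma rmean_modulus_le f (k : nat) : L2 f -> nsq f <= 4^-1 ^+ k ->
  rmean (fun t => modulus (f t)) <= 2^-1 ^+ k.
Proof.
move=> f2 fk; have fi := L2_cint f2; have si := L2_sqr f2.
have p0 : 0 < (2 : R) ^+ k by rewrite exprn_gt0.
apply: (@le_trans _ _ (rmean (fun t => (2 ^+ k / 2) * modulus (f t) ^+ 2 + 2^-1 ^+ k / 2))).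
  apply: rmean_le_all; first exact: cint_modulus.
    by apply: rintD; [exact: rintZ|exact: rint_cst].
  move=> t _; have h := sqr_ge0 (2 ^+ k * modulus (f t) - 1).
  have q0 : 0 < (2 : R)^-1 ^+ k by rewrite exprn_gt0// invr_gt0.
  have pq : (2 : R) ^+ k * 2^-1 ^+ k = 1 by rewrite -exprMn divff// expr1n.
  have := mulr_ge0 (ltW q0) h; move: pq; rewrite sqrrB expr1n mulr1.
  set p := 2 ^+ k; set q := _^-1 ^+ k; set m := modulus _ => pq.
  have -> : q * ((p * m) ^+ 2 - p * m *+ 2 + 1) = (p * q) * (p * m ^+ 2) - (p * q) * m *+ 2 + q.
    by ring.
  by rewrite pq !mul1r -mulr_natr; lra.
rewrite rmeanD; [|exact: rintZ|exact: rint_cst].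
rewrite rmeanZ// rmean_cst.
have : 2 ^+ k / 2 * nsq f <= 2 ^+ k / 2 * 4^-1 ^+ k.
  by rewrite ler_pM2l// divr_gt0.
have -> : 2 ^+ k / 2 * 4^-1 ^+ k = 2^-1 ^+ k / 2 :> R.
  rewrite mulrAC -exprMn; congr (_ ^+ _ / _); lra.
by rewrite /nsq; lra.
Qed.

(** The partial sums of the Fourier series over nonnegative frequencies
    converge in L2, by Bessel's inequality; consecutive terms of a sparse
    subsequence are at distance at most 2^-k, so that it converges almost
    everywhere, and Fatou's lemma identifies its pointwise limit with the
    limit in L2. *)
Lemma riesz_projection f : L2 f -> exists2 g, hardy g & forall n, fcoef g n = fcoef f n.
Proof.
move=> f2; pose a := fcoef f.
pose S n := \sum_(0 <= k < n) modulus (a k) ^+ 2.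
have ndS : nondecreasing_seq S.
  by apply/nondecreasing_seqP => n; rewrite /S big_nat_recr//= lerDl sqr_ge0.
have cS : cvgn S.
  by apply: nondecreasing_is_cvgn => //; exists (nsq f) => _ [n _ <-]; exact: bessel.
have Sle n : S n <= limn S by exact: nondecreasing_cvgn_le.
have tail m n : (m <= n)%N -> nsq (block a m n) <= limn S - S m.
  move=> mn; rewrite nsq_block; apply: (@le_trans _ _ (S n - S m)).
    by rewrite /S (@big_cat_nat _ _ _ m 0 n)//= addrAC subrr add0r.
  by rewrite lerD2r; exact: Sle.
have [N hN] : exists N : nat -> nat, forall k n, (N k <= n)%N -> limn S - S n <= 4^-1 ^+ k.
  suff : forall k, exists N, forall n, (N <= n)%N -> limn S - S n <= 4^-1 ^+ k.
    by move=> /choice[N hN]; exists N.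
  move=> k; have e0 : 0 < (4 : R)^-1 ^+ k by rewrite exprn_gt0// invr_gt0.
  move/cvgrPdist_lt : cS => /(_ _ e0)[N _ hN]; exists N => n Nn.
  by have := hN n Nn; rewrite ltr_norml => /andP[_ /ltW].
pose M k := (\sum_(0 <= j < k) (N j).+1 + N k)%N.
have MN k : (N k <= M k)%N by exact: leq_addl.
have kM k : (k <= M k)%N.
  apply: leq_trans (leq_addr _ _).
  rewrite -[X in (X <= _)%N]muln1 -[X in (X * _)%N]subn0 -sum_nat_const_nat.
  exact: leq_sum.
have MS k : (M k <= M k.+1)%N.
  by rewrite /M big_nat_recr//= -!addnA leq_add2l (leq_trans (leqnSn _)) ?leq_addr.
have Mmon : {homo M : i j / (i <= j)%N}.
  by apply: homo_leq => //; exact: leq_trans.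
pose u k := block a 0 (M k).
have um k t : u k t = block a 0 (M 0%N) t + \sum_(0 <= j < k) block a (M j) (M j.+1) t.
  elim: k => [|k IH]; first by rewrite big_geq// addr0.
  rewrite big_nat_recr//= addrA -IH /u /block -big_cat_nat//=.
have mu' k : cmeasurable (u k) by apply: L2_measurable; exact: L2_block.
have cv : aec (fun t => exists l, ccvg \oo (u ^~ t) l).
  have := @ae_bounded_sums (fun k t => modulus (block a (M k) (M k.+1) t)).
  move=> /(_ (fun k => cint_modulus (L2_cint (L2_block a (M k) (M k.+1))))).
  move=> /(_ (fun k t _ => modulus_ge0 _)).
  have bd k : rmean (fun t => modulus (block a (M k) (M k.+1) t)) <= 2^-1 ^+ k.
    apply: rmean_modulus_le; first exact: L2_block.
    by apply: (le_trans (tail _ _ (MS k))); exact: hN.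
  move=> /(_ bd); apply: aecS => t _ [B hB].
  have [l hl] := bounded_cseries_cvg hB.
  exists (block a 0 (M 0%N) t + l).
  under eq_fun do rewrite um.
  by apply: ccvgD => //; exact: ccvg_cst.
have [g mg ug] := cmeasurable_limit mu' cv.
have gu k : L2 (fun t => g t - u k t) /\ nsq (fun t => g t - u k t) <= 4^-1 ^+ k.
  apply: (nsq_le_fatou (u := fun j => block a (M k) (M (j + k)%N))).
  - by rewrite exprn_ge0// invr_ge0.
  - by move=> n; exact: L2_block.
  - exact: cmeasB.
  - move=> n; apply: (le_trans (tail _ _ _)); last exact: hN.
    by apply: Mmon; exact: leq_addl.
  - apply: aecS ug => t _ ut.
    have ut' : ccvg \oo (fun j => u (j + k)%N t) (g t).
      by move: ut; rewrite /ccvg -(cvg_shiftn k).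
    have ck : ccvg \oo (fun=> u k t) (u k t) by exact: ccvg_cst.
    have h := ccvgB ut' ck; rewrite /ccvg; apply: cvg0_le (h _) => j; rewrite modulus_ge0 andTb.
    have -> : u (j + k)%N t = u k t + block a (M k) (M (j + k)%N) t.
      by rewrite /u /block -big_cat_nat//; apply: Mmon; exact: leq_addl.
    by rewrite le_eqVlt; apply/orP; left; apply/eqP; congr modulus; ring.
have u2 k : L2 (u k) by exact: L2_block.
have g2 : L2 g.
  have := L2D (gu 0%N).1 (u2 0%N).
  by under eq_fun do rewrite subrK.
have small e : 0 < e -> exists k0, forall k, (k0 <= k)%N -> nsq (fun t => g t - u k t) < e.
  move=> e0.
  have h : (4^-1 : R) ^+ k @[k --> \oo] --> (0 : R).
    by apply: cvg_expr; rewrite ger0_norm ?invr_ge0//; lra.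
  move/cvgrPdist_lt : h => /(_ _ e0)[k0 _ hk]; exists k0 => k kk.
  apply: (le_lt_trans (gu k).2); have := hk k kk.
  by rewrite sub0r normrN ger0_norm// exprn_ge0// invr_ge0.
exists g => [|n]; first split => // n.
  under cintegral_eq do rewrite mulrC.
  apply: pairing_closed => //; first exact: L2_expiX.
  move=> e e0; have [k0 hk] := small _ e0; exists (u k0); split => //.
    exact: hk.
  under cintegral_eq do rewrite mulrC.
  have := (hardy_poly (\poly_(k < M k0) a k)).2 n.
  by under cintegral_eq do rewrite -block_poly.
apply/eqP; rewrite -subr_eq0; apply/eqP.
have ex := L2_expiX R n.
have fn k : (n < k)%N -> fcoef (u k) n = fcoef f n.
  by move=> nk; rewrite fcoef_block leq0n (leq_trans nk (kM k)).
apply: modulus_eq0; apply/eqP; rewrite -sqrf_eq0 eq_le sqr_ge0 andbT.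
apply/ler_addgt0Pr => e e0; rewrite add0r.
have [k0 hk] := small _ e0; set k := maxn k0 n.+1.
have := hk k (leq_maxl _ _) => hkk.
rewrite -(fn k) ?leq_maxr// -inner_prodBl//.
apply: (le_trans (cauchy_schwarz_sqr (L2B g2 (u2 k)) ex)).
have -> : nsq (fun t : R => expi t ^+ n) = 1.
  by apply: complexI; rewrite -inner_prod_nsq expi_orthogonal eqxx.
by rewrite mulr1 ltW.
Qed.

(** This g is the orthogonal projection of f onto H2: the coefficients of f -
    g over nonnegative frequencies vanish, and these frequencies span H2. *)
Lemma riesz_orthogonal f : L2 f ->
  exists g, hardy g /\ forall h, hardy h -> inner_prod (fun t => f t - g t) h = 0.
Proof.
move=> f2; have [g gh gf] := riesz_projection f2; exists g; split => // h hh.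
have fg2 := L2B f2 gh.1.
rewrite inner_prodC; last by apply: L2_cintM; [exact: hh.1|exact: L2_conj].
rewrite inner_prodE (_ : cintegral _ = 0) ?conjc0//.
under cintegral_eq do rewrite mulrC.
apply: pairing_hardy => //; first exact: L2_conj.
move=> n; have : inner_prod (fun t => f t - g t) (fun t => expi t ^+ n) = 0.
  have ex := L2_expiX R n; have g2 := gh.1.
  by rewrite inner_prodBl// -/(fcoef f n) -/(fcoef g n) gf subrr.
rewrite inner_prodE => h0.
transitivity ((cintegral (fun t => (f t - g t) * (expi t ^+ n)^*))^*); last first.
  by rewrite h0 conjc0.
rewrite -cintegral_conj; last by apply: L2_cintM => //; apply: L2_conj; exact: L2_expiX.
by apply: cintegral_eq => t _; rewrite conjcM conjcK.
Qed.

End riesz_fischer.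

(** * Model spaces and the kernel of a dual truncated Toeplitz operator *)

Section model_spaces.
Variable R : realType.
Local Notation C := R[i].
Implicit Types (f g h k beta : R -> C) (t : R).

Lemma model_spaceP beta k : Linfty beta -> model_space beta k <->
  hardy k /\ forall h, hardy h -> inner_prod k (fun t => beta t * h t) = 0.
Proof.
move=> bb; split=> [[/H2P kh kb]|[kh kb]]; split=> //.
- move=> h hh; apply: kb; split; first by apply: cmeasM; [exact: bb.1|exact: L2_measurable hh.1].
  by exists h; [apply/H2P|exact: aecW].
- exact/H2P.
- move=> g [mg [h /H2P hh gh]]; rewrite -[RHS](kb h hh).
  have mk := L2_measurable kh.1.
  apply: inner_prod_ae_eq => //; last exact: aecW.
  by apply: cmeasM; [exact: bb.1|exact: L2_measurable hh.1].
Qed.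

Lemma model_space_ae_eq beta f g : Linfty beta -> model_space beta f -> cmeasurable g ->
  aec (fun t => f t = g t) -> model_space beta g.
Proof.
move=> bb /(model_spaceP _ bb)[fh fb] mg fg; apply/model_spaceP => //; split.
  exact: hardy_ae_eq fg.
move=> h hh; rewrite -[RHS](fb h hh).
have mbh : cmeasurable (fun t => beta t * h t).
  by apply: cmeasM; [exact: bb.1|exact: L2_measurable hh.1].
apply: inner_prod_ae_eq => //; [exact: L2_measurable fh.1| |exact: aecW].
by apply: aecS fg => t _ ->.
Qed.

Section inner_theta.
Variable theta : R -> C.
Hypothesis theta_inner : inner_function theta.

Lemma inner_Linf : Linfty theta.
Proof. by case: theta_inner => -[]. Qed.

Lemma inner_hardy : hardy theta.
Proof. by apply: Hinf_hardy; case: theta_inner. Qed.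

Lemma inner_conjK : aec (fun t => (theta t)^* * theta t = 1).
Proof. by case: theta_inner => _; apply: aecS => t _; exact: conj_eq_inv. Qed.

Lemma inner_mul_hardy h : hardy h -> hardy (fun t => theta t * h t).
Proof. exact: hardyM inner_Linf inner_hardy. Qed.

Lemma model_space_orth k h : model_space theta k -> hardy h ->
  inner_prod k (fun t => theta t * h t) = 0.
Proof. by move=> /(model_spaceP _ inner_Linf)[_]; exact. Qed.

Lemma model_space_hardy k : model_space theta k -> hardy k.
Proof. by move=> /(model_spaceP _ inner_Linf)[]. Qed.

Lemma model_perp_inner h : hardy h -> model_perp theta (fun t => theta t * h t).
Proof.
move=> hh; have th2 := (inner_mul_hardy hh).1; split=> // k kK.
have k2 := (model_space_hardy kK).1.
rewrite inner_prodC; last by apply: L2_cintM => //; exact: L2_conj.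
by rewrite model_space_orth// conjc0.
Qed.

Lemma model_perp_antianalytic g : L2 g -> (forall h, hardy h -> inner_prod g h = 0) ->
  model_perp theta g.
Proof. by move=> g2 gh; split => // k kK; apply: gh; exact: model_space_hardy. Qed.

(** The negative powers of z and theta H2 lie in the complement of the model
    space; being orthogonal to them already forces membership in the model
    space. *)
Lemma model_space_double_perp g : L2 g ->
  (forall f, model_perp theta f -> inner_prod g f = 0) -> model_space theta g.
Proof.
move=> g2 gM; apply/model_spaceP; first exact: inner_Linf.
split; last by move=> h hh; apply: gM; exact: model_perp_inner.
split=> // n.
have := gM (fun t => (expi t ^+ n.+1)^*).
rewrite inner_prodE; under cintegral_eq do rewrite conjcK.
apply; apply: model_perp_antianalytic; first by apply: L2_conj; exact: L2_expiX.
move=> h hh; rewrite inner_prodE.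
transitivity ((cintegral (fun t => h t * expi t ^+ n.+1))^*).
  rewrite -cintegral_conj; last exact/cint_expiX/L2_cint/hh.1.
  by apply: cintegral_eq => t _; rewrite conjcM mulrC.
by rewrite hh.2 conjc0.
Qed.

(** For the orthogonal projection P+ onto H2, the projection onto theta H2 is
    theta P+ conj(theta). *)
Lemma hardy_decomposition p : hardy p -> exists q, hardy q /\
  model_space theta (fun t => p t - theta t * q t).
Proof.
move=> ph.
have tp2 : L2 (fun t => (theta t)^* * p t).
  by apply: L2M_bounded; [exact: Linf_conj inner_Linf|exact: ph.1].
have [q [qh pq]] := riesz_orthogonal tp2.
have tq := inner_mul_hardy qh.
exists q; split=> //; apply/model_spaceP; first exact: inner_Linf.
split; first exact: hardyB.
move=> h hh; rewrite -[RHS](pq h hh) !inner_prodE; apply: cintegral_ae_eq.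
- apply: cmeasM; first exact: L2_measurable (hardyB ph tq).1.
  by apply: cmeas_conj; exact: L2_measurable (inner_mul_hardy hh).1.
- apply: cmeasM; first exact: L2_measurable (L2B tp2 qh.1).
  by apply: cmeas_conj; exact: L2_measurable hh.1.
- apply: aecS inner_conjK => t _ tt; rewrite conjcM.
  have -> : (p t - theta t * q t) * ((theta t)^* * (h t)^*) =
    ((theta t)^* * p t - ((theta t)^* * theta t) * q t) * (h t)^* by ring.
  by rewrite tt mul1r.
Qed.

(** The projection onto the model space is P+ followed by the projection along
    theta H2. *)
Lemma model_decomposition f : L2 f -> exists k, model_space theta k /\
  model_perp theta (fun t => f t - k t).
Proof.
move=> f2; have [p [ph fp]] := riesz_orthogonal f2.
have [q [qh kK]] := hardy_decomposition ph; have tq := inner_mul_hardy qh.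
exists (fun t => p t - theta t * q t).
split=> //; split=> [|k' kK']; first exact: L2B (hardyB ph tq).1.
have k2' := (model_space_hardy kK').1.
transitivity (inner_prod (fun t => (f t - p t) + theta t * q t) k').
  by apply: cintegral_eq => t _; congr (_ * _); ring.
rewrite inner_prodDl//; [|exact: L2B f2 ph.1|exact: tq.1].
rewrite fp ?add0r; last exact: model_space_hardy.
by have [_] := model_perp_inner qh; exact.
Qed.

Lemma model_perp_orth k f : model_space theta k -> model_perp theta f -> inner_prod k f = 0.
Proof.
move=> kK [f2 fK]; rewrite inner_prodC ?fK ?conjc0//.
by apply: L2_cintM => //; apply: L2_conj; exact: (model_space_hardy kK).1.
Qed.

Lemma model_perp_ae_eq f g : model_perp theta f -> cmeasurable g ->
  aec (fun t => f t = g t) -> model_perp theta g.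
Proof.
move=> [f2 fK] mg fg; split; first exact: L2_ae_eq fg f2.
move=> k kK; rewrite -[RHS](fK k kK).
have mk := L2_measurable (model_space_hardy kK).1.
apply: inner_prod_ae_eq => //; [exact: L2_measurable f2| |exact: aecW].
by apply: aecS fg => t _ ->.
Qed.

(** The component of p in the model space vanishes, since it is orthogonal to
    itself. *)
Lemma hardy_model_perp p : hardy p -> model_perp theta p ->
  exists2 q, hardy q & aec (fun t => p t = theta t * q t).
Proof.
move=> ph pM; have [q [qh kK]] := hardy_decomposition ph; exists q => //.
have tqM := model_perp_inner qh; have tq2 := tqM.1.
have k2 := (model_space_hardy kK).1.
have : nsq (fun t => p t - theta t * q t) <= 0.
  have := model_perp_orth kK pM; have := model_perp_orth kK tqM => h1 h2.
  have := inner_prodBl ph.1 tq2 k2.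
  rewrite inner_prod_nsq (inner_prodC (L2_cintM k2 (L2_conj ph.1))).
  rewrite (inner_prodC (L2_cintM k2 (L2_conj tq2))) h1 h2 conjc0 subrr.
  by move=> /complexI ->.
move=> /(nsq_eq0 k2); apply: aecS => t _ /eqP.
by rewrite subr_eq0 => /eqP.
Qed.

Lemma orth_projP f : L2 f -> is_orth_proj (model_perp theta) f (orth_proj (model_perp theta) f).
Proof.
move=> f2; have [k [kK fk]] := model_decomposition f2.
suff : is_orth_proj (model_perp theta) f (fun t => f t - k t).
  by move=> h; apply: (@xgetPex _ (fun=> 0) [set g | is_orth_proj _ f g]); eexists; exact: h.
split=> // h hM; rewrite -[RHS](model_perp_orth kK hM); apply: cintegral_eq => t _.
by congr (_ * _); rewrite /= opprB addrC subrK.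
Qed.

(** The projection of G f onto the complement of the model space K vanishes
    exactly when G f is orthogonal to that complement, that is, when it lies
    in K. *)
Lemma ker_dual_toeplitzP G f : Linfty G -> ker_dual_toeplitz theta G f <->
  model_perp theta f /\ model_space theta (fun t => G t * f t).
Proof.
move=> Gb.
have key : model_perp theta f -> (ceq (dual_toeplitz theta G f) (fun=> 0) <->
    model_space theta (fun t => G t * f t)).
  move=> [f2 _]; have Gf2 := L2M_bounded Gb f2.
  have := orth_projP Gf2; rewrite /dual_toeplitz; set g := orth_proj _ _ => -[gM gP].
  have g2 := gM.1; have mg := L2_measurable g2; have mGf := L2_measurable Gf2.
  split=> [g0|GfK].
  - apply: model_space_double_perp => // h hM; rewrite -[RHS](gP h hM).
    have mh := L2_measurable hM.1.
    apply: inner_prod_ae_eq => //; [exact: cmeasB| |exact: aecW].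
    by apply: aecS g0 => t _ /= ->; rewrite subr0.
  - apply: nsq_eq0 => //; have := gP g gM.
    rewrite -[inner_prod _ _]/(inner_prod (fun t => G t * f t - g t) g).
    rewrite inner_prodBl// (model_perp_orth GfK gM) sub0r inner_prod_nsq.
    by move/eqP; rewrite oppr_eq0 => /eqP /complexI ->.
by split=> -[fM ?]; split=> //; apply/key.
Qed.

Lemma theta_model_perp : model_perp theta theta.
Proof.
have := model_perp_inner (hardy1 R).
by under eq_fun do rewrite mulr1.
Qed.

Lemma ker_dual_toeplitz_theta G : Linfty G ->
  ker_dual_toeplitz theta G theta <-> mulset (conjf theta) (model_space theta) G.
Proof.
move=> Gb; split=> [/(ker_dual_toeplitzP _ Gb)[_ GtK]|[mG [k kK Gk]]].
  split; first exact: Gb.1.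
  exists (fun t => G t * theta t) => //.
  by apply: aecS inner_conjK => t _ tt; rewrite /= /conjf mulrCA tt mulr1.
apply/ker_dual_toeplitzP => //; split; first exact: theta_model_perp.
have mk := L2_measurable (model_space_hardy kK).1.
apply: model_space_ae_eq kK _ _; first exact: inner_Linf.
  by apply: cmeasM => //; exact: inner_Linf.1.
by apply: aecS2 Gk inner_conjK => t _ -> /= tt; rewrite /conjf mulrAC tt mul1r.
Qed.

(** The negative coefficients of conj(z G) are conjugates of the pairings of
    theta G, an element of the model space, with the functions theta z^n. *)
Lemma conj_symbol_Hinf G : mulset (conjf theta) (model_space theta) G -> Linfty G ->
  Hinf (fun t => (expi t * G t)^*).
Proof.
move=> [mG [k kK Gk]] Gb.
have eb : Linfty (@expi R) by have := Linf_expiX R 1; under eq_fun do rewrite expr1.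
have hb : Linfty (fun t => (expi t * G t)^*) by apply: Linf_conj; exact: LinfM.
have kh := model_space_hardy kK.
apply: hardy_Hinf => //; split=> [|n]; first exact: Linf_L2.
have ten := inner_mul_hardy (hardy_expiX R n).
rewrite -[RHS](conjc0 R) -(model_space_orth kK (hardy_expiX R n)) inner_prodE.
rewrite -cintegral_conj; last first.
  by apply: L2_cintM; [exact: kh.1|apply: L2_conj; exact: ten.1].
apply: cintegral_ae_eq.
- by apply: cmeasM; [exact: hb.1|exact: cmeas_expiX].
- apply: cmeas_conj; apply: cmeasM; first exact: L2_measurable kh.1.
  by apply: cmeas_conj; exact: L2_measurable ten.1.
- apply: aecS Gk => t _ ->; rewrite /= /conjf !conjcM !conjcK exprS.
  have -> : (expi t)^* * (theta t * (k t)^*) * (expi t * expi t ^+ n) =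
    ((expi t)^* * expi t) * ((k t)^* * (theta t * expi t ^+ n)) by ring.
  by rewrite expi_conjK mul1r.
Qed.

End inner_theta.
End model_spaces.

(** * The complex exponential *)

Section complex_exponential.
Variable R : realType.
Local Notation C := R[i].
Local Notation modulus := (@ComplexField.Normc.normc R).
Implicit Types (z w : C) (x : R).

Lemma modulus_cexp w : modulus (cexp w) = expR (complex.Re w).
Proof. by rewrite /cexp modulusM modulus_expi mulr1 modulus_real ger0_norm ?expR_ge0. Qed.

Lemma cexpD z w : cexp (z + w) = cexp z * cexp w.
Proof.
rewrite /cexp ReD ImD expRD expiD (rmorphM (real_complex R)).
by ring.
Qed.

Lemma cexp_real x : cexp x%:C = (expR x)%:C.
Proof. by rewrite /cexp /= expi0 mulr1. Qed.

Lemma cexpMn w n : cexp (w *+ n) = cexp w ^+ n.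
Proof.
elim: n => [|n IH]; first by rewrite mulr0n expr0 -[0]/(0%:C) cexp_real expR0.
by rewrite mulrS cexpD IH exprS.
Qed.

Lemma Re_cexp w : complex.Re (cexp w) = expR (complex.Re w) * cos (complex.Im w).
Proof. by rewrite /cexp ReM /=; ring. Qed.

Lemma Im_cexp w : complex.Im (cexp w) = expR (complex.Re w) * sin (complex.Im w).
Proof. by rewrite /cexp ImM /=; ring. Qed.

Lemma cmeas_cexp (f : R -> C) : cmeasurable f -> cmeasurable (fun t => cexp (f t)).
Proof.
move=> [f1 f2]; split.
- under eq_fun do rewrite Re_cexp.
  apply: measurable_funM.
    by apply: (measurableT_comp (@measurable_expR R)).
  by apply: (measurableT_comp (continuous_measurable_fun (@continuous_cos R))).
- under eq_fun do rewrite Im_cexp.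
  apply: measurable_funM.
    by apply: (measurableT_comp (@measurable_expR R)).
  by apply: (measurableT_comp (continuous_measurable_fun (@continuous_sin R))).
Qed.

Lemma ccvg_cexp (T : Type) (F : set_system T) {FF : Filter F} (u : T -> C) a :
  ccvg F u a -> ccvg F (fun i => cexp (u i)) (cexp a).
Proof.
move=> /ccvgP[ru iu].
have e1 := cvg_comp _ _ ru (@continuous_expR R (complex.Re a)).
have c1 := cvg_comp _ _ iu (@continuous_cos R (complex.Im a)).
have s1 := cvg_comp _ _ iu (@continuous_sin R (complex.Im a)).
apply/ccvgP; split.
- by rewrite Re_cexp; under eq_fun do rewrite Re_cexp; exact: cvgM e1 c1.
- by rewrite Im_cexp; under eq_fun do rewrite Im_cexp; exact: cvgM e1 s1.
Qed.

Lemma derivative_harmonic (f : R -> R) (d : R) : is_derive (0 : R) (1 : R) f d ->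
  n.+1%:R * (f n.+1%:R^-1 - f 0) @[n --> \oo] --> d.
Proof.
move=> [df <-]; move/derivable1P : (df) => df'.
have h0 : (harmonic : nat -> R) @ \oo --> (0 : R)^'.
  move=> A [e /= e0 eA]; have := @cvg_harmonic R.
  move/cvgrPdist_lt => /(_ e e0); apply: filterS => n hn.
  by apply: eA => //=; rewrite /harmonic/= gt_eqF// invr_gt0 ltr0n.
have := cvg_comp _ _ h0 df.
rewrite -/('D_1 f 0).
have -> : (fun h : R => h^-1 *: ((f \o shift 0) (h *: 1) - f 0)) \o harmonic =
  (fun n => n.+1%:R * (f n.+1%:R^-1 - f 0)) => //.
by apply/funext => n; rewrite /= /harmonic/= invrK addr0 /GRing.scale/= mulr1.
Qed.

Lemma exprB_le (a b : C) (M : R) n : modulus a <= M -> modulus b <= M -> 0 <= M ->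
  modulus (a ^+ n.+1 - b ^+ n.+1) <= n.+1%:R * M ^+ n * modulus (a - b).
Proof.
move=> aM bM M0; rewrite subrXX modulusM mulrC.
rewrite ler_wpM2r ?modulus_ge0//; apply: (le_trans (modulus_sum _ _ _)).
apply: (@le_trans _ _ (\sum_(i < n.+1) M ^+ n)); last first.
  by rewrite sumr_const card_ord mulr_natl.
apply: ler_sum => i _; rewrite modulusM !modulusX.
have -> : M ^+ n = M ^+ (n.+1.-1 - i) * M ^+ i.
  have iN : (i <= n)%N by rewrite -ltnS; exact: ltn_ord.
  by rewrite -exprD subnK.
by apply: ler_pM; rewrite ?exprn_ge0 ?modulus_ge0 ?lerXn2r ?nnegrE ?modulus_ge0.
Qed.

(** Euler's limit, from the derivative at 0 of s |-> cexp (s w). *)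
Lemma cexp_limit w : ccvg \oo (fun n => (1 + w / n.+1%:R) ^+ n.+1) (cexp w).
Proof.
set x := complex.Re w; set y := complex.Im w.
have nR n : n.+1%:R = (n.+1%:R : R)%:C :> C by rewrite (rmorph_nat (real_complex R)).
have wn n : w / n.+1%:R = (n.+1%:R^-1 : R)%:C * w.
  by rewrite nR -(fmorphV (real_complex R)) mulrC.
have dcos : is_derive (0 : R) (1 : R) (fun s : R => expR (s * x) * cos (s * y)) x.
  apply: is_derive_eq; rewrite /GRing.scale/= !mul0r expR0 cos0 sin0.
  by rewrite !(mulr0, mul0r, mulr1, mul1r, addr0, add0r, oppr0).
have dsin : is_derive (0 : R) (1 : R) (fun s : R => expR (s * x) * sin (s * y)) y.
  apply: is_derive_eq; rewrite /GRing.scale/= !mul0r expR0 cos0 sin0.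
  by rewrite !(mulr0, mul0r, mulr1, mul1r, addr0, add0r, oppr0).
have lim : ccvg \oo (fun n => n.+1%:R * (cexp (w / n.+1%:R) - 1)) w.
  apply/ccvgP; split.
  - have -> : (fun n => complex.Re (n.+1%:R * (cexp (w / n.+1%:R) - 1))) =
      (fun n => n.+1%:R * (expR (n.+1%:R^-1 * x) * cos (n.+1%:R^-1 * y) -
                           expR (0 * x) * cos (0 * y))).
      apply/funext => n; rewrite wn nR ReM ReD Re_cexp ReM ImM /=.
      by rewrite !mul0r expR0 cos0 !subr0 addr0 mulr1.
    exact: derivative_harmonic dcos.
  - have -> : (fun n => complex.Im (n.+1%:R * (cexp (w / n.+1%:R) - 1))) =
      (fun n => n.+1%:R * (expR (n.+1%:R^-1 * x) * sin (n.+1%:R^-1 * y) -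
                           expR (0 * x) * sin (0 * y))).
      apply/funext => n; rewrite wn nR ImM ImD Im_cexp ReM ImM /=.
      by rewrite !mul0r expR0 sin0 !subr0 !addr0 mulr0 subr0.
    exact: derivative_harmonic dsin.
have mw := modulus_ge0 w.
have lim2 : expR (modulus w) * modulus (n.+1%:R * (cexp (w / n.+1%:R) - 1) - w)
    @[n --> \oo] --> (0 : R).
  by rewrite -(mulr0 (expR (modulus w))); apply: cvgMl_tmp; exact: lim.
apply: cvg0_le lim2 => n; rewrite modulus_ge0 andTb.
have n0 : (n.+1%:R : C) != 0 by rewrite pnatr_eq0.
have ninv : 0 <= (n.+1%:R : R)^-1 by rewrite invr_ge0.
have mwn : modulus (w / n.+1%:R) = modulus w / n.+1%:R.
  by rewrite wn modulusM modulus_real ger0_norm// mulrC.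
have E : cexp w = cexp (w / n.+1%:R) ^+ n.+1.
  by rewrite -cexpMn -[w / _ *+ _]mulr_natr divfK.
rewrite E modulus_distC.
pose M := expR (modulus w / n.+1%:R).
have aM : modulus (cexp (w / n.+1%:R)) <= M.
  rewrite modulus_cexp ler_expR -mwn; apply: le_trans (Re_le_modulus _); exact: ler_norm.
have bM : modulus (1 + w / n.+1%:R) <= M.
  apply: (le_trans (modulusD _ _)); rewrite modulus1 mwn; exact: expR_ge1Dx.
apply: (le_trans (exprB_le n aM bM (expR_ge0 _))).
have -> : n.+1%:R * (cexp (w / n.+1%:R) - 1) - w =
  n.+1%:R * (cexp (w / n.+1%:R) - (1 + w / n.+1%:R)).
  by rewrite opprD addrA [in RHS]mulrBr [n.+1%:R * (w / _)]mulrCA divff// mulr1.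
rewrite modulusM nR modulus_real ger0_norm// -nR.
rewrite mulrAC mulrC ler_wpM2r ?mulr_ge0 ?modulus_ge0//.
rewrite /M -expRM_natl ler_expR -[leRHS]mulr1 mulrCA ler_wpM2l//.
by rewrite ler_pdivrMr ?ltr0n// mul1r ler_nat.
Qed.

End complex_exponential.

(** * Exponentials of Herglotz integrals *)

Section outer_functions.
Variable R : realType.
Local Notation C := R[i].
Local Notation modulus := (@ComplexField.Normc.normc R).
Implicit Types (f g h : R -> C) (s t r e : R) (z v w : C) (chi : R -> R).

(** What is needed of the boundary values of a bounded analytic function with
    value v at 0; the point is that this passes to bounded pointwise limits.
    *)
Definition analytic_mean g v :=
  (forall n, cintegral (fun t => g t * expi t ^+ n.+1) = 0) /\ cintegral g = v.

Lemma analytic_mean_poly (p : {poly C}) : analytic_mean (fun t => p.[expi t]) p.[0].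
Proof.
split=> [n|]; first exact: (hardy_poly p).2.
have := cintegralM_poly p (cint_cst (1 : C)).
have -> : cintegral (fun t => 1 * p.[expi t]) = cintegral (fun t => p.[expi t]).
  by apply: cintegral_eq => t _; rewrite mul1r.
move=> ->; rewrite horner_coef; apply: eq_bigr => -[[|i] ilt] _ /=.
  rewrite !expr0; congr (_ * _); rewrite -[RHS](cintegral_cst (1 : C)).
  by apply: cintegral_eq => t _; rewrite mulr1.
rewrite expr0n mulr0; have := cintegral_expiX R i => h.
rewrite -[RHS](mulr0 p`_i.+1) -h; congr (_ * _).
by apply: cintegral_eq => t _; rewrite mul1r.
Qed.

Lemma analytic_meanZ (c : C) g v : cint g -> analytic_mean g v ->
  analytic_mean (fun t => c * g t) (c * v).
Proof.
move=> gi [gn gv]; split=> [n|]; last by rewrite cintegralZ// gv.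
rewrite -[RHS](mulr0 c) -(gn n) -cintegralZ; last exact: cint_expiX.
by apply: cintegral_eq => t _; rewrite mulrA.
Qed.

Lemma analytic_mean_limit (u : nat -> R -> C) g (v_ : nat -> C) v (K : R) :
  (forall n, cmeasurable (u n)) -> cmeasurable g ->
  (forall n, aec (fun t => modulus (u n t) <= K)) ->
  aec (fun t => ccvg \oo (u ^~ t) (g t)) -> ccvg \oo v_ v ->
  (forall n, analytic_mean (u n) (v_ n)) -> analytic_mean g v.
Proof.
move=> mu' mg uK ug vv uv; split=> [n|].
- have [|||||_ h] := @cintegral_dct R (fun k t => u k t * expi t ^+ n.+1)
    (fun t => g t * expi t ^+ n.+1) (fun=> K).
  + by move=> k; apply: cmeasM => //; exact: cmeas_expiX.
  + by apply: cmeasM => //; exact: cmeas_expiX.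
  + exact: rint_cst.
  + by move=> k; apply: aecS (uK k) => t _; rewrite modulusM modulus_expiX mulr1.
  + by apply: aecS ug => t _ ct; apply: ccvgM => //; exact: ccvg_cst.
  apply: ccvg_unique h _; under eq_fun do rewrite (uv _).1; exact: ccvg_cst.
- have [_ h] := cintegral_dct mu' mg (rint_cst K) uK ug.
  by apply: ccvg_unique h _; under eq_fun do rewrite (uv _).2.
Qed.

(** The exponent in outer_disc. *)
Definition herglotz chi z :=
  cintegral (fun t => (expi t + z) / (expi t - z) * (chi t)%:C).

Lemma herglotz_kernel z s : modulus z < 1 ->
  (expi s + z) / (expi s - z) = 2 * cauchy_kernel z s - 1.
Proof.
move=> z1; rewrite /cauchy_kernel; set w := z * (expi s)^*.
have ze : z = w * expi s by rewrite /w -mulrA expi_conjK mulr1.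
have w1 : modulus w < 1 by rewrite modulus_rot.
have d0 := one_sub_neq0 w1.
have e0 : expi s != 0 :> C.
  by apply/eqP => h; have := modulus_expi s; rewrite h modulus0 => /eqP; rewrite eq_sym oner_eq0.
rewrite ze -[X in (X + _) / _]mul1r -[X in _ / (X - _)]mul1r -mulrDl -mulrBl.
by rewrite -mulf_div divff// mulr1; field.
Qed.

Lemma cint_realC chi : rint chi -> cint (fun t => (chi t)%:C).
Proof. by move=> ci; split => //=; exact: rint_cst. Qed.

Lemma cint_herglotz chi z : rint chi -> modulus z < 1 ->
  cint (fun t => (expi t + z) / (expi t - z) * (chi t)%:C).
Proof.
move=> ci z1; have cc := cint_realC ci.
have -> : (fun t => (expi t + z) / (expi t - z) * (chi t)%:C) =
  (fun t => 2 * ((chi t)%:C * cauchy_kernel z t) - (chi t)%:C).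
  by apply/funext => t; rewrite herglotz_kernel//; ring.
by apply: cintB => //; apply: cintZ; exact: cint_cauchy.
Qed.

Lemma herglotz_cauchy chi z : rint chi -> modulus z < 1 ->
  herglotz chi z = 2 * cauchy (fun t => (chi t)%:C) z - (rmean chi)%:C.
Proof.
move=> ci z1; have cc := cint_realC ci.
rewrite -cintegral_real -cintegralZ; last exact: cint_cauchy.
rewrite -cintegralB//; last by apply: cintZ; exact: cint_cauchy.
by apply: cintegral_eq => t _; rewrite herglotz_kernel//; ring.
Qed.

Lemma herglotzD chi chi' z : rint chi -> rint chi' -> modulus z < 1 ->
  herglotz (fun t => chi t + chi' t) z = herglotz chi z + herglotz chi' z.
Proof.
move=> ci ci' z1; rewrite /herglotz -cintegralD; do ?exact: cint_herglotz.
by apply: cintegral_eq => t _; rewrite (rmorphD (real_complex R)) mulrDr.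
Qed.

Lemma poisson_Re z s : modulus z < 1 ->
  poisson z s = complex.Re ((expi s + z) / (expi s - z)).
Proof.
move=> z1; rewrite herglotz_kernel//.
have -> : poisson z s = complex.Re (poisson z s)%:C by [].
rewrite poissonE//; set k := cauchy_kernel z s.
have w1 : modulus (z^* * expi s) < 1 by rewrite modulusM modulus_conj modulus_expi mulr1.
have d0 := one_sub_neq0 w1.
have kE : k^* = (1 - z^* * expi s)^-1.
  by rewrite /k /cauchy_kernel conjc_inv conjcB conjc1 conjcM conjcK.
have -> : (z^* * expi s) * (1 - z^* * expi s)^-1 = k^* - 1 by rewrite kE; field.
by rewrite !ReD !ReN Re_conj ReM /=; ring.
Qed.

Lemma Re_herglotz chi z : rint chi -> modulus z < 1 ->
  complex.Re (herglotz chi z) = rmean (fun s => poisson z s * chi s).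
Proof.
move=> ci z1; rewrite Re_cintegral; apply: rmean_eq => s _.
by rewrite ReM /= mulr0 subr0 -poisson_Re.
Qed.

Lemma herglotz_le chi z (L : R) : rint chi -> aec (fun t => chi t <= L) ->
  modulus z < 1 -> complex.Re (herglotz chi z) <= L.
Proof.
move=> ci cL z1; rewrite Re_herglotz//.
have pi1 : rint (poisson z).
  by have := rint_poisson (rint_cst (1 : R)) z1; under eq_fun do rewrite mulr1.
rewrite -[leRHS]mulr1 -(rmean_poisson z1) -rmeanZ//.
apply: rmean_le; [exact: rint_poisson|exact: rintZ|].
by apply: aecS cL => s _ h; rewrite mulrC ler_wpM2r// poisson_ge0.
Qed.

(** On a smaller circle the Herglotz integral is a bounded limit of
    polynomials, hence so is its exponential, by Euler's limit. *)
Lemma analytic_mean_herglotz chi r : rint chi -> 0 <= r < 1 ->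
  cmeasurable (fun t => cexp (herglotz chi (r%:C * expi t))) /\
  analytic_mean (fun t => cexp (herglotz chi (r%:C * expi t))) (expR (rmean chi))%:C.
Proof.
move=> ci r01; have /andP[r0 r1] := r01.
have z1 t : modulus (r%:C * expi t) < 1 by rewrite modulus_radial.
set f := fun t => (chi t)%:C; have fi : cint f := cint_realC ci.
have ps := cauchy_series fi.
pose m : C := (rmean chi)%:C.
pose H t := herglotz chi (r%:C * expi t).
have HE t : H t = 2 * cauchy f (r%:C * expi t) - m by rewrite /H herglotz_cauchy.
pose q n : {poly C} := 2 *: \poly_(k < n) dilate (fcoef f) r k - m%:P.
have qE n t : (q n).[expi t] = 2 * block (dilate (fcoef f) r) 0 n t - m.
  by rewrite /q hornerD hornerN hornerC hornerZ block_poly.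
have qH t : ccvg \oo (fun n => (q n).[expi t]) (H t).
  rewrite HE; under eq_fun do rewrite qE.
  apply: ccvgB; last exact: ccvg_cst.
  by apply: ccvgM; [exact: ccvg_cst|exact: dilate_cvg].
have [K0 hK0] := dilate_bounded ps r01.
pose K := 2 * K0 + modulus m.
have K00 : 0 <= K0 by apply: le_trans (hK0 0%N 0); exact: modulus_ge0.
have K1 : 0 <= K by rewrite addr_ge0 ?modulus_ge0// mulr_ge0.
have qK n t : modulus (q n).[expi t] <= K.
  rewrite qE; apply: (le_trans (modulusB _ _)); rewrite lerD2r modulusM.
  have -> : modulus 2 = 2.
    by rewrite -(rmorph_nat (real_complex R)) modulus_real ger0_norm.
  by rewrite ler_pM2l.
have mH : cmeasurable H.
  apply: (cmeas_lim (u := fun n t => (q n).[expi t])) => // n.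
  exact: L2_measurable (L2_poly _).
(* The polynomial q 0 is excluded, since it lacks the term of degree 0. *)
have q0 n : (0 < n)%N -> (q n).[0] = m.
  move=> n0; rewrite /q hornerD hornerN hornerC hornerZ horner_poly.
  have -> : \sum_(i < n) dilate (fcoef f) r i * 0 ^+ i = m.
    case: n n0 => // n _; rewrite big_ord_recl big1 => [|i _]; last first.
      by rewrite lift0 expr0n mulr0.
    rewrite addr0 expr0 mulr1 /dilate expr0 mulr1 /m -cintegral_real /fcoef inner_prodE.
    by apply: cintegral_eq => t _; rewrite expr0 conjc1 mulr1.
  by ring.
have nR (n : nat) : n.+1%:R = (n.+1%:R : R)%:C :> C by rewrite (rmorph_nat (real_complex R)).
have mn (n : nat) : modulus (n.+1%:R : C)^-1 = n.+1%:R^-1.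
  by rewrite modulusV nR modulus_real ger0_norm.
have step N : analytic_mean (fun t => (1 + H t / N.+1%:R) ^+ N.+1) ((1 + m / N.+1%:R) ^+ N.+1).
  pose P n : {poly C} := (1 + N.+1%:R^-1 *: q n.+1) ^+ N.+1.
  have PE n z : (P n).[z] = (1 + (q n.+1).[z] / N.+1%:R) ^+ N.+1.
    by rewrite /P horner_exp hornerD hornerZ hornerC mulrC.
  apply: (@analytic_mean_limit (fun n t => (P n).[expi t]) _
     (fun=> (1 + m / N.+1%:R) ^+ N.+1) _ ((1 + K / N.+1%:R) ^+ N.+1)).
  - by move=> n; exact: L2_measurable (L2_poly _).
  - apply: cmeasX; apply: cmeasD; first exact: cmeas_cst.
    by apply: cmeasM => //; exact: cmeas_cst.
  - move=> n; apply: aecW => t _; rewrite PE modulusX.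
    rewrite lerXn2r ?nnegrE ?modulus_ge0 ?addr_ge0 ?divr_ge0//.
    apply: (le_trans (modulusD _ _)); rewrite modulus1 lerD2l modulusM mn.
    by rewrite ler_wpM2r ?invr_ge0.
  - apply: aecW => t _; under eq_fun do rewrite PE.
    have h : ccvg \oo (fun n => 1 + (q n.+1).[expi t] / N.+1%:R) (1 + H t / N.+1%:R).
      apply: ccvgD; first exact: ccvg_cst.
      apply: ccvgM; last exact: ccvg_cst.
      by have := qH t; rewrite /ccvg -(cvg_shiftS (fun n => modulus ((q n).[expi t] - H t))).
    exact: ccvgX.
  - exact: ccvg_cst.
  - move=> n; have := analytic_mean_poly (P n); rewrite PE q0//.
have HK t : modulus (H t) <= K.
  apply/ler_addgt0Pr => e e0.
  have [n _ /(_ n (leqnn n)) hn] := ccvg_near e0 (qH t).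
  have -> : H t = (q n).[expi t] - ((q n).[expi t] - H t) by ring.
  by apply: (le_trans (modulusB _ _)); apply: lerD (qK n t) (ltW hn).
split; first exact: cmeas_cexp.
apply: (@analytic_mean_limit (fun n t => (1 + H t / n.+1%:R) ^+ n.+1) _
     (fun n => (1 + m / n.+1%:R) ^+ n.+1) _ (expR K)).
- move=> n; apply: cmeasX; apply: cmeasD; first exact: cmeas_cst.
  by apply: cmeasM => //; exact: cmeas_cst.
- exact: cmeas_cexp.
- move=> n; apply: aecW => t _; rewrite modulusX.
  apply: (@le_trans _ _ (expR (K / n.+1%:R) ^+ n.+1)).
    rewrite lerXn2r ?nnegrE ?modulus_ge0 ?expR_ge0//.
    apply: le_trans (expR_ge1Dx _); apply: (le_trans (modulusD _ _)).
    by rewrite modulus1 lerD2l modulusM mn ler_wpM2r ?invr_ge0.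
  by rewrite -expRM_natl ler_expR mulrC divfK.
- by apply: aecW => t _; exact: cexp_limit.
- by rewrite -cexp_real; exact: cexp_limit.
- exact: step.
Qed.

(** Let r tend to 1 in the previous lemma, by dominated convergence. *)
Lemma bounded_exponential chi (c : C) f (B : R) : modulus c = 1 -> rint chi -> cmeasurable f ->
  (forall z, modulus z < 1 -> modulus (c * cexp (herglotz chi z)) <= B) ->
  boundary (fun z => c * cexp (herglotz chi z)) f ->
  [/\ aec (fun t => modulus (f t) <= B), hardy f &
      cintegral f = c * (expR (rmean chi))%:C].
Proof.
move=> c1 ci mf FB bf.
have cv := boundary_radius bf.
have z1 n t : modulus ((radius R n)%:C * expi t) < 1.
  by have /andP[r0 r1] := radius_itv R n; rewrite modulus_radial.
have fB : aec (fun t => modulus (f t) <= B).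
  apply: aecS cv => t _ h.
  by apply: (ler_cvg_to (ccvg_modulus h) (cvg_cst _)); apply: nearW => n; exact: FB.
have [fn fm] : analytic_mean f (c * (expR (rmean chi))%:C).
  apply: (@analytic_mean_limit (fun n t => c * cexp (herglotz chi ((radius R n)%:C * expi t)))
     _ (fun=> c * (expR (rmean chi))%:C) _ B) => //.
  - move=> n; have [m _] := analytic_mean_herglotz ci (radius_itv R n).
    by apply: cmeasM => //; exact: cmeas_cst.
  - by move=> n; apply: aecW => t _; exact: FB.
  - exact: ccvg_cst.
  - move=> n; have [m am] := analytic_mean_herglotz ci (radius_itv R n).
    apply: analytic_meanZ => //.
    apply: (cint_bounded (M := B) m); apply: aecW => t _.
    by have := FB _ (z1 n t); rewrite modulusM c1 mul1r.
split=> //; split=> //.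
by apply: Linf_L2; split=> //; exists B.
Qed.

End outer_functions.

(** * Outer functions *)

Section outer_cyclicity.
Variable R : realType.
Local Notation C := R[i].
Local Notation modulus := (@ComplexField.Normc.normc R).
Local Notation circ := (@circ R).
Implicit Types (f g h : R -> C) (s t r e : R) (z v w : C) (chi : R -> R).

(** The modulus of the exponential of a Herglotz integral is the exponential
    of a Poisson integral, to which Fatou's theorem applies. *)
Lemma modulus_outer_boundary (c : C) chi f : modulus c = 1 -> rint chi ->
  boundary (fun z => c * cexp (herglotz chi z)) f ->
  aec (fun t => modulus (f t) = expR (chi t)).
Proof.
move=> c1 ci bf; apply: aecS2 bf (poisson_radial_limit ci) => t _ h1 h2.
have l1 := ccvg_modulus h1.
have l2 := cvg_comp _ _ h2 (@continuous_expR R (chi t)).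
have l3 : modulus (c * cexp (herglotz chi (r%:C * expi t))) @[r --> 1^'-] -->
    expR (chi t).
  apply: cvg_trans l2; apply: near_eq_cvg.
  apply: filterS (near_radius R) => r /andP[r0 r1].
  by rewrite /= modulusM c1 mul1r modulus_cexp Re_herglotz// modulus_radial.
exact: cvg_unique (l1 _) l3.
Qed.

(** The Herglotz integral of chi is an affine function of its Cauchy integral,
    which is also the Cauchy integral of the projection of chi onto H2. *)
Lemma bounded_herglotz_boundary chi (M : R) : measurable_fun circ chi ->
  aec (fun t => `|chi t| <= M) ->
  exists2 f, cmeasurable f & boundary (herglotz chi) f.
Proof.
move=> mchi chiM.
have ci : rint chi by exact: rint_dom (rint_cst M) chiM.
have c2 : L2 (fun t => (chi t)%:C).
  apply: Linf_L2; split; first exact: cmeas_real.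
  by exists M; apply: aecS chiM => t _; rewrite modulus_real.
have [g gh gc] := riesz_projection c2.
have fi := cint_realC ci; have gi := L2_cint gh.1.
have E z : modulus z < 1 -> cauchy g z = cauchy (fun t => (chi t)%:C) z.
  move=> z1; apply: ccvg_unique (cauchy_series gi z1) _.
  by under eq_fun do under eq_bigr do rewrite gc; exact: cauchy_series fi z z1.
exists (fun t => 2 * g t - (rmean chi)%:C).
  apply: cmeasB; last exact: cmeas_cst.
  by apply: cmeasM; [exact: cmeas_cst|exact: L2_measurable gh.1].
apply: aecS (boundary_cauchy gh) => t _ h.
apply: (@near_eq_ccvg _ _ _ _ _ (fun r : R => 2 * cauchy g (r%:C * expi t) - (rmean chi)%:C)).
  apply: filterS (near_radius R) => r /andP[r0 r1].
  have z1 : modulus (r%:C * expi t) < 1 by rewrite modulus_radial.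
  by rewrite herglotz_cauchy// E.
apply: ccvgB; last exact: ccvg_cst.
by apply: ccvgM => //; exact: ccvg_cst.
Qed.

Lemma boundaryM (F G : C -> C) f g : boundary F f -> boundary G g ->
  boundary (fun z => F z * G z) (fun t => f t * g t).
Proof. by move=> Ff Gg; apply: aecS2 Ff Gg => t _ h1 h2; exact: ccvgM. Qed.

Lemma boundary_near (F G : C -> C) f : (forall z, modulus z < 1 -> F z = G z) ->
  boundary G f -> boundary F f.
Proof.
move=> FG; apply: aecS => t _; apply: near_eq_ccvg.
apply: filterS (near_radius R) => r /andP[r0 r1].
by rewrite FG// modulus_radial.
Qed.

Section outer_function.
Variable O : R -> C.
Hypotheses (O_outer : outer_function O) (O_bounded : Linfty O).

Lemma outer_representation : exists (c : C) (chi : R -> R) (L : R),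
  [/\ modulus c = 1, rint chi, 0 <= L, aec (fun t => chi t <= L) &
      boundary (fun z => c * cexp (herglotz chi z)) O].
Proof.
have [mO [c [phi [c1 mphi phi0 lphi bO]]]] := O_outer.
exists c, (fun t => ln (phi t)).
have [_ [M OM]] := O_bounded.
have bO' : boundary (fun z => c * cexp (herglotz (fun t => ln (phi t)) z)) O by exact: bO.
exists (Num.max M 0); split=> //; first by rewrite le_max lexx orbT.
apply: aecS2 OM (modulus_outer_boundary c1 lphi bO') => t _ h1 h2.
rewrite le_max; apply/orP; left; apply: le_trans h1.
by rewrite h2; apply: le_trans (expR_ge1Dx _); rewrite lerDr.
Qed.

Lemma outer_hardy : hardy O.
Proof.
have [c [chi [L [c1 ci _ cL bO]]]] := outer_representation.
have [_ h _] : [/\ aec (fun t => modulus (O t) <= expR L), hardy O &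
      cintegral O = c * (expR (rmean chi))%:C].
  apply: bounded_exponential => //; first exact: O_bounded.1.
  by move=> z z1; rewrite modulusM c1 mul1r modulus_cexp ler_expR herglotz_le.
by [].
Qed.

Lemma outer_neq0 : aec (fun t => O t != 0).
Proof.
have [c [chi [L [c1 ci _ _ bO]]]] := outer_representation.
apply: aecS (modulus_outer_boundary c1 ci bO) => t _ h.
by apply/eqP => O0; move: h; rewrite O0 modulus0 => /esym/eqP; rewrite gt_eqF// expR_gt0.
Qed.

Lemma rmean_truncation chi : rint chi ->
  rmean (fun t => chi t + Num.min (- chi t) n%:R) @[n --> \oo] --> (0 : R).
Proof.
move=> ci; have mc := rint_measurable ci.
apply: (rmean_dct (g := fun t => `|chi t|)).
- move=> n; apply: measurable_funD => //; apply: measurable_minr; last exact: measurable_cst.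
  exact: measurable_funN.
- exact: rint_abs.
- move=> n; apply: aecW => t _; have n0 : 0 <= n%:R :> R by [].
  have [c0|c0] := leP 0 (chi t).
    by rewrite min_l ?subrr ?normr0//; lra.
  have m0 : 0 <= Num.min (- chi t) n%:R by rewrite le_min n0 andbT; lra.
  have m1 : Num.min (- chi t) n%:R <= - chi t by rewrite ge_min lexx.
  by rewrite (ltr0_norm c0) ler_norml; apply/andP; split; lra.
- apply: aecW => t _; apply: cvg_near_cst; exists (Num.bound `|chi t|) => // n /= bn.
  have h : `|chi t| < n%:R.
    by apply: (lt_le_trans (archi_boundP _)) => //; rewrite ler_nat.
  rewrite min_l ?subrr// ltW// (le_lt_trans _ h)// -normrN; exact: ler_norm.
Qed.

(** With n large, truncating log (1/|O|) at height n gives a bounded analytic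
    g such that O g = c exp (H min (log |O| + n, 0)), where H is the Herglotz
    integral and |c| = 1. Then |O g| is at most 1, and the mean of O g, which
    is c exp of the mean of min (log |O| + n, 0), is close to c: this forces O
    g to be close to c in L2. The witness is conj(c) g. *)
Lemma outer_cyclic (e : R) : 0 < e ->
  exists2 h, Linfty h /\ hardy h & nsq (fun t => O t * h t - 1) < e.
Proof.
move=> e0; have [c [chi [L [c1 ci L0 cL bO]]]] := outer_representation.
have [n hn] : exists n, 2 - 2 * expR (rmean (fun t => chi t + Num.min (- chi t) n%:R)) < e.
  have h := cvg_comp _ _ (rmean_truncation ci) (@continuous_expR R 0).
  move: h; rewrite expR0 => /cvgrPdist_lt/(_ (e / 2) ltac:(by rewrite divr_gt0)).
  move=> [n _ /(_ n (leqnn n))] /=; rewrite ltr_norml => /andP[_ h]; exists n.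
  by move: h; lra.
pose psi t := Num.min (- chi t) n%:R.
have mc := rint_measurable ci.
have mpsi : measurable_fun circ psi.
  by apply: measurable_minr; [exact: measurable_funN|exact: measurable_cst].
have n0 : 0 <= n%:R :> R by [].
have psib : aec (fun t => `|psi t| <= L + n%:R).
  apply: aecS cL => t _ h; rewrite ler_norml; apply/andP; split.
    by rewrite /psi le_min; lra.
  by rewrite /psi ge_min; lra.
have psii : rint psi by exact: rint_dom (rint_cst _) psib.
have [U mU bU] := bounded_herglotz_boundary mpsi psib.
have bh : boundary (fun z => 1 * cexp (herglotz psi z)) (fun t => cexp (U t)).
  by apply: aecS bU => t _ h; under eq_fun do rewrite mul1r; exact: ccvg_cexp.
have mh : cmeasurable (fun t => cexp (U t)) by exact: cmeas_cexp.
have [hb hh _] : [/\ aec (fun t => modulus (cexp (U t)) <= expR n%:R),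
    hardy (fun t => cexp (U t)) & cintegral (fun t => cexp (U t)) = 1 * (expR (rmean psi))%:C].
  apply: bounded_exponential => //; first exact: modulus1.
  move=> z z1; rewrite modulusM modulus1 mul1r modulus_cexp ler_expR herglotz_le//.
  by apply: aecW => t _; rewrite /psi ge_min lexx orbT.
have cpi : rint (fun t => chi t + psi t) by exact: rintD.
have mE : cmeasurable (fun t => O t * cexp (U t)) by apply: cmeasM => //; exact: O_bounded.1.
have [Eb Eh Em] : [/\ aec (fun t => modulus (O t * cexp (U t)) <= 1),
    hardy (fun t => O t * cexp (U t)) &
    cintegral (fun t => O t * cexp (U t)) = c * (expR (rmean (fun t => chi t + psi t)))%:C].
  apply: bounded_exponential => //.
    move=> z z1; rewrite modulusM c1 mul1r modulus_cexp -expR0 ler_expR herglotz_le//.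
    apply: aecW => t _; rewrite /psi -lerBrDl sub0r ge_min lexx//.
  apply: boundary_near (boundaryM bO bh) => z z1.
  by rewrite herglotzD// cexpD mul1r mulrA.
(* ||E - c||^2 = ||E||^2 + 1 - 2 Re (conj(c) mean E), where E = O g. *)
have cc : c * c^* = 1 by rewrite mulcJ c1 expr1n.
exists (fun t => c^* * cexp (U t)).
  have hb' : Linfty (fun t => cexp (U t)) by split=> //; exists (expR n%:R).
  split; first by apply: LinfM => //; exact: Linf_cst.
  apply: hardyM => //; first exact: Linf_cst.
  have := hardy_poly (c^*%:P : {poly C}).
  by under eq_fun do rewrite hornerC.
apply: le_lt_trans hn.
have -> : nsq (fun t => O t * (c^* * cexp (U t)) - 1) =
          nsq (fun t => O t * cexp (U t) + (- c)).
  have c1' : modulus c^* = 1 by rewrite modulus_conj.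
  apply: nsq_eq => t _; rewrite -[RHS]mul1r -c1' -modulusM; congr modulus.
  by rewrite mulrDr mulrN [c^* * c]mulrC cc; ring.
have E2 := Eh.1.
rewrite nsqD//; last exact: L2_cst.
have E1 : nsq (fun t => O t * cexp (U t)) <= 1.
  rewrite -[leRHS](rmean_cst (1 : R)); apply: rmean_le; [exact: L2_sqr|exact: rint_cst|].
  by apply: aecS Eb => t _ h; rewrite expr_le1 ?modulus_ge0.
have -> : nsq (fun=> - c) = 1.
  rewrite -[RHS](rmean_cst (1 : R)); apply: rmean_eq => t _.
  by rewrite modulusN c1 expr1n.
have -> : complex.Re (inner_prod (fun t => O t * cexp (U t)) (fun=> - c)) =
          - expR (rmean (fun t => chi t + psi t)).
  have -> : inner_prod (fun t => O t * cexp (U t)) (fun=> - c) =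
            - c^* * cintegral (fun t => O t * cexp (U t)).
    rewrite inner_prodE -cintegralZ; last exact: L2_cint.
    by apply: cintegral_eq => t _; rewrite -[- c]sub0r conjcB conjc0 sub0r mulrC.
  by rewrite Em mulrA mulNr [c^* * c]mulrC cc mulN1r ReN.
by move: E1; lra.
Qed.

End outer_function.
End outer_cyclicity.

(** * The kernel when it contains theta *)

Section kernel_description.
Variable R : realType.
Local Notation C := R[i].
Local Notation modulus := (@ComplexField.Normc.normc R).
Implicit Types (f g h k : R -> C) (t : R).

Variables (theta G I O : R -> C).
Hypotheses (theta_inner : inner_function theta) (G_bounded : Linfty G).
Hypotheses (I_inner : inner_function I) (O_outer : outer_function O).
Hypothesis theta_ker : ker_dual_toeplitz theta G theta.
Hypothesis G_factor : ceq (conjf G) (expi \* (I \* O)).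

Let zI t := expi t * I t.

Lemma Linf_expi : Linfty (@expi R).
Proof. by have := Linf_expiX R 1; under eq_fun do rewrite expr1. Qed.

Lemma hardy_expi : hardy (@expi R).
Proof. by have := hardy_expiX R 1; under eq_fun do rewrite expr1. Qed.

Let zI_bounded : Linfty zI.
Proof. by apply: LinfM; [exact: Linf_expi|exact: inner_Linf]. Qed.

Let zI_hardy : hardy zI.
Proof. by apply: hardyM; [exact: Linf_expi|exact: hardy_expi|exact: inner_hardy]. Qed.

Lemma symbolE : aec (fun t => G t = (zI t * O t)^*).
Proof.
apply: aecS G_factor => t _; rewrite /conjf /= => h.
by rewrite -[LHS]conjcK h /zI mulrA.
Qed.

Lemma modulus_symbol : aec (fun t => modulus (G t) = modulus (O t)).
Proof.
case: I_inner => _; apply: aecS2 symbolE => t _ -> I1.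
by rewrite modulus_conj !modulusM modulus_expi I1 !mul1r.
Qed.

Lemma outer_factor_bounded : Linfty O.
Proof.
split; first by case: O_outer.
have [_ [M GM]] := G_bounded; exists M.
by apply: aecS2 modulus_symbol GM => t _ ->.
Qed.

Let O_hardy : hardy O := outer_hardy O_outer outer_factor_bounded.

Lemma symbol_theta_model : model_space theta (fun t => G t * theta t).
Proof. by move/(ker_dual_toeplitzP theta_inner _ G_bounded) : theta_ker => []. Qed.

Lemma symbol_theta_mul_hardy h : hardy h -> hardy (fun t => (G t * theta t) * h t).
Proof.
apply: hardyM; first by apply: LinfM => //; exact: inner_Linf.
exact: model_space_hardy symbol_theta_model.
Qed.

Lemma zIO_mul_hardy h : hardy h -> hardy (fun t => (zI t * O t) * h t).
Proof.
apply: hardyM; first by apply: LinfM => //; exact: outer_factor_bounded.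
exact: hardyM.
Qed.

(** Since G |theta|^2 = conj(z I O), orthogonality of G theta k to theta H2
    amounts to orthogonality of k to z I O H2. *)
Lemma inner_prod_symbol k h : hardy k -> hardy h ->
  inner_prod (fun t => (G t * theta t) * k t) (fun t => theta t * h t) =
  inner_prod k (fun t => zI t * (O t * h t)).
Proof.
move=> kh hh; have mk := L2_measurable kh.1; have mh := L2_measurable hh.1.
have mth := (inner_Linf theta_inner).1; have mG := G_bounded.1.
have mzI := zI_bounded.1; have mO := outer_factor_bounded.1.
rewrite !inner_prodE; apply: cintegral_ae_eq.
- have mGt : cmeasurable (fun t => G t * theta t) by exact: cmeasM.
  by apply: cmeasM; [exact: cmeasM|apply: cmeas_conj; exact: cmeasM].
- by apply: cmeasM => //; apply: cmeas_conj; apply: cmeasM => //; exact: cmeasM.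
- apply: aecS2 symbolE (inner_conjK theta_inner) => t _ -> tt.
  by rewrite /zI !conjcM -[RHS]mul1r -tt; ring.
Qed.

Lemma ker_of_model_space f : mulset theta (model_space (expi \* I)) f ->
  ker_dual_toeplitz theta G f.
Proof.
move=> [mf [k kK fk]].
have {kK} [kh korth] : hardy k /\ forall h, hardy h -> inner_prod k (fun t => zI t * h t) = 0.
  by apply/(model_spaceP _ zI_bounded); exact: kK.
have mth := (inner_Linf theta_inner).1; have mG := G_bounded.1.
have kf : aec (fun t => theta t * k t = f t) by apply: aecS fk => t _ ->.
apply/ker_dual_toeplitzP => //; split.
  exact: (model_perp_ae_eq theta_inner (model_perp_inner theta_inner kh) mf kf).
apply: (@model_space_ae_eq _ theta (fun t => (G t * theta t) * k t)).
- exact: inner_Linf.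
- apply/model_spaceP; first exact: inner_Linf.
  split=> [|h hh]; first exact: symbol_theta_mul_hardy.
  by rewrite inner_prod_symbol// korth//; apply: hardyM => //; exact: outer_factor_bounded.
- exact: cmeasM.
- by apply: aecS fk => t _ ->; rewrite /= mulrA.
Qed.

(** Write f = (f - P+ f) + P+ f, with P+ the projection onto H2. The second
    term is orthogonal to the model space, hence lies in theta H2. The first
    one vanishes: G (f - P+ f) is in H2, and orthogonal to H2 because
    multiplication by conj(G) = z I O preserves H2; and G vanishes almost
    nowhere. *)
Lemma ker_hardy f : ker_dual_toeplitz theta G f ->
  exists2 q, hardy q & aec (fun t => f t = theta t * q t).
Proof.
move=> /(ker_dual_toeplitzP theta_inner _ G_bounded)[fM GfK].
have f2 := fM.1; have [p [ph fp]] := riesz_orthogonal f2.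
have fp2 := L2B f2 ph.1.
have mG := G_bounded.1; have mf := L2_measurable f2.
have pM : model_perp theta p.
  split; first exact: ph.1.
  move=> k kK; have k2 := (model_space_hardy theta_inner kK).1.
  have := inner_prodBl f2 ph.1 k2; rewrite fp; last exact: model_space_hardy kK.
  have -> : inner_prod f k = 0 by have [_] := fM; exact.
  by rewrite sub0r => /esym/eqP; rewrite oppr_eq0 => /eqP.
have [q qh pq] := hardy_model_perp theta_inner ph pM.
exists q => //.
have Gfh := model_space_hardy theta_inner GfK.
have Gm : hardy (fun t => G t * (f t - p t)).
  apply: hardy_ae_eq (hardyB Gfh (symbol_theta_mul_hardy qh)) _ _.
    by apply: cmeasM => //; apply: cmeasB => //; exact: L2_measurable ph.1.
  by apply: aecS pq => t _ ->; ring.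
have G0 : nsq (fun t => G t * (f t - p t)) <= 0.
  have : inner_prod (fun t => G t * (f t - p t)) (fun t => G t * (f t - p t)) = 0.
    rewrite -[RHS](fp _ (zIO_mul_hardy Gm)) !inner_prodE.
    apply: cintegral_ae_eq.
    - apply: cmeasM; first exact: L2_measurable Gm.1.
      by apply: cmeas_conj; exact: L2_measurable Gm.1.
    - apply: cmeasM; first exact: L2_measurable fp2.
      by apply: cmeas_conj; exact: L2_measurable (zIO_mul_hardy Gm).1.
    - apply: aecS symbolE => t _ Gt.
      by rewrite [in RHS]conjcM -Gt; ring.
  by rewrite inner_prod_nsq => /complexI ->.
have := nsq_eq0 Gm.1 G0 => z0.
have On0 := outer_neq0 O_outer outer_factor_bounded.
have fe : aec (fun t => f t = p t).
  apply: aecS3 z0 modulus_symbol On0 => t _ /eqP + GO /modulus_gt0.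
  rewrite -GO mulf_eq0 => /orP[/eqP ->|]; first by rewrite modulus0 ltxx.
  by rewrite subr_eq0 => /eqP.
by apply: aecS2 fe pq => t _ ->.
Qed.

(** By cyclicity of O, the functions O h with h in H2 may be replaced by
    arbitrary functions of H2. *)
Lemma cancel_outer q : hardy q ->
  (forall h, hardy h -> inner_prod q (fun t => zI t * (O t * h t)) = 0) ->
  model_space zI q.
Proof.
move=> qh qO; apply/(model_spaceP _ zI_bounded); split=> // h hh.
pose w t := zI t * (q t)^*.
have q2 := qh.1; have w2 : L2 w by apply: L2M_bounded => //; exact: L2_conj.
have O2 := O_hardy.1.
have wO g : hardy g -> cintegral (fun t => w t * (O t * g t)) = 0.
  move=> gh; have Ogh : hardy (fun t => O t * g t).
    by apply: hardyM => //; exact: outer_factor_bounded.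
  have := qO g gh; rewrite inner_prodE => e; rewrite -[RHS](conjc0 R) -e.
  rewrite -cintegral_conj; last first.
    by apply: L2_cintM => //; apply: L2_conj; apply: L2M_bounded => //; exact: Ogh.1.
  by apply: cintegral_eq => t _; rewrite /w /zI !conjcM !conjcK; ring.
have wn n : cintegral (fun t => w t * expi t ^+ n) = 0.
  have we2 : L2 (fun t => w t * expi t ^+ n).
    have := L2M_bounded (Linf_expiX R n) w2.
    by under eq_fun do rewrite mulrC.
  transitivity (cintegral (fun t => (w t * expi t ^+ n) * 1)).
    by apply: cintegral_eq => t _; rewrite mulr1.
  apply: pairing_closed => //; first exact: L2_cst.
  move=> e e0; have [g [gb gh] ge] := outer_cyclic O_outer outer_factor_bounded e0.
  exists (fun t => O t * g t); split.
  - by apply: L2M_bounded; [exact: outer_factor_bounded|exact: gh.1].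
  - by rewrite nsq_distC.
  - rewrite -[RHS](wO _ (hardyM (Linf_expiX R n) (hardy_expiX R n) gh)).
    by apply: cintegral_eq => t _; ring.
have := pairing_hardy w2 wn hh => e.
rewrite inner_prodC; last first.
  by apply: L2_cintM; [exact: L2M_bounded hh.1|exact: L2_conj].
rewrite inner_prodE (_ : cintegral _ = 0) ?conjc0// -e.
by apply: cintegral_eq => t _; rewrite /w; ring.
Qed.

Lemma model_space_of_ker f : ker_dual_toeplitz theta G f ->
  mulset theta (model_space (expi \* I)) f.
Proof.
move=> fK; have [q qh fq] := ker_hardy fK.
have [[f2 _] GfK] := iffLR (ker_dual_toeplitzP theta_inner f G_bounded) fK.
split; first exact: L2_measurable.
exists q; last exact: fq.
have GqK : model_space theta (fun t => (G t * theta t) * q t).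
  apply: model_space_ae_eq GfK _ _; first exact: inner_Linf.
    exact: L2_measurable (symbol_theta_mul_hardy qh).1.
  by apply: aecS fq => t _ ->; rewrite mulrA.
apply: cancel_outer => // h hh.
by rewrite -inner_prod_symbol// (model_space_orth theta_inner GqK).
Qed.

End kernel_description.

Theorem theorem4p11 (R : realType) (theta G : R -> R[i])
    (theta_inner : inner_function theta) (G_bounded : Linfty G) :
  ((ker_dual_toeplitz theta G theta <->
    (mulset (conjf theta) (model_space theta) `&` Linfty) G) /\
   (mulset (conjf theta) (model_space theta) `&` Linfty
      `<=` mulset (conjf expi) (@conjf R @` Hinf))) /\
  (ker_dual_toeplitz theta G theta -> ~ ceq G (fun=> 0) ->
   forall I O : R -> R[i], inner_function I -> outer_function O ->
     ceq (conjf G) (expi \* (I \* O)) ->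
     ker_dual_toeplitz theta G = mulset theta (model_space (expi \* I))).
Proof.
split; first split.
- split=> [/(ker_dual_toeplitz_theta theta_inner G_bounded)//|[? _]].
  exact/(ker_dual_toeplitz_theta theta_inner G_bounded).
- move=> H [HK Hb]; split; first exact: Hb.1.
  exists (conjf (fun t => conjc (expi t * H t))).
    exists (fun t => conjc (expi t * H t)) => //.
    exact: (conj_symbol_Hinf theta_inner HK Hb).
  by apply: aecW => t _; rewrite /= /conjf conjcK mulrA expi_conjK mul1r.
- move=> theta_ker _ I O I_inner O_outer G_factor; apply/seteqP; split=> f fK.
  + exact: (model_space_of_ker theta_inner G_bounded I_inner O_outer).
  + exact: (ker_of_model_space theta_inner G_bounded I_inner O_outer).
Qed.
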